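(* Suppose that $f:\mathbb{R}\to\mathbb{R}$ satisfies, for some $\alpha\in(0,1)$, $\|f'\|_{C^{\alpha}(\mathbb{R})}<\infty$, $\inf_{\mathbb{R}}f=b>0$, $f(x)\to1$ as $x\to-\infty$ and $f(x)\to a>0$ as $x\to\infty$. Let $\hat m$ be the critical mass flux of the nozzle, let $\{m_{0,n}\}$ be any sequence in $[0,\hat m)$ with $m_{0,n}\to\hat m$ as $n\to+\infty$, and let $(U_n,V_n)$ be the (axial, radial) velocity of the global axially symmetric uniformly subsonic flow with mass flux $m_{0,n}$. Then there exist a subsequence, still labelled $\{(U_n,V_n)\}$, and functions $U,V$ such that, almost everywhere, $$U_n\to U,\qquad V_n\to V,\qquad g(q_n^2)U_n\to g(q^2)U,\qquad g(q_n^2)V_n\to g(q^2)V,$$ where $q_n^2=U_n^2+V_n^2$ and $q^2=U^2+V^2$. Moreover, this limit yields a three dimensional flow with density $\rho(x,y,z)=g(q^2)(x,r)$ and velocity $$u(x,y,z)=U(x,r),\quad v(x,y,z)=V(x,r)\frac{y}{r},\quad w(x,y,z)=V(x,r)\frac{z}{r},\qquad r=\sqrt{y^2+z^2},$$ which satisfies $$u_y-v_x=0,\quad v_z-w_y=0,\quad w_x-u_z=0\quad\text{in } D$$ in the sense of distributions, and, for any $\eta\in C_c^{\infty}(\bar D)$, $$\iiint_{D}(\rho u,\rho v,\rho w)\cdot\nabla\eta\,dx\,dy\,dz=0 .$$ This implies that $(u,v,w)$ satisfies the boundary condition $(u,v,w)\cdot\vec n=0$ on $\partial D$ as the normal trace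 of the divergence field $(\rho u,\rho v,\rho w)$ on the boundary.
   Context: Nozzle: $D=\{(x,y,z): 0\le\sqrt{y^2+z^2}<f(x),\ -\infty<x<\infty\}$, with outward normal $\vec n$; its half-section is $\Omega=\{(x,r):0<r<f(x),\ -\infty<x<\infty\}$. Gas law: the pressure $p=p(\rho)$ is a fixed smooth function with $p'(\rho)>0$ for $\rho>0$ and $p''(\rho)\ge 0$, nondimensionalized so that the critical speed and critical density are both $1$ (in particular $p'(1)=1$). The function $g$ gives the density in terms of the squared speed, $\rho=g(q^2)$, through Bernoulli's law $\frac{q^2}{2}+\int_1^{\rho}\frac{p'(s)}{s}\,ds=\frac12$; $g$ is decreasing, and the flow is subsonic exactly when $q<1$. An axially symmetric uniformly subsonic flow with mass flux $m_0$ is given by a velocity potential $\Phi$ (unique up to an additive constant) with $\mathrm{div}(g(|\nabla\Phi|^2)\nabla\Phi)=0$ in $D$, $\partial\Phi/\partial n=0$ on $\partial D$, $\int_{S}g(|\nabla\Phi|^2)\frac{\partial\Phi}{\partial\vec l}\,dS=m_0$ (for $S$ any cross-section transversal to the $x$-axis, with unit normal $\vec l$ in the positive axial direction), $\sup_{\bar D}|\nabla\Phi|<1$, and velocity of the form $\Phi_x=U(x,r)$, $\Phi_y=V(x,r)\frac yr$, $\Phi_z=V(x,r)\frac zr$. Critical mass flux: $\hat m>0$ is the value (shown to exist in the paper for such $f$) such that for each $m_0\in[0,\hat m)$ there is a unique axially symmetric uniformly subsonic flow with mass flux $m_0$, and $M(m_0)=\sup_{\bar D}|\nabla\Phi|$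 ranges over $[0,1)$ as $m_0$ varies in $[0,\hat m)$, with $M(m_0)\to1$ as $m_0\to\hat m$. For $0<m_0<\hat m$ these flows have $U>0$ in $\bar D$, flow angle $\omega=\arctan\frac VU$ satisfying $\min\{\inf_x\arctan f'(x),0\}\le\omega\le\max\{\sup_x\arctan f'(x),0\}$, and for every $\underline m\in(0,\hat m)$ there is $\delta>0$ with $|\nabla\Phi|\ge\delta$ for all $m_0\in[\underline m,\hat m)$. *)

(* Defs.v *)
(* MathComp-Analysis; [R] is an arbitrary [realType]. *)
From HB Require Import structures.
From mathcomp Require Import all_boot all_order all_algebra.
From mathcomp Require Import all_classical all_reals all_analysis.
Set Implicit Arguments.
Unset Strict Implicit.
Unset Printing Implicit Defensive.
Import Order.TTheory GRing.Theory Num.Theory.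
Import numFieldNormedType.Exports.
Local Open Scope ring_scope.
Local Open Scope classical_set_scope.

Notation mu1 R := (@lebesgue_measure R).
Notation mu2 R := ((mu1 R \x mu1 R)%E).
Notation mu3 R := ((mu2 R \x mu1 R)%E).

(* Points of space are triples ((x, y), z).  The library norm on products is
   the max norm, so Euclidean lengths are always written with [dot3]. *)
Notation space3 R := (R * R * R)%type.

Section Space.
Context {R : realType}.
Implicit Types (X Y F G : space3 R) (D : set (space3 R)) (phi : space3 R -> R).

Definition xc X : R := X.1.1.
Definition yc X : R := X.1.2.
Definition zc X : R := X.2.

Definition e_x : space3 R := (1, 0, 0).
Definition e_y : space3 R := (0, 1, 0).
Definition e_z : space3 R := (0, 0, 1).

Definition dot3 X Y : R := xc X * xc Y + yc X * yc Y + zc X * zc Y.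

Definition grad phi X : space3 R := ('D_e_x phi X, 'D_e_y phi X, 'D_e_z phi X).

Definition div3 (F : space3 R -> space3 R) X : R :=
  'D_e_x (xc \o F) X + 'D_e_y (yc \o F) X + 'D_e_z (zc \o F) X.

(* class C^k on an open set *)
Fixpoint Ck (k : nat) D phi : Prop :=
  (forall X, D X -> {for X, continuous phi}) /\
  if k is k'.+1 then
    forall e, e \in [:: e_x; e_y; e_z] ->
      (forall X, D X -> derivable phi X e) /\ Ck k' D ('D_e phi)
  else True.

Definition supp phi : set (space3 R) := closure [set X | phi X != 0].

(* C_c^oo(R^3); the elements of C_c^oo(closure D) are the restrictions of
   these functions to closure D *)
Definition test_function phi : Prop :=
  (forall k, Ck k setT phi) /\ compact (supp phi).

(* C_c^oo(D), for D open *)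
Definition test_function_in D phi : Prop :=
  test_function phi /\ supp phi `<=` D.

(* The equation d_a u - d_b v = 0 in the sense of distributions in D *)
Definition distr_eq D (a : space3 R) (u : space3 R -> R)
    (b : space3 R) (v : space3 R -> R) : Prop :=
  forall phi, test_function_in D phi ->
    (\int[mu3 R]_(X in D) (v X * 'D_b phi X - u X * 'D_a phi X)%:E = 0)%E.

(* div F = d in the sense of distributions in D *)
Definition distr_div D (F : space3 R -> space3 R) (d : space3 R -> R) : Prop :=
  forall phi, test_function_in D phi ->
    (\int[mu3 R]_(X in D) (dot3 (F X) (grad phi X) + d X * phi X)%:E = 0)%E.

End Space.

Section Gas.
Context {R : realType}.
Implicit Types p : R -> R.

(* Since the critical speed and density are 1, the squared sound speed p' is 1
   at density 1. *)
Definition gas_law p : Prop :=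
  [/\ forall k rho, 0 < rho -> derivable (derive1n k p) rho 1,
      forall rho, 0 < rho -> 0 < derive1 p rho,
      forall rho, 0 < rho -> 0 <= derive1n 2 p rho &
      derive1 p 1 = 1].

(* oriented integral of p'(s)/s from 1 to rho *)
Definition enthalpy p (rho : R) : R :=
  if 1 <= rho then \int[mu1 R]_(s in `[1, rho]) (derive1 p s / s)
  else - \int[mu1 R]_(s in `[rho, 1]) (derive1 p s / s).

(* The function g: [dens p s] is the density at squared speed [s]; the value 0
   is a default where Bernoulli's law has no solution, which never happens for
   0 <= s <= 1. *)
Definition dens p (s : R) : R :=
  xget 0 [set rho | 0 < rho /\ s / 2 + enthalpy p rho = 1 / 2].

End Gas.

Section Nozzle.
Context {R : realType}.
Implicit Types (p f : R -> R) (U V : R * R -> R) (X : space3 R).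

Definition nozzle_profile f : Prop :=
  [/\ exists2 alpha : R, 0 < alpha < 1 &
        (forall x, derivable f x 1) /\
        exists C : R, forall x y,
          `|derive1 f x| <= C /\
          `|derive1 f x - derive1 f y| <= C * `|x - y| `^ alpha,
      0 < inf (range f),
      f x @[x --> -oo] --> (1 : R) &
      exists2 a : R, 0 < a & f x @[x --> +oo] --> a].

Definition radius X : R := Num.sqrt (yc X ^+ 2 + zc X ^+ 2).

(* the cylindrical coordinates (x, r) *)
Definition cyl X : R * R := (xc X, radius X).

Definition nozzle f : set (space3 R) := [set X | radius X < f (xc X)].

Definition half_section f : set (R * R) := [set P | 0 < P.2 < f P.1].

Definition cross_section f (x : R) : set (R * R) :=
  [set P | nozzle f (x, P.1, P.2)].

(* the boundary of the nozzle, and its outward unit normal *)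
Definition wall f : set (space3 R) := [set X | radius X = f (xc X)].

Definition outward_normal f X : space3 R :=
  let c := Num.sqrt (1 + derive1 f (xc X) ^+ 2) in
  (- derive1 f (xc X) / c, yc X / radius X / c, zc X / radius X / c).

(* integral over the wall, parametrized by (x, theta), where
   dS = f(x) sqrt(1 + f'(x)^2) dx dtheta *)
Definition wall_integral f (h : space3 R -> R) : \bar R :=
  (\int[mu1 R]_x \int[mu1 R]_(t in [set` `[0, 2 * pi]%R])
     (h (x, f x * cos t, f x * sin t)
        * (f x * Num.sqrt (1 + derive1 f x ^+ 2))%R)%:E)%E.

(* On the axis r = 0 the ratios y/r and z/r are 0, hence the transversal
   velocity vanishes there. *)
Definition velocity U V X : space3 R :=
  (U (cyl X), V (cyl X) * (yc X / radius X), V (cyl X) * (zc X / radius X)).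

Definition speed U V X : R :=
  Num.sqrt (dot3 (velocity U V X) (velocity U V X)).

Definition max_speed f U V : \bar R :=
  ereal_sup [set (speed U V X)%:E | X in closure (nozzle f)].

(* Axially symmetric uniformly subsonic flow with mass flux [m], potential
   [Phi] in C^2(D) with gradient continuous up to the boundary, and axial and
   radial velocities [U] and [V].  On [closure (nozzle f)] the gradient is
   given by its continuous extension [velocity U V]. *)
Record subsonic_flow p f (m : R) (Phi : space3 R -> R) U V : Prop := {
  flow_C2 : Ck 2 (nozzle f) Phi ;
  flow_C1_closure : {within closure (nozzle f), continuous (velocity U V)} ;
  flow_grad : forall X, nozzle f X -> grad Phi X = velocity U V X ;
  flow_div : forall X, nozzle f X ->
    div3 (fun Y => dens p (dot3 (grad Phi Y) (grad Phi Y)) *: grad Phi Y) X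
    = 0 ;
  flow_slip : forall X, wall f X ->
    dot3 (velocity U V X) (outward_normal f X) = 0 ;
  flow_flux : forall x : R,
    (\int[mu2 R]_(P in cross_section f x)
      (let G := grad Phi (x, P.1, P.2) in dens p (dot3 G G) * dot3 G e_x)%:E
     = m%:E)%E ;
  flow_subsonic : (max_speed f U V < 1)%E }.

(* [M m] is the maximal speed of the flow with mass flux [m]. *)
Definition critical_mass_flux p f (mhat : R) : Prop :=
  [/\ 0 < mhat,
      forall m : R, 0 <= m < mhat -> exists Phi U V, subsonic_flow p f m Phi U V,
      forall (m : R) Phi U V Phi' U' V', 0 <= m < mhat ->
        subsonic_flow p f m Phi U V -> subsonic_flow p f m Phi' U' V' ->
        exists c, forall X, nozzle f X -> Phi' X = Phi X + c &
      exists M : R -> R,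
        [/\ forall (m : R) Phi U V,
              0 <= m < mhat -> subsonic_flow p f m Phi U V ->
              max_speed f U V = (M m)%:E,
            M @` `[0, mhat[ = `[0, 1[ &
            M m @[m --> mhat^'-] --> (1 : R)]].

Definition flow_density p U V X : R := dens p (U (cyl X) ^+ 2 + V (cyl X) ^+ 2).

(* [h] is the normal trace on the wall of the field [F], whose divergence in
   the nozzle is [d], in the sense of the Gauss-Green formula. *)
Definition normal_trace f (F : space3 R -> space3 R)
    (d h : space3 R -> R) : Prop :=
  distr_div (nozzle f) F d /\
  forall eta, test_function eta ->
    (wall_integral f (fun X => h X * eta X)%R
     = \int[mu3 R]_(X in nozzle f)
         (dot3 (F X) (grad eta X) + d X * eta X)%:E)%E.

End Nozzle.

(* Main.v *)
Require Import Defs.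
From HB Require Import structures.
From mathcomp Require Import all_boot all_order all_algebra.
From mathcomp Require Import all_classical all_reals all_analysis.
From mathcomp Require Import measurable_realfun ring lra.

(** The proof is a monotonicity argument.  At squared speeds up to 1 Bernoulli's
   law defines a density [g >= 1], and the mass flux [F(a) = g(|a|^2) a] is
   strongly monotone on the closed unit ball, the critical speed included:
   [(F(a) - F(b)) . (a - b) >= |a - b|^4 / 8] ([mass_flux_monotone]).  So the
   velocities converge strongly as soon as the potentials converge.

   The potentials, normalized at the origin, are locally bounded and locally
   equi-Lipschitz because the speeds are below 1; by compactness a subsequence
   converges at every point of the nozzle ([potential_limit]).
   Testing the difference of the equations of two flows with a cutoff times the
   difference of their potentials bounds the integral of the cutoff times
   [|v_n - v_n'|^4] by a multiple of the [L^1] distances of the two potentials to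
   their limit on a compact set
   ([gap_estimate]); a fast subsequence of the velocities then converges almost
   everywhere in the nozzle ([velocity_subsequence]).

   The profiles [U] and [V] live on the half-section, a set of dimension two.  A
   subset of it is null as soon as its preimage under cylindrical coordinates is
   null in space: almost every slice [z = const] of the preimage is null, and
   these coordinates act on the slices by Lipschitz maps ([null_of_cyl_null]).

   Each flow satisfies the weak equation even for test functions that do not
   vanish on the wall ([flow_weak_wall]).  Cutting off a layer along the wall
   produces an error term that is the integral of the normal flux against the
   derivative of the cutoff; the normal flux is uniformly small near the wall by
   the slip condition, and the integral of the derivative of the cutoff is
   bounded, by the divergence theorem for the radial field ([layer_bound]).  The
   velocities of the flows are also curl free in the sense of distributions
   ([gradient_curl_free]).  Both equations pass to the limit by dominated
   convergence, and the one up to the wall contains the vanishing of the normal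
   trace. *)

Set Implicit Arguments.
Unset Strict Implicit.
Unset Printing Implicit Defensive.
Import Order.TTheory GRing.Theory Num.Theory.
Import numFieldNormedType.Exports.
Local Open Scope ring_scope.
Local Open Scope classical_set_scope.

Local Notation radius := Defs.radius.

(** * Consequences of the mean value theorem *)
Section MeanValue.
Context {R : realType}.
Implicit Types (h dh : R -> R) (a b : R).

Lemma within_continuous_derive h dh a b :
  (forall x, a <= x <= b -> is_derive x 1 h (dh x)) ->
  {within `[a, b], continuous h}.
Proof.
move=> hd; apply: derivable_within_continuous => x.
by rewrite in_itv /= => /hd [].
Qed.

Lemma le_of_derive_ge0 h dh a b : a <= b ->
  (forall x, a <= x <= b -> is_derive x 1 h (dh x)) ->
  (forall x, a <= x <= b -> 0 <= dh x) -> h a <= h b.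
Proof.
move=> ab hd d0.
have [| |c] := @MVT_segment _ h dh a b ab.
- by move=> x; rewrite in_itv /= => /andP[/ltW ax /ltW xb]; apply: hd; rewrite ax.
- exact: within_continuous_derive hd.
- rewrite in_itv /= => cab e.
  by rewrite -subr_ge0 e mulr_ge0 ?subr_ge0 // d0.
Qed.

Lemma lt_of_derive_gt0 h dh a b : a < b ->
  (forall x, a <= x <= b -> is_derive x 1 h (dh x)) ->
  (forall x, a <= x <= b -> 0 < dh x) -> h a < h b.
Proof.
move=> ab hd d0.
have [| |c] := @MVT_segment _ h dh a b (ltW ab).
- by move=> x; rewrite in_itv /= => /andP[/ltW ax /ltW xb]; apply: hd; rewrite ax.
- exact: within_continuous_derive hd.
- rewrite in_itv /= => cab e.
  by rewrite -subr_gt0 e mulr_gt0 ?subr_gt0 // d0.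
Qed.

Lemma derive_le1_lipschitz h dh a b : a <= b ->
  (forall x, a <= x <= b -> is_derive x 1 h (dh x)) ->
  (forall x, a <= x <= b -> `|dh x| <= 1) -> `|h b - h a| <= b - a.
Proof.
move=> ab hd d1.
have [| |c] := @MVT_segment _ h dh a b ab.
- by move=> x; rewrite in_itv /= => /andP[/ltW ax /ltW xb]; apply: hd; rewrite ax.
- exact: within_continuous_derive hd.
- rewrite in_itv /= => cab ->.
  by rewrite normrM (ger0_norm (_ : 0 <= b - a)) ?subr_ge0 // ler_piMl ?subr_ge0 // d1.
Qed.

End MeanValue.

(** * The density as a function of the squared speed *)
Section GasLaw.
Context {R : realType} (p : R -> R).
Implicit Types rho s t q x y : R.
Hypothesis hp : gas_law p.
Local Notation dp := (derive1 p).
Local Notation H := (enthalpy p).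
Local Notation k := (fun s => dp s / s).

Lemma gas_derive_continuous rho : 0 < rho -> {for rho, continuous dp}.
Proof.
move=> r0; have [/(_ 1%N _ r0) /= d _ _ _] := hp.
by apply/differentiable_continuous/derivable1_diffP.
Qed.

(** [p'] is nondecreasing by convexity, and equals 1 at the critical density. *)
Lemma gas_derive_ge1 rho : 1 <= rho -> 1 <= dp rho.
Proof.
move=> r1; have [d _ dd p1] := hp.
rewrite -[leLHS]p1; apply: (le_of_derive_ge0 (dh := derive1n 2 p) r1) => x /andP[x1 _].
- by rewrite /= derive1E; apply: derivableP; apply: (d 1%N); lra.
- by apply: dd; lra.
Qed.

Let k_continuous rho : 0 < rho -> {for rho, continuous k}.
Proof.
move=> r0; apply: continuousM; first exact: gas_derive_continuous.
by apply: continuousV; [rewrite gt_eqF|exact: cvg_id].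
Qed.

Let k_integrable x y : 0 < x -> (mu1 R).-integrable `[x, y] (EFin \o k).
Proof.
move=> x0; apply: continuous_compact_integrable; first exact: segment_compact.
apply: continuous_in_subspaceT => z; rewrite inE /= in_itv /= => /andP[xz _].
by apply: k_continuous; lra.
Qed.

Let enthalpyB x y : 0 < x -> x <= y -> H y - H x = \int[mu1 R]_(s in `[x, y]) k s.
Proof.
have add a b c : 0 < a -> a <= b -> b <= c ->
    \int[mu1 R]_(s in `[a, c]) k s - \int[mu1 R]_(s in `[a, b]) k s
    = \int[mu1 R]_(s in `[b, c]) k s.
  move=> a0 ab bc; rewrite Rintegral_itvB ?bnd_simp //; last exact: k_integrable.
  rewrite Rintegral_itv_obnd_cbnd //.
  apply: integrableS (k_integrable c a0) => //.
  by apply: subset_itvr; rewrite bnd_simp.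
move=> x0 xy; rewrite /enthalpy; case: (leP 1 y) => y1; case: (leP 1 x) => x1.
- by rewrite (add 1).
- have := add x 1 y x0 (ltW x1) y1; lra.
- by have := lt_le_trans y1 (le_trans x1 xy); rewrite ltxx.
- have := add x y 1 x0 xy (ltW y1); lra.
Qed.

Lemma is_derive_enthalpy rho : 0 < rho -> is_derive rho 1 H (dp rho / rho).
Proof.
move=> r0.
have h0 : 0 < rho / 2 by lra.
have [] := @continuous_FTC1_closed _ k (rho / 2) rho (rho + 1) _ _ _ (k_continuous r0).
- by lra.
- exact: k_integrable.
- by lra.
move=> /derivableP + e; rewrite derive1E in e; rewrite e => d.
have {}d := is_deriveD (is_derive_cst (H (rho / 2)) rho 1) d.
rewrite add0r in d.
apply: (near_eq_is_derive _ d).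
near=> y; rewrite /= !fctE -enthalpyB 1?addrC ?subrK //.
by apply: ltW; near: y; apply: lt_nbhsr; lra.
Unshelve. all: by end_near. Qed.

Lemma enthalpy1 : H 1 = 0.
Proof. by rewrite /enthalpy lexx set_itv1 Rintegral_set1. Qed.

Lemma enthalpy_lt x y : 0 < x -> x < y -> H x < H y.
Proof.
move=> x0 xy; apply: (lt_of_derive_gt0 xy) => z /andP[xz _].
  by apply: is_derive_enthalpy; apply: lt_le_trans xz.
by have [_ d _ _] := hp; rewrite divr_gt0 ?d //; apply: lt_le_trans xz.
Qed.

Lemma dens_enthalpy rho : 0 < rho -> dens p (1 - 2 * H rho) = rho.
Proof.
move=> r0; rewrite /dens; case: xgetP => [y _ [y0 e]|/(_ rho) []]; last first.
  by split => //; lra.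
have {}e : H y = H rho by lra.
by case: (ltgtP y rho) => // lt; have := enthalpy_lt _ lt; rewrite e ltxx => F; exfalso; apply/notF/F.
Qed.

(** Since [p' >= 1] beyond the critical density, the enthalpy is unbounded, so
   that Bernoulli's law has a solution for every squared speed up to 1. *)
Lemma ln_le_enthalpy rho : 1 <= rho -> ln rho <= H rho.
Proof.
move=> r1.
suff : H 1 - ln 1 <= H rho - ln rho by rewrite enthalpy1 ln1; lra.
apply: (le_of_derive_ge0 (h := H \- @ln R) (dh := fun x => dp x / x - x^-1) r1).
  move=> x /andP[x1 _]; have x0 : 0 < x by lra.
  by apply: is_deriveB; [exact: is_derive_enthalpy|exact: is_derive1_ln].
move=> x /andP[x1 _]; have x0 : 0 < x by lra.
have -> : dp x / x - x^-1 = (dp x - 1) / x by field; lra.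
by rewrite divr_ge0 ?subr_ge0 ?gas_derive_ge1 // ltW.
Qed.

Lemma dens_surj s : s <= 1 -> exists2 rho, 1 <= rho & s = 1 - 2 * H rho.
Proof.
move=> s1; set E := expR ((1 - s) / 2).
have E1 : 1 <= E by rewrite -expR0 ler_expR; lra.
have [||rho] := @IVT _ H 1 E ((1 - s) / 2) E1.
- apply: (within_continuous_derive (dh := k)) => x /andP[x1 _].
  by apply: is_derive_enthalpy; lra.
- have := ln_le_enthalpy E1; rewrite enthalpy1 expRK => HE.
  by rewrite ge_min le_max; apply/andP; split; apply/orP; [left|right]; lra.
- by rewrite in_itv /= => /andP[r1 _] e; exists rho => //; rewrite e; lra.
Qed.

Lemma dens_ge1 s : s <= 1 -> 1 <= dens p s.
Proof. by move=> /dens_surj [rho r1 ->]; rewrite dens_enthalpy //; lra. Qed.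

(** The map from densities to squared speeds has a nonzero derivative up to and
   including the critical density, so its inverse is differentiable also at the
   critical speed; only the derivative of [q g(q^2)] degenerates there. *)
Lemma is_derive_dens s : s <= 1 ->
  is_derive s 1 (dens p) (- (dens p s / (2 * dp (dens p s)))).
Proof.
move=> /dens_surj [rho r1 ->]; have r0 : 0 < rho by lra.
rewrite dens_enthalpy //.
have d0 : 0 < dp rho by have := gas_derive_ge1 r1; lra.
have der x : 0 < x -> is_derive x 1 (fun r => 1 - 2 * H r) (- (2 * (dp x / x))).
  move=> x0; have dH := is_derive_enthalpy x0.
  have := is_deriveB (is_derive_cst (1 : R) x 1) (is_deriveZ 2 dH).
  by rewrite sub0r.
have -> : - (rho / (2 * dp rho)) = (- (2 * (dp rho / rho)))^-1.
  by field; rewrite !gt_eqF.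
apply: is_derive_inverse (der _ r0) _.
- by near=> x; rewrite dens_enthalpy //; near: x; apply: lt_nbhsr.
- near=> x; apply/differentiable_continuous/derivable1_diffP.
  by have [] := der x _ => //; near: x; apply: lt_nbhsr.
- by rewrite oppr_eq0 gt_eqF // mulr_gt0 // divr_gt0.
Unshelve. all: by end_near. Qed.

Lemma dens_continuous s : s <= 1 -> {for s, continuous (dens p)}.
Proof.
move=> s1; apply/differentiable_continuous/derivable1_diffP.
by have [] := is_derive_dens s1.
Qed.

Lemma dens_le_stagnation s : 0 <= s <= 1 -> dens p s <= dens p 0.
Proof.
move=> /andP[s0 s1]; rewrite -lerN2.
pose dg s := - - (dens p s / (2 * dp (dens p s))).
apply: (le_of_derive_ge0 (h := - dens p) (dh := dg) s0).
  by move=> x /andP[_ x1]; apply: is_deriveN; apply: is_derive_dens; lra.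
move=> x /andP[_ x1]; rewrite /dg opprK.
have g1 : 1 <= dens p x by apply: dens_ge1; lra.
have := gas_derive_ge1 g1 => ?.
by rewrite divr_ge0 //; lra.
Qed.

(** The derivative of [q g(q^2)] is [g (1 - q^2 / p'(g))], which is at least
   [1 - q] because [g >= 1] and [p'(g) >= 1].  It vanishes at the critical
   speed, hence a quadratic lower bound in place of a linear one. *)
Lemma mass_flux_increasing t s : 0 <= t -> t <= s -> s <= 1 ->
  (s - t) ^+ 2 / 2 <= s * dens p (s ^+ 2) - t * dens p (t ^+ 2).
Proof.
move=> t0 ts s1.
(* [q - q^2 / 2] is the primitive of [1 - q]. *)
pose J q := q * dens p (q ^+ 2) - (q - 2^-1 * q ^+ 2).
pose dJ q := let g := dens p (q ^+ 2) in g * (1 - q ^+ 2 / dp g) - (1 - q).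
suff : J t <= J s by rewrite /J; nra.
have sq q : t <= q <= s -> q ^+ 2 <= 1.
  by move=> /andP[tq qs]; rewrite expr_le1 //; lra.
apply: (le_of_derive_ge0 (dh := dJ) ts) => q tqs; have q1 := sq _ tqs;
  have g1 := dens_ge1 q1; have d1 := gas_derive_ge1 g1; last first.
  rewrite /dJ /=; set g := dens p _ in g1 d1 *.
  have q0 : 0 <= q by lra.
  have q01 : q <= 1 by lra.
  have : q ^+ 2 / dp g <= q ^+ 2.
    by rewrite ler_pdivrMr; [rewrite ler_peMr // sqr_ge0|lra].
  by move=> ?; have : q ^+ 2 <= q; nra.
have dq : is_derive q 1 (fun x : R => x ^+ 2) (2 * q).
  by apply: is_derive_eq; rewrite /GRing.scale /= mulr1; ring.
have dg := @is_derive1_comp R (dens p) (fun x => x ^+ 2) q _ _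
  (is_derive_dens q1) dq.
have d : is_derive q 1 J _ := is_deriveB (is_deriveM (is_derive_id q 1) dg)
   (is_deriveB (is_derive_id q 1) (is_deriveZ (2^-1) dq)).
apply: is_derive_eq d _; rewrite /dJ /= /GRing.scale /=.
set g := dens p _ in g1 d1 *.
by field; lra.
Qed.

End GasLaw.

(** * Monotonicity of the mass flux *)
Section VectorAlgebra.
Context {R : realType}.
Implicit Types (a b c : space3 R).

Lemma space3_eta a : a = (xc a, yc a, zc a).
Proof. by case: a => [[]]. Qed.

Lemma dot3_ge0 a : 0 <= dot3 a a.
Proof. by rewrite /dot3 -!expr2 !addr_ge0 ?sqr_ge0. Qed.

Lemma dot3_cauchy_schwarz a b : dot3 a b ^+ 2 <= dot3 a a * dot3 b b.
Proof.
rewrite -subr_ge0 /dot3.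
set x1 := xc a; set y1 := yc a; set z1 := zc a.
set x2 := xc b; set y2 := yc b; set z2 := zc b.
have -> : (x1 * x1 + y1 * y1 + z1 * z1) * (x2 * x2 + y2 * y2 + z2 * z2)
    - (x1 * x2 + y1 * y2 + z1 * z2) ^+ 2
  = (x1 * y2 - y1 * x2) ^+ 2 + (y1 * z2 - z1 * y2) ^+ 2
    + (z1 * x2 - x1 * z2) ^+ 2 by ring.
by rewrite !addr_ge0 ?sqr_ge0.
Qed.

Lemma coord_le1 a : dot3 a a <= 1 -> [/\ `|xc a| <= 1, `|yc a| <= 1 & `|zc a| <= 1].
Proof.
by rewrite /dot3 => a1; split; rewrite ler_norml; apply/andP; split; nra.
Qed.

Lemma dot3_le3 a b M : 0 <= M -> dot3 a a <= 1 ->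
  `|xc b| <= M -> `|yc b| <= M -> `|zc b| <= M -> `|dot3 a b| <= 3 * M.
Proof.
move=> M0 /coord_le1[x1 y1 z1] xM yM zM.
rewrite /dot3 (le_trans (ler_normD _ _)) //.
have h (u v : R) : `|u| <= 1 -> `|v| <= M -> `|u * v| <= M.
  by move=> u1 vM; rewrite normrM -[M]mul1r ler_pM.
have := ler_normD (xc a * xc b) (yc a * yc b).
by have := h _ _ x1 xM; have := h _ _ y1 yM; have := h _ _ z1 zM; lra.
Qed.

Variable p : R -> R.
Hypothesis hp : gas_law p.

Definition mass_flux a : space3 R := dens p (dot3 a a) *: a.

Lemma dot3Zl (k : R) a b : dot3 (k *: a) b = k * dot3 a b.
Proof. by rewrite /dot3 /xc /yc /zc /= /GRing.scale /=; ring. Qed.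

Lemma dot3C a b : dot3 a b = dot3 b a.
Proof. by rewrite /dot3; ring. Qed.

Lemma dot3Dl a b c : dot3 (a + b) c = dot3 a c + dot3 b c.
Proof. by rewrite /dot3 /xc /yc /zc /=; ring. Qed.

Lemma dot3Nl a b : dot3 (- a) b = - dot3 a b.
Proof. by rewrite /dot3 /xc /yc /zc /=; ring. Qed.

Lemma dot3Br a b c : dot3 a (b - c) = dot3 a b - dot3 a c.
Proof. by rewrite /dot3 /xc /yc /zc /=; ring. Qed.

(** The flux is the gradient of a convex function of the velocity.  Ellipticity
   degenerates at the critical speed, where the exponent 4 instead of 2 makes the
   monotonicity uniform. *)
Lemma mass_flux_monotone a b : dot3 a a <= 1 -> dot3 b b <= 1 ->
  dot3 (a - b) (a - b) ^+ 2 / 8 <= dot3 (mass_flux a - mass_flux b) (a - b).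
Proof.
wlog ba : a b / dot3 b b <= dot3 a a.
  move=> wl a1 b1; case: (leP (dot3 b b) (dot3 a a)) => [/wl|/ltW/wl]; first exact.
  move=> /(_ b1 a1); rewrite -[in X in X -> _](opprB a b).
  rewrite -(opprB (mass_flux a)) !dot3Nl (dot3C (a - b)) !dot3Nl !opprK.
  by rewrite (dot3C _ (- _)) dot3Nl opprK (dot3C (a - b) (mass_flux _ - _)).
move=> a1 b1.
rewrite !dot3Br !dot3Dl !dot3Nl !dot3Zl (dot3C b a).
set s := Num.sqrt (dot3 a a); set t := Num.sqrt (dot3 b b).
have s2 : dot3 a a = s ^+ 2 by rewrite sqr_sqrtr // dot3_ge0.
have t2 : dot3 b b = t ^+ 2 by rewrite sqr_sqrtr // dot3_ge0.
have s0 : 0 <= s := sqrtr_ge0 _; have t0 : 0 <= t := sqrtr_ge0 _.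
have ts : t <= s by rewrite ler_wsqrtr.
have s1 : s <= 1 by rewrite -sqrtr1 ler_wsqrtr.
have J := mass_flux_increasing hp t0 ts s1.
have A1 : 1 <= dens p (s ^+ 2) by apply: (dens_ge1 hp); rewrite -s2.
have B1 : 1 <= dens p (t ^+ 2) by apply: (dens_ge1 hp); rewrite -t2.
have := dot3_cauchy_schwarz a b; rewrite s2 t2 => cs.
set c := dot3 a b in cs *; set A := dens p _ in J A1 *; set B := dens p _ in J B1 *.
have {}cs : `|c| <= s * t.
  by rewrite -ler_sqr ?nnegrE ?mulr_ge0 // real_normK ?num_real // exprMn.
move: cs; rewrite ler_norml => /andP[c1 c2].
(* with x = |a| - |b| and y = |a| |b| - a.b, |a - b|^2 = x^2 + 2 y, and the
   product of the fluxes is (A |a| - B |b|) x + (A + B) y. *)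
set x := s - t in J *; pose y := s * t - c.
have x0 : 0 <= x by rewrite subr_ge0.
have x1 : x <= 1 by rewrite /x; lra.
have y0 : 0 <= y by rewrite subr_ge0.
have st1 : s * t <= 1 by rewrite mulr_ile1 //; lra.
have y2 : y <= 2 by rewrite /y; lra.
have -> : s ^+ 2 - c - (c - t ^+ 2) = x ^+ 2 + 2 * y by rewrite /x /y; ring.
have -> : A * s ^+ 2 - B * c - (A * c - B * t ^+ 2)
    = (s * A - t * B) * x + (A + B) * y by rewrite /x /y; ring.
have h1 : x ^+ 2 / 2 * x <= (s * A - t * B) * x by rewrite ler_wpM2r.
have h2 : 2 * y <= (A + B) * y by rewrite ler_wpM2r //; lra.
have h3 : x ^+ 4 <= x ^+ 3 by rewrite [leLHS]exprS ler_piMl ?exprn_ge0.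
have h4 : y ^+ 2 <= 2 * y by rewrite expr2 ler_wpM2r.
have h5 : 0 <= (x ^+ 2 - 2 * y) ^+ 2 := sqr_ge0 _.
have : 0 <= x ^+ 3 by rewrite exprn_ge0.
lra.
Qed.

End VectorAlgebra.

(** * Measurability and integration in space *)
(** [lebesgue_measure] is a measure on the alias [measurableTypeR R] of [R], so
   the product measure [mu3 R] is one on the following alias of space. *)
Notation M3 R := (measurableTypeR R * measurableTypeR R * measurableTypeR R)%type.
Notation measurable3 D := (@measurable _ (M3 _) D).
Notation measurable_fun3 D phi := (@measurable_fun _ _ (M3 _) _ D phi).

Section Measurability.
Context {R : realType}.
Implicit Types (D O : set (space3 R)) (phi : space3 R -> R) (X Y : space3 R).

Lemma measurable_xc D : measurable_fun3 D (@xc R).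
Proof. apply: measurable_funTS; exact: (measurableT_comp measurable_fst measurable_fst). Qed.

Lemma continuous_xc : continuous (@xc R).
Proof. by move=> X; apply: continuous_comp; exact: cvg_fst. Qed.

Lemma continuous_yc : continuous (@yc R).
Proof. by move=> X; apply: continuous_comp; [exact: cvg_fst|exact: cvg_snd]. Qed.

Lemma continuous_zc : continuous (@zc R).
Proof. by move=> X; exact: cvg_snd. Qed.

Lemma ball3P X Y (e : R) : ball X e Y <->
  [/\ `|xc X - xc Y| < e, `|yc X - yc Y| < e & `|zc X - zc Y| < e].
Proof.
split => [[[]]|[]]; first by rewrite /ball /= /ball_ /=; split.
by move=> h1 h2 h3; split; [split|].
Qed.

(** The open sets are countable unions of cubes with rational centres. *)
Lemma open_measurable3 O : open O -> measurable3 O.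
Proof.
move=> oO.
pose c (q : rat * rat * rat) : space3 R := (ratr q.1.1, ratr q.1.2, ratr q.2).
pose B (i : rat * rat * rat * nat) : set (space3 R) := ball (c i.1) (i.2.+1%:R^-1).
suff -> : O = \bigcup_(i in [set i | B i `<=` O]) B i.
  rewrite bigcup_mkcond; apply: countable_bigcupT_measurable => // i.
  case: ifPn => // _.
  have -> : B i = (ball (c i.1).1.1 (i.2.+1%:R^-1) `*` ball (c i.1).1.2 (i.2.+1%:R^-1))
                  `*` ball (c i.1).2 (i.2.+1%:R^-1).
    by [].
  apply: measurableX => //; [apply: measurableX|]; by apply: open_measurable; apply: ball_open.
apply/seteqP; split => [X OX|X [i /= BO /BO]] //.
have /nbhs_ballP[e /= e0 eO] : nbhs X O by exact: open_nbhs_nbhs.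
have [n ne] : exists n : nat, 2 * n.+1%:R^-1 < e.
  have [n ne] := @ltr_add_invr R 0 (e / 2) ltac:(lra).
  by exists n; move: ne; rewrite add0r; move: (_^-1) => v; lra.
have n0 : 0 < n.+1%:R^-1 :> R by rewrite invr_gt0.
have app (x d : R) : 0 < d -> exists q : rat, `|ratr q - x| < d.
  move=> d0; have /rat_in_itvoo[q] : x - d < x + d by lra.
  by rewrite in_itv /= => qx; exists q; rewrite ltr_norml; lra.
have tri (a x y v : R) : `|a - x| < v -> `|a - y| < v -> 2 * v < e -> `|x - y| < e.
  by move=> ax ay; have := ler_distD a x y; rewrite (distrC x a); lra.
have [q1 h1] := app (xc X) _ n0; have [q2 h2] := app (yc X) _ n0.
have [q3 h3] := app (zc X) _ n0.
exists (q1, q2, q3, n); last by apply/ball3P.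
move=> Y /ball3P[k1 k2 k3]; apply: eO; apply/ball3P.
by split; [apply: tri h1 k1 ne|apply: tri h2 k2 ne|apply: tri h3 k3 ne].
Qed.

Lemma continuous_measurable3 D phi : open D ->
  (forall X, D X -> {for X, continuous phi}) -> measurable_fun3 D phi.
Proof.
move=> oD cphi; apply: (measurability _ (RGenOpens.measurableE R)).
move=> _ [_ [a [b ->] <-]]; apply: open_measurable3.
rewrite openE => X [DX phiX]; apply: filterI; first exact: open_nbhs_nbhs.
by apply: cphi => //; apply: open_nbhs_nbhs; split => //; exact: interval_open.
Qed.

End Measurability.

Section Fubini.
Context {R : realType}.

Lemma plane_sigma_finite : sigma_finite setT (mu2 R).
Proof.
pose I n : set (measurableTypeR R) := `[- n%:R, n%:R].
have mI n : measurable (I n) by exact: measurable_itv.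
exists (fun n => I n `*` I n).
  apply/seteqP; split => // -[x y] _.
  have [n hn] : exists n : nat, Num.max `|x| `|y| <= n%:R.
    exists (Num.bound (Num.max `|x| `|y|)).
    by apply/ltW/archi_boundP; rewrite le_max normr_ge0.
  exists n => //; rewrite /I /= !in_itv /= -!ler_norml.
  by move: hn; rewrite ge_max => /andP[].
move=> n; split; first exact: measurableX.
have -> : mu2 R (I n `*` I n) = (mu1 R (I n) * mu1 R (I n))%E.
  exact: (@product_measure1E _ _ _ _ R (mu1 R) (mu1 R) _ _ (mI n) (mI n)).
rewrite lebesgue_measure_itv /=.
by case: ifP => _ /=; rewrite -?EFinB ?mul0e ?ltry // -!EFinM ltry.
Qed.

(** A copy of [mu2 R] that carries its sigma-finiteness, so that Fubini's
   theorem applies to [mu3 R], the product of this measure and [mu1 R]. *)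
Definition plane_measure : set (measurableTypeR R * measurableTypeR R)%type -> \bar R :=
  mu2 R.
HB.instance Definition _ := Measure.copy plane_measure (mu2 R).
HB.instance Definition _ :=
  @Measure_isSigmaFinite.Build _ _ _ plane_measure plane_sigma_finite.

Section Integrable.
Variable f : M3 R -> \bar R.
Hypothesis fi : (mu3 R).-integrable setT f.

Lemma fubini_z_outer : (\int[mu3 R]_X f X = \int[mu1 R]_z \int[mu2 R]_P f (P, z))%E.
Proof. exact: (esym (@integral21_prod_meas1 _ _ _ _ R plane_measure (mu1 R) f fi)). Qed.

Lemma fubini_z_inner : (\int[mu3 R]_X f X = \int[mu2 R]_P \int[mu1 R]_z f (P, z))%E.
Proof. exact: (esym (@integral12_prod_meas1 _ _ _ _ R plane_measure (mu1 R) f fi)). Qed.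

Lemma slice_integrable :
  {ae mu1 R, forall z, (mu2 R).-integrable setT (fun P => f (P, z))}.
Proof. exact: (@ae_integrable2 _ _ _ _ R plane_measure (mu1 R) f fi). Qed.

Lemma fubini_slices_eq0 :
  (forall z, (mu2 R).-integrable setT (fun P => f (P, z)) ->
    \int[mu2 R]_P f (P, z) = 0)%E ->
  (\int[mu3 R]_X f X = 0)%E.
Proof.
move=> s0; rewrite fubini_z_outer.
transitivity (\int[mu1 R]_z (cst 0 z))%E; last by rewrite integral_cst // mul0e.
apply: ae_eq_integral => //.
- exact: (@measurable_fubini_G _ _ _ _ R plane_measure (mu1 R) f fi).
- by apply: filterS slice_integrable => z iz _; exact: s0.
Qed.

End Integrable.

End Fubini.

Section BoxIntegrals.
Context {R : realType}.
Implicit Types (A B C : R) (D : set (space3 R)) (X e : space3 R)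
  (phi : space3 R -> R).

Definition box A : set (space3 R) := (`[- A, A] `*` `[- A, A]) `*` `[- A, A].

Lemma boxP A X : box A X <-> [/\ `|xc X| <= A, `|yc X| <= A & `|zc X| <= A].
Proof.
rewrite /box /= !in_itv /= -!ler_norml.
by split => [[[h1 h2] h3]|[h1 h2 h3]].
Qed.

Lemma box_compact A : compact (box A).
Proof. by do 2 (apply: compact_setX; last exact: segment_compact); exact: segment_compact. Qed.

Lemma compact_closed3 (K : set (space3 R)) : compact K -> closed K.
Proof. by apply: compact_closed; exact: (@norm_hausdorff R (space3 R)). Qed.

Lemma box_measurable A : measurable3 (box A).
Proof. by apply: measurableX => //; apply: measurableX. Qed.

Lemma box_lty A : (mu3 R (box A) < +oo)%E.
Proof.
pose I : set R := `[- A, A].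
have mI : measurable I by exact: measurable_itv.
have -> : mu3 R (box A) = (mu1 R I * mu1 R I * mu1 R I)%E.
  apply: etrans (@product_measure1E _ _ _ _ R (mu2 R) (mu1 R) _ _ (measurableX mI mI) mI) _.
  by congr (_ * _)%E; exact: (@product_measure1E _ _ _ _ R (mu1 R) (mu1 R) _ _ mI mI).
rewrite !lebesgue_measure_itv /=.
by case: ifP => _ /=; rewrite -?EFinB ?mul0e ?ltry // -!EFinM ltry.
Qed.

Lemma box_indic_integrable A D : measurable3 D ->
  (mu3 R).-integrable D (EFin \o \1_(box A)).
Proof.
move=> mD; apply: (@integrableS _ _ _ _ setT) => //.
apply/integrableP; split.
  by apply/measurable_EFinP; apply: measurable_indic; exact: box_measurable.
rewrite [X in (X < _)%E](_ : _ = mu3 R (box A)) ?box_lty //.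
rewrite -[in RHS](setIT (box A)) -integral_indic //; last exact: box_measurable.
by apply: eq_integral => x _ /=; rewrite ger0_norm // indicE; case: (_ \in _).
Qed.

Lemma box_integrable D phi A C : measurable3 D -> measurable_fun3 D phi ->
  (forall X, D X -> `|phi X| <= C) ->
  (forall X, D X -> ~ box A X -> phi X = 0) ->
  (mu3 R).-integrable D (EFin \o phi).
Proof.
move=> mD mphi phiC phi0.
have := integrableZl mD C (box_indic_integrable A mD).
apply: le_integrable => //; first exact/measurable_EFinP.
move=> X DX /=; rewrite lee_fin indicE.
have [bX|bX] := pselect (box A X).
  by rewrite mem_set // mulr1 (le_trans (phiC _ DX)) // ler_norm.
by rewrite memNset //= mulr0 phi0 // normr0.
Qed.

Lemma continuous_bounded_compact (K : set (space3 R)) phi : compact K ->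
  {within K, continuous phi} -> exists2 C, 0 <= C & forall X, K X -> `|phi X| <= C.
Proof.
move=> cK cphi; have /compact_bounded [M [_ hM]] := continuous_compact cphi cK.
exists (`|M| + 1); first by rewrite addr_ge0.
move=> X KX; apply: (hM (`|M| + 1)); last by exists X.
by rewrite (le_lt_trans (ler_norm _)) // ltrDl.
Qed.

Lemma continuous_bounded_box phi A : continuous phi ->
  exists2 C, 0 <= C & forall X, box A X -> `|phi X| <= C.
Proof.
move=> cphi; refine (continuous_bounded_compact (phi := phi) (@box_compact A) _).
exact: continuous_subspaceT.
Qed.

Lemma continuous_box_integrable phi A : continuous phi ->
  (forall X, ~ box A X -> phi X = 0) -> (mu3 R).-integrable setT (EFin \o phi).
Proof.
move=> cphi phi0; have [C C0 hC] := continuous_bounded_box A cphi.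
apply: (@box_integrable _ _ A C) => //.
- exact: (@continuous_measurable3 R setT phi openT (fun X _ => cphi X)).
- move=> X _; have [/hC //|/phi0 ->] := pselect (box A X).
  by rewrite normr0.
- by move=> X _; exact: phi0.
Qed.

Lemma continuous3 (T : topologicalType) (u v w : T -> R) :
  continuous u -> continuous v -> continuous w ->
  continuous (fun t => (u t, v t, w t) : space3 R).
Proof.
by move=> cu cv cw t; exact: (cvg_pair (cvg_pair (cu t) (cv t)) (cw t)).
Qed.

Lemma near_eq_der phi psi X e : {near X, phi =1 psi} ->
  derivable psi X e -> derivable phi X e /\ 'D_e phi X = 'D_e psi X.
Proof.
move=> ep d; split; last exact: near_eq_derive.
by apply: near_eq_derivable d; apply: filterS ep => Y ->.
Qed.

Lemma near_outside_compact (K : set (space3 R)) X : compact K -> ~ K X ->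
  \forall Y \near X, ~ K Y.
Proof.
move=> /compact_closed3/closed_openC oK KX.
by apply: open_nbhs_nbhs.
Qed.

Lemma der_outside_compact (K : set (space3 R)) phi X e : compact K ->
  (forall X, ~ K X -> phi X = 0) -> ~ K X -> 'D_e phi X = 0.
Proof.
move=> cK phi0 KX; rewrite (@near_eq_derive _ _ _ phi (cst 0)) ?derive_cst //.
by apply: filterS (near_outside_compact cK KX) => Y /phi0.
Qed.

(** Restricts derivatives along an axis to lines, for use with the calculus of
   functions of one variable. *)
Lemma slice_derive phi X e (c : R -> space3 R) (t : R) :
  (forall h, c (h + t) = h *: e + X) ->
  (derivable phi X e -> derivable (phi \o c) t 1)
  /\ derive1 (phi \o c) t = 'D_e phi X.
Proof.
move=> ce; have cX : c t = X by have := ce 0; rewrite scale0r !add0r.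
have E : (fun h : R => h^-1 *: ((phi \o c \o shift t) (h *: 1) - (phi \o c) t))
    = (fun h => h^-1 *: ((phi \o shift X) (h *: e) - phi X)).
  by apply/funext => h /=; rewrite /GRing.scale /= mulr1 ce cX.
by rewrite derive1E /derivable /derive E.
Qed.

Lemma integral_derive1_eq0 (g : R -> R) A : (forall t, derivable g t 1) ->
  continuous (derive1 g) -> (forall t, A < `|t| -> g t = 0) ->
  (\int[mu1 R]_t (derive1 g t)%:E = 0)%E.
Proof.
move=> dg cg g0; pose B : R := `|A| + 1.
have AB (t : R) : B <= `|t| -> A < `|t|.
  by rewrite /B; have := ler_norm A; lra.
have B0 : 0 < B by rewrite /B; have := normr_ge0 A; lra.
have g'0 t : t \notin (`[- B, B] : set R) -> derive1 g t = 0.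
  move=> tB; rewrite derive1E (@near_eq_derive _ _ _ g (cst 0)) ?derive_cst //.
  have : B < `|t|.
    by rewrite ltNge; apply: contra tB; rewrite ler_norml => tB; rewrite inE /= in_itv.
  move=> Bt; near=> s; apply: g0; apply: AB; apply: ltW.
  near: s; have : {for t, continuous (fun s : R => `|s|)} by exact: norm_continuous.
  by move=> /(_ [set v | B < v]); apply; exact: lt_nbhsr.
pose I : set R := `[- B, B].
have -> : (fun t => (derive1 g t)%:E) = ((fun t => (derive1 g t)%:E) \_ I).
  apply/funext => t; rewrite patchE; case: ifPn => // tB.
  by rewrite g'0.
have cont t : {for t, continuous g}.
  by apply/differentiable_continuous/derivable1_diffP; exact: dg.
rewrite -integral_mkcond (@continuous_FTC2 R (derive1 g) g (- B) B).
- rewrite !g0 ?subee //; first by apply: AB; rewrite normrN ger0_norm ?lexx // ltW.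
  by apply: AB; rewrite ger0_norm ?lexx // ltW.
- by lra.
- exact: continuous_subspaceT.
- split => [t _||]; first exact: dg.
    by apply: cvg_at_right_filter; exact: cont.
  by apply: cvg_at_left_filter; exact: cont.
- by [].
Unshelve. all: by end_near. Qed.

(** Fubini's theorem along the lines in the direction [e], on which the integral
   of a derivative with bounded support vanishes. *)
Lemma integral_derive_eq0 phi A e : e \in [:: e_x; e_y; e_z] ->
  (forall X, derivable phi X e) ->
  continuous ('D_e phi) -> (forall X, ~ box A X -> phi X = 0) ->
  (\int[mu3 R]_X ('D_e phi X)%:E = 0)%E.
Proof.
move=> ein dphi cphi phi0.
have int : (mu3 R).-integrable setT (EFin \o 'D_e phi).
  by apply: continuous_box_integrable cphi _ => X; exact: der_outside_compact (@box_compact A) phi0.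
have line (c : R -> space3 R) : continuous c ->
    (forall h t, c (h + t) = h *: e + c t) ->
    (forall t, A < `|t| -> ~ box A (c t)) ->
    (\int[mu1 R]_t ('D_e phi (c t))%:E = 0)%E.
  move=> cc ce cA.
  have der t := slice_derive phi (fun h => ce h t).
  transitivity (\int[mu1 R]_t (derive1 (phi \o c) t)%:E)%E.
    by apply: eq_integral => t _; rewrite (der t).2.
  apply: (@integral_derive1_eq0 _ A).
  - by move=> t; apply: (der t).1.
  - have -> : derive1 (phi \o c) = 'D_e phi \o c.
      by apply/funext => t; rewrite (der t).2.
    by move=> t; apply: continuous_comp; [exact: cc|exact: cphi].
  - by move=> t /cA /phi0.
have NA t : A < `|t| -> ~ (`|t| <= A) by rewrite ltNge => /negP.
move: ein; rewrite !inE => /or3P[] /eqP e0; subst e.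
- apply: (fubini_slices_eq0 int) => z iz.
  refine (etrans (esym (integral21_prod_meas1 iz)) _); rewrite /fubini_G.
  apply: integral0_eq => y _ /=.
  apply: (line (fun x => (x, y, z))).
  + by apply: continuous3 => ?; [exact: cvg_id|exact: cvg_cst|exact: cvg_cst].
  + by move=> h x; rewrite [RHS]space3_eta /xc /yc /zc /= /GRing.scale /= !mulr0 !add0r mulr1.
  + by move=> x /NA xA /boxP[].
- apply: (fubini_slices_eq0 int) => z iz.
  refine (etrans (esym (integral12_prod_meas1 iz)) _); rewrite /fubini_F.
  apply: integral0_eq => x _ /=.
  apply: (line (fun y => (x, y, z))).
  + by apply: continuous3 => ?; [exact: cvg_cst|exact: cvg_id|exact: cvg_cst].
  + by move=> h y; rewrite [RHS]space3_eta /xc /yc /zc /= /GRing.scale /= !mulr0 !add0r mulr1.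
  + by move=> y /NA yA /boxP[].
- rewrite fubini_z_inner //.
  apply: integral0_eq => -[x y] _ /=.
  apply: (line (fun z => (x, y, z))).
  + by apply: continuous3 => ?; [exact: cvg_cst|exact: cvg_cst|exact: cvg_id].
  + by move=> h z; rewrite [RHS]space3_eta /xc /yc /zc /= /GRing.scale /= !mulr0 !add0r mulr1.
  + by move=> z /NA zA /boxP[].
Qed.

End BoxIntegrals.

(** * Functions of class C1 *)
Section Calculus.
Context {R : realType}.
Implicit Types (D K : set (space3 R)) (X Y e a b : space3 R)
  (phi psi eta : space3 R -> R) (F : space3 R -> space3 R).

Notation axes := [:: e_x; e_y; e_z].

(** Stated with the derivatives along the axes only, as in [Ck 1], but pointwise,
   so that it can be localized. *)
Definition C1 D phi := forall X, D X -> {for X, continuous phi} /\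
  forall e, e \in axes -> derivable phi X e /\ {for X, continuous ('D_e phi)}.

Lemma ex_axis : @e_x R \in axes. Proof. by rewrite !inE eqxx. Qed.
Lemma ey_axis : @e_y R \in axes. Proof. by rewrite !inE eqxx orbT. Qed.
Lemma ez_axis : @e_z R \in axes. Proof. by rewrite !inE eqxx !orbT. Qed.
Local Hint Resolve ex_axis ey_axis ez_axis : core.

Lemma Ck1_C1 D phi : Ck 1 D phi -> C1 D phi.
Proof.
move=> [cphi dphi] X DX; split; first exact: cphi.
by move=> e /dphi [d [c _]]; split; [exact: d|exact: c].
Qed.

Lemma Ck2_C1 D phi : Ck 2 D phi ->
  C1 D phi /\ forall e, e \in axes -> C1 D ('D_e phi).
Proof.
move=> [cphi dphi]; split; last by move=> e /dphi [_ /Ck1_C1].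
move=> X DX; split; first exact: cphi.
by move=> e /dphi [d [c _]]; split; [exact: d|exact: c].
Qed.

Lemma C1_continuous D phi X : C1 D phi -> D X -> {for X, continuous phi}.
Proof. by move=> c DX; have [] := c X DX. Qed.

Lemma C1_derivable D phi X e : C1 D phi -> D X -> e \in axes -> derivable phi X e.
Proof. by move=> c DX ea; have [_ /(_ _ ea)[]] := c X DX. Qed.

Lemma C1_der_continuous D phi X e : C1 D phi -> D X -> e \in axes ->
  {for X, continuous ('D_e phi)}.
Proof. by move=> c DX ea; have [_ /(_ _ ea)[]] := c X DX. Qed.

Lemma continuous_near_eq phi psi X : {near X, phi =1 psi} ->
  {for X, continuous psi} -> {for X, continuous phi}.
Proof.
move=> e c; rewrite /prop_for /continuous_at (nbhs_singleton e).
by apply: cvg_trans c; apply: near_eq_cvg; apply: filterS e => Y ->.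
Qed.

Lemma C1_near_eq D phi psi : open D -> {in D, phi =1 psi} -> C1 D psi -> C1 D phi.
Proof.
move=> oD e c X DX.
have nD : \forall Y \near X, D Y by exact: open_nbhs_nbhs.
have en : {near X, phi =1 psi} by apply: filterS nD => Y DY; apply: e; rewrite inE.
split; first exact: continuous_near_eq en (C1_continuous c DX).
move=> u ua; split; first exact: (near_eq_der en (C1_derivable c DX ua)).1.
apply: continuous_near_eq (C1_der_continuous c DX ua).
near=> Y; apply: near_eq_derive.
have : nbhs Y D by apply: open_nbhs_nbhs; split => //; near: Y.
by apply: filterS => Z DZ; apply: e; rewrite inE.
Unshelve. all: by end_near. Qed.

Lemma C1S D D' phi : D `<=` D' -> C1 D' phi -> C1 D phi.
Proof. by move=> s c X /s; exact: c. Qed.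

Lemma C1_cst D (k : R) : C1 D (cst k).
Proof.
move=> X _; split; first exact: cvg_cst.
move=> e _; split; first exact: derivable_cst.
have -> : 'D_e (cst k) = cst 0 :> (space3 R -> R).
  by apply/funext => Y; rewrite derive_cst.
exact: cvg_cst.
Qed.

Lemma C1D D phi psi : open D -> C1 D phi -> C1 D psi -> C1 D (fun X => phi X + psi X).
Proof.
move=> oD cphi cpsi X DX; split.
  by apply: continuousD; [exact: C1_continuous cphi _|exact: C1_continuous cpsi _].
move=> e ea; split.
  by apply: derivableD; [exact: C1_derivable cphi _ _|exact: C1_derivable cpsi _ _].
apply: (@continuous_near_eq _ (fun Y => 'D_e phi Y + 'D_e psi Y)); last first.
  by apply: continuousD; [exact: C1_der_continuous cphi _ _|exact: C1_der_continuous cpsi _ _].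
have : \forall Y \near X, D Y by exact: open_nbhs_nbhs.
apply: filterS => Y DY; apply: deriveD; [exact: C1_derivable cphi _ _|exact: C1_derivable cpsi _ _].
Qed.

Lemma der_mul D phi psi X e : C1 D phi -> C1 D psi -> D X -> e \in axes ->
  'D_e (fun X => phi X * psi X) X = phi X * 'D_e psi X + psi X * 'D_e phi X.
Proof.
move=> cphi cpsi DX ea.
by apply: deriveM; [exact: C1_derivable cphi _ _|exact: C1_derivable cpsi _ _].
Qed.

Lemma C1M D phi psi : open D -> C1 D phi -> C1 D psi -> C1 D (fun X => phi X * psi X).
Proof.
move=> oD cphi cpsi X DX.
have c0 := C1_continuous cphi DX; have c1 := C1_continuous cpsi DX.
split; first exact: continuousM.
move=> e ea; split.
  by apply: derivableM; [exact: C1_derivable cphi _ _|exact: C1_derivable cpsi _ _].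
apply: (@continuous_near_eq _ (fun Y => phi Y * 'D_e psi Y + psi Y * 'D_e phi Y)).
  have : \forall Y \near X, D Y by exact: open_nbhs_nbhs.
  by apply: filterS => Y DY; exact: der_mul cphi cpsi DY ea.
apply: continuousD; apply: continuousM => //.
  exact: C1_der_continuous cpsi _ _.
exact: C1_der_continuous cphi _ _.
Qed.

Lemma is_derive_comp (h : R -> R) (l : R) phi X e : derivable phi X e ->
  is_derive (phi X) 1 h l -> is_derive X e (h \o phi) (l * 'D_e phi X).
Proof.
move=> dphi dh.
pose c (t : R) : space3 R := t *: e + X.
have ce t : c (t + 0) = t *: e + X by rewrite addr0.
have [d1 d2] := slice_derive phi ce.
have [_ d4] := slice_derive (h \o phi) ce.
have c0 : c 0 = X by rewrite /c scale0r add0r.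
have D1 : is_derive (0 : R) 1 (phi \o c) ('D_e phi X).
  by apply: DeriveDef; [exact: d1|rewrite -derive1E].
have D2 : is_derive (0 : R) 1 (h \o (phi \o c)) (l * 'D_e phi X).
  by apply: is_derive1_comp; rewrite /= c0.
split; last by rewrite -d4 derive1E; case: D2.
by apply/derivable1P; case: D2.
Qed.

Lemma der_comp D (h dh : R -> R) phi X e : C1 D phi -> D X -> e \in axes ->
  is_derive (phi X) 1 h (dh (phi X)) ->
  'D_e (fun X => h (phi X)) X = dh (phi X) * 'D_e phi X.
Proof.
by move=> c DX ea d; have [] := is_derive_comp (C1_derivable c DX ea) d.
Qed.

Lemma C1_comp D (h dh : R -> R) phi : open D -> C1 D phi ->
  (forall X, D X -> is_derive (phi X) 1 h (dh (phi X)) /\ {for phi X, continuous dh}) ->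
  C1 D (fun X => h (phi X)).
Proof.
move=> oD c hd X DX; have [d cd] := hd X DX.
split.
  apply: continuous_comp; first exact: C1_continuous c DX.
  by apply/differentiable_continuous/derivable1_diffP; case: d.
move=> e ea; split; first by have [] := is_derive_comp (C1_derivable c DX ea) d.
apply: (@continuous_near_eq _ (fun Y => dh (phi Y) * 'D_e phi Y)).
  have : \forall Y \near X, D Y by exact: open_nbhs_nbhs.
  by apply: filterS => Y DY; apply: (der_comp c DY ea); case: (hd Y DY).
apply: continuousM; last exact: C1_der_continuous c DX ea.
by apply: continuous_comp cd; exact: C1_continuous c DX.
Qed.

End Calculus.

(** * Integration by parts *)
Section Green.
Context {R : realType}.
Implicit Types (D K : set (space3 R)) (X Y e a b : space3 R)
  (phi psi eta g : space3 R -> R) (F : space3 R -> space3 R).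
Local Hint Resolve ex_axis ey_axis ez_axis : core.

Lemma continuous_dist phi X (d : R) : {for X, continuous phi} -> 0 < d ->
  \forall Y \near X, `|phi X - phi Y| < d.
Proof.
move=> c d0; have {}c : phi Y @[Y --> X] --> phi X := c.
by move/cvgrPdist_lt : c => /(_ d d0).
Qed.

Lemma compact_in_box K : compact K -> exists A, K `<=` box A.
Proof.
move=> cK.
have bd phi : continuous phi -> exists2 C, 0 <= C & forall X, K X -> `|phi X| <= C.
  by move=> c; exact: (continuous_bounded_compact cK (continuous_subspaceT c)).
have [C1 C10 h1] := bd _ continuous_xc.
have [C2 C20 h2] := bd _ continuous_yc.
have [C3 C30 h3] := bd _ continuous_zc.
exists (C1 + C2 + C3) => X KX; apply/boxP.
by split; [have := h1 X KX|have := h2 X KX|have := h3 X KX]; lra.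
Qed.

Lemma grad_bounded K g : compact K -> C1 setT g -> (forall X, ~ K X -> g X = 0) ->
  exists2 M, 0 <= M & forall X e, e \in [:: e_x; e_y; e_z] -> `|'D_e g X| <= M.
Proof.
move=> cK cg g0.
have bd e : e \in [:: e_x; e_y; e_z] -> exists2 C, 0 <= C & forall X, `|'D_e g X| <= C.
  move=> ea; have c : continuous ('D_e g) by move=> X; exact: (C1_der_continuous cg).
  have [C C0 hC] := continuous_bounded_compact cK (continuous_subspaceT c).
  exists C => // X; have [/hC //|KX] := pselect (K X).
  by rewrite (der_outside_compact e cK g0 KX) normr0.
have [M1 M10 h1] := bd _ ex_axis; have [M2 M20 h2] := bd _ ey_axis.
have [M3 M30 h3] := bd _ ez_axis.
exists (M1 + M2 + M3); first by rewrite !addr_ge0.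
move=> X e; rewrite !inE => /or3P[] /eqP ->.
- by apply: le_trans (h1 X) _; rewrite -addrA lerDl addr_ge0.
- by apply: le_trans (h2 X) _; rewrite addrAC lerDr addr_ge0.
- by apply: le_trans (h3 X) _; rewrite lerDr addr_ge0.
Qed.

Lemma C1_ext0 D K g : compact K -> K `<=` D -> C1 D g ->
  (forall X, ~ K X -> g X = 0) -> C1 setT g.
Proof.
move=> cK KD cg g0 X _.
have [KX|KX] := pselect (K X); first exact/cg/KD.
have nX := near_outside_compact cK KX.
have e0 : {near X, g =1 cst 0} by apply: filterS nX => Y /g0.
split; first by apply: continuous_near_eq e0 _; exact: cvg_cst.
move=> e _; split; first by apply: (near_eq_der e0 _).1; exact: derivable_cst.
apply: (@continuous_near_eq _ _ (cst 0)); last exact: cvg_cst.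
apply: filterS nX => Y KY; exact: der_outside_compact cK g0 KY.
Qed.

Lemma integral_der_compact K g e : compact K -> C1 setT g -> e \in [:: e_x; e_y; e_z] ->
  (forall X, ~ K X -> g X = 0) ->
  (mu3 R).-integrable setT (fun X => ('D_e g X)%:E)
  /\ (\int[mu3 R]_X ('D_e g X)%:E = 0)%E.
Proof.
move=> cK cg ea g0; have [A KA] := compact_in_box cK.
have gA X : ~ box A X -> g X = 0 by move=> bX; apply: g0 => /KA.
have cD : continuous ('D_e g) by move=> X; exact: (C1_der_continuous cg).
split; last by apply: (integral_derive_eq0 ea _ cD gA) => X; exact: (C1_derivable cg).
by apply: (continuous_box_integrable cD) => X; exact: der_outside_compact (@box_compact R A) gA.
Qed.

Lemma dot3_grad a psi X : dot3 a (grad psi X) =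
  xc a * 'D_e_x psi X + yc a * 'D_e_y psi X + zc a * 'D_e_z psi X.
Proof. by []. Qed.

(** The divergence theorem for the field [psi F], which vanishes near the
   boundary of [D]. *)
Lemma green D K F psi : open D -> compact K -> K `<=` D ->
  C1 D (xc \o F) -> C1 D (yc \o F) -> C1 D (zc \o F) -> C1 D psi ->
  (forall X, ~ K X -> psi X = 0) ->
  (\int[mu3 R]_X (dot3 (F X) (grad psi X) + psi X * div3 F X)%:E = 0)%E.
Proof.
move=> oD cK KD cF1 cF2 cF3 cpsi psi0.
pose G (c : space3 R -> R) X := psi X * (c \o F) X.
have G0 c X : ~ K X -> G c X = 0 by move=> /psi0 p0; rewrite /G p0 mul0r.
have I c e : C1 D (c \o F) -> e \in [:: e_x; e_y; e_z] ->
    (mu3 R).-integrable setT (fun X => ('D_e (G c) X)%:E)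
    /\ (\int[mu3 R]_X ('D_e (G c) X)%:E = 0)%E.
  move=> cF ea; apply: (integral_der_compact cK) => //; last exact: G0.
  by apply: (C1_ext0 cK KD _ (G0 c)); exact: C1M.
have P c e X : C1 D (c \o F) -> e \in [:: e_x; e_y; e_z] ->
    'D_e (G c) X = psi X * 'D_e (c \o F) X + c (F X) * 'D_e psi X.
  move=> cF ea; have [KX|KX] := pselect (K X).
    by rewrite /G (der_mul cpsi cF) //; exact: KD.
  rewrite psi0 // mul0r (der_outside_compact _ cK psi0 KX) mulr0 addr0.
  exact: der_outside_compact cK (@G0 c) KX.
have [i1 e1] := I xc e_x cF1 ex_axis.
have [i2 e2] := I yc e_y cF2 ey_axis.
have [i3 e3] := I zc e_z cF3 ez_axis.
transitivity (\int[mu3 R]_X ((('D_e_x (G xc) X)%:E + ('D_e_y (G yc) X)%:E) + ('D_e_z (G zc) X)%:E))%E.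
  apply: eq_integral => X _; rewrite -!EFinD (P _ _ _ cF1) // (P _ _ _ cF2) // (P _ _ _ cF3) //.
  congr EFin; rewrite dot3_grad /div3.
  move: (xc _) (yc _) (zc _) (psi X) ('D_e_x _ X) ('D_e_y _ X) ('D_e_z _ X).
  by move: ('D_e_x _ X) ('D_e_y _ X) ('D_e_z _ X) => *; ring.
rewrite integralD //; last exact: integrableD.
by rewrite integralD // e1 e2 e3 !adde0.
Qed.

Lemma compact_supp_zero phi X : ~ supp phi X -> phi X = 0.
Proof.
move=> sX; apply/eqP/negPn/negP => p0; apply: sX; exact: subset_closure.
Qed.

(** Both mixed derivatives are limits of the second difference quotient of
   [phi] over the squares spanned by [h a] and [h b]. *)
Lemma second_difference phi X a b (h : R) : 0 < h ->
  C1 setT phi -> a \in [:: e_x; e_y; e_z] -> b \in [:: e_x; e_y; e_z] ->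
  C1 setT ('D_a phi) ->
  exists t s : R, [/\ 0 <= t <= h, 0 <= s <= h &
    phi (h *: a + (h *: b + X)) - phi (h *: a + X) - (phi (h *: b + X) - phi X)
    = h ^+ 2 * 'D_b ('D_a phi) (s *: b + (t *: a + X))].
Proof.
move=> h0 c aa ba ca.
have line (g : space3 R -> R) e Y (t : R) : C1 setT g -> e \in [:: e_x; e_y; e_z] ->
    is_derive t 1 (fun t : R => g (t *: e + Y)) ('D_e g (t *: e + Y)).
  move=> cg ea.
  have sl (k : R) : (k + t) *: e + Y = k *: e + (t *: e + Y).
    by rewrite scalerDl addrA.
  have [d1 d2] := @slice_derive _ g (t *: e + Y) e (fun t => t *: e + Y) t sl.
  apply: DeriveDef; first by apply: d1; exact: (C1_derivable cg).
  by rewrite -derive1E d2.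
pose g1 (t : R) := phi (t *: a + (h *: b + X)) - phi (t *: a + X).
have dg1 (t : R) : is_derive t 1 g1
    ('D_a phi (t *: a + (h *: b + X)) - 'D_a phi (t *: a + X)).
  exact: is_deriveB (line _ _ _ _ c aa) (line _ _ _ _ c aa).
have [|t] := @MVT_segment _ g1 _ 0 h (ltW h0) (fun t _ => dg1 t).
  by apply: within_continuous_derive => t _; exact: dg1.
rewrite in_itv /= => th E1.
have [|s] := @MVT_segment _ _ _ 0 h (ltW h0)
   (fun s _ => line _ b (t *: a + X) s ca ba).
  exact: (within_continuous_derive (fun s _ => line _ b (t *: a + X) s ca ba)).
rewrite in_itv /= => sh E2.
exists t, s; split => //.
move: E1; rewrite /g1 scale0r !add0r => ->.
rewrite subr0 expr2 -mulrA mulrC; congr (_ * _).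
move: E2; rewrite scale0r !add0r subr0 [RHS]mulrC => <-.
by rewrite [h *: b + (t *: a + X)]addrCA.
Qed.

Lemma axis_coord (u : space3 R) : u \in [:: e_x; e_y; e_z] ->
  [/\ 0 <= xc u <= 1, 0 <= yc u <= 1 & 0 <= zc u <= 1].
Proof. by rewrite !inE => /or3P[] /eqP ->; rewrite /xc /yc /zc /= !lexx ler01. Qed.

Lemma ball_cell X (h s t : R) u v : 0 < h ->
  u \in [:: e_x; e_y; e_z] -> v \in [:: e_x; e_y; e_z] ->
  0 <= s <= h -> 0 <= t <= h -> ball X (h * 3) (s *: u + (t *: v + X)).
Proof.
move=> h0 ua va sh th.
have p (q r : R) : 0 <= q <= h -> 0 <= r <= 1 -> 0 <= q * r <= h.
  by move=> /andP[q0 qh] /andP[r0 r1]; rewrite mulr_ge0 //= -[h]mulr1 ler_pM.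
have small (k l : R) : 0 <= k <= h -> 0 <= l <= h -> `|- (k + l)| < h * 3.
  move=> /andP[k0 kh] /andP[l0 lh]; rewrite normrN ger0_norm ?addr_ge0 //.
  by clear -h0 k0 kh l0 lh; lra.
have bd (l : space3 R -> R) : (forall (r : R) Y Z, l (r *: Y + Z) = r * l Y + l Z) ->
    0 <= l u <= 1 -> 0 <= l v <= 1 -> `|l X - l (s *: u + (t *: v + X))| < h * 3.
  move=> ll lu lv; rewrite !ll.
  have -> : l X - (s * l u + (t * l v + l X)) = - (s * l u + t * l v) by ring.
  by apply: small; apply: p.
have [u1 u2 u3] := axis_coord ua; have [v1 v2 v3] := axis_coord va.
by apply/ball3P; split; apply: bd.
Qed.

(** The second difference quotient does not depend on the order of the two
   directions. *)
Lemma schwarz phi X a b : Ck 2 setT phi ->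
  a \in [:: e_x; e_y; e_z] -> b \in [:: e_x; e_y; e_z] ->
  'D_a ('D_b phi) X = 'D_b ('D_a phi) X.
Proof.
move=> /Ck2_C1[c c2] aa ba; have ca := c2 _ aa; have cb := c2 _ ba.
apply/eqP/negPn/negP => ne.
pose e := `|'D_a ('D_b phi) X - 'D_b ('D_a phi) X| / 2.
have e0 : 0 < e by rewrite divr_gt0 // normr_gt0 subr_eq0.
have [d d0 hd] : exists2 d : R, 0 < d & forall Y, ball X d Y ->
    `|'D_a ('D_b phi) X - 'D_a ('D_b phi) Y| < e
    /\ `|'D_b ('D_a phi) X - 'D_b ('D_a phi) Y| < e.
  have n1 := continuous_dist (C1_der_continuous cb (I : setT X) aa) e0.
  have n2 := continuous_dist (C1_der_continuous ca (I : setT X) ba) e0.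
  have /nbhs_ballP[d /= d0 hd] :
      nbhs X [set Y | `|'D_a ('D_b phi) X - 'D_a ('D_b phi) Y| < e
                   /\ `|'D_b ('D_a phi) X - 'D_b ('D_a phi) Y| < e].
    by apply: filterS2 n1 n2 => Y h1 h2; split; [exact: h1|exact: h2].
  by exists d => // Y /hd.
pose h := d / 3.
have h0 : 0 < h by rewrite divr_gt0.
have unit u v (s t : R) : u \in [:: e_x; e_y; e_z] -> v \in [:: e_x; e_y; e_z] ->
    0 <= s <= h -> 0 <= t <= h -> ball X d (s *: u + (t *: v + X)).
  have -> : d = h * 3 by rewrite /h; field.
  by move=> ua va sh th; exact: ball_cell.
(* The two mean value points are different, but both lie in the small ball. *)
have [t [s [th sh E1]]] := second_difference X h0 c aa ba ca.
have [t' [s' [th' sh' E2]]] := second_difference X h0 c ba aa cb.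
have [_ k1] := hd _ (unit b a s t ba aa sh th).
have [k2 _] := hd _ (unit a b s' t' aa ba sh' th').
have EE : 'D_b ('D_a phi) (s *: b + (t *: a + X)) = 'D_a ('D_b phi) (s' *: a + (t' *: b + X)).
  have h2 : h ^+ 2 != 0 by rewrite expf_neq0 // gt_eqF.
  apply: (mulfI h2); refine (etrans (esym E1) (etrans _ E2)).
  rewrite [h *: b + (h *: a + X)]addrCA.
  by move: (phi _) (phi _) (phi _) (phi _) => *; ring.
rewrite EE in k1.
have far (u v w : R) : `|u - v| = 2 * e -> `|u - w| < e -> `|v - w| < e -> False.
  move=> uv uw vw; have := ler_distD w u v.
  by rewrite (distrC w v); clear -uv uw vw; lra.
by apply: far k2 k1; rewrite /e; field.
Qed.

(** A gradient is curl free, tested against [eta]: by the symmetry of the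
   second derivatives of [eta] the integrand is
   [D_a (phi D_b eta) - D_b (phi D_a eta)]. *)
Lemma gradient_curl_free D K phi eta a b : open D -> compact K -> K `<=` D ->
  C1 D phi -> Ck 2 setT eta -> (forall X, ~ K X -> eta X = 0) ->
  a \in [:: e_x; e_y; e_z] -> b \in [:: e_x; e_y; e_z] ->
  (\int[mu3 R]_X ('D_a phi X * 'D_b eta X - 'D_b phi X * 'D_a eta X)%:E = 0)%E.
Proof.
move=> oD cK KD cphi ceta eta0 aa ba.
have [_ c2] := Ck2_C1 ceta.
pose G u X := phi X * 'D_u eta X.
have D0 u X : ~ K X -> 'D_u eta X = 0 by exact: der_outside_compact.
have G0 u X : ~ K X -> G u X = 0 by move=> KX; rewrite /G D0 // mulr0.
have I u v : u \in [:: e_x; e_y; e_z] -> v \in [:: e_x; e_y; e_z] ->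
    (mu3 R).-integrable setT (fun X => ('D_v (G u) X)%:E)
    /\ (\int[mu3 R]_X ('D_v (G u) X)%:E = 0)%E.
  move=> ua va; apply: (integral_der_compact cK) => //; last exact: G0.
  by apply: (C1_ext0 cK KD _ (G0 u)); exact: (C1M oD cphi (C1S (@subsetT _ D) (c2 _ ua))).
have [i1 e1] := I b a ba aa; have [i2 e2] := I a b aa ba.
transitivity (\int[mu3 R]_X (('D_a (G b) X)%:E - ('D_b (G a) X)%:E))%E; last first.
  refine (etrans (integralB measurableT i1 i2) _).
  by refine (etrans (congr2 (fun u v => (u - v)%E) e1 e2) _); exact: sube0.
apply: eq_integral => X _; rewrite -EFinB; congr EFin.
have [KX|KX] := pselect (K X); last first.
  by rewrite !D0 // !mulr0 !(der_outside_compact _ cK (G0 _) KX).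
have DX := KD _ KX.
rewrite /G (der_mul cphi (C1S (@subsetT _ D) (c2 _ ba)) DX aa).
rewrite (der_mul cphi (C1S (@subsetT _ D) (c2 _ aa)) DX ba).
move: ('D_a ('D_b eta) X) ('D_b ('D_a eta) X) (schwarz X ceta aa ba) => u v ->.
by move: ('D_a phi X) ('D_b phi X) ('D_a eta X) ('D_b eta X) (phi X) => *; ring.
Qed.

End Green.

(** * Cutoff functions *)
Section Cutoff.
Context {R : realType}.
Implicit Types s t : R.

Definition pos_part s := Num.max s 0.
(** Continuously differentiable, unlike [pos_part]; all cutoffs are made of this
   function. *)
Definition sqpos s := pos_part s ^+ 2.

Lemma pos_part_continuous : continuous pos_part.
Proof. by move=> s; apply: continuous_max; [exact: cvg_id|exact: cvg_cst]. Qed.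

Lemma pos_part_ge0 s : 0 <= pos_part s. Proof. by rewrite le_max lexx orbT. Qed.
Lemma pos_partE s : 0 <= s -> pos_part s = s. Proof. by move=> /max_idPl. Qed.
Lemma pos_part0 s : s <= 0 -> pos_part s = 0. Proof. by move=> /max_idPr. Qed.

Lemma is_derive_sqpos s : is_derive s 1 sqpos (2 * pos_part s).
Proof.
have [s0|s0|s0] := ltgtP s 0.
- rewrite pos_part0 ?ltW // mulr0; apply: near_eq_is_derive (is_derive_cst 0 s 1).
  near=> t; rewrite /sqpos pos_part0 ?expr0n //.
  by apply: ltW; near: t; exact: lt_nbhsl.
- rewrite pos_partE ?ltW //.
  have d : is_derive s 1 (fun t => t ^+ 2) (2 * s).
    by apply: is_derive_eq; rewrite /GRing.scale /= mulr1; ring.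
  apply: near_eq_is_derive d; near=> t; rewrite /sqpos pos_partE //.
  by apply: ltW; near: t; exact: lt_nbhsr.
- rewrite s0 pos_part0 // mulr0; apply/is_derive1_caratheodory.
  exists pos_part; split; last exact: pos_part0.
    move=> z; rewrite /sqpos (pos_part0 (lexx 0)) expr0n subr0 expr2 subr0.
    have [z0|z0] := leP 0 z; first by rewrite !pos_partE.
    by rewrite !pos_part0 ?mul0r // ltW.
  exact: pos_part_continuous.
Unshelve. all: by end_near. Qed.

Lemma sqpos_ge0 s : 0 <= sqpos s. Proof. exact: sqr_ge0. Qed.
Lemma sqpos0 s : s <= 0 -> sqpos s = 0. Proof. by move=> s0; rewrite /sqpos pos_part0 ?expr0n. Qed.
Lemma sqpos_gt0 s : 0 < s -> 0 < sqpos s.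
Proof. by move=> s0; rewrite /sqpos pos_partE ?exprn_gt0 // ltW. Qed.

(** A step of class C1 from 0 on the negative half-line to 1 on [1, +oo[. *)
Definition step s := 1 - sqpos (1 - sqpos s).
Definition dstep s := 2 * pos_part (1 - sqpos s) * (2 * pos_part s).

Lemma is_derive_step s : is_derive s 1 step (dstep s).
Proof.
have d1 := is_deriveB (is_derive_cst (1 : R) s 1) (is_derive_sqpos s).
have d2 := @is_derive1_comp R sqpos _ s _ _ (is_derive_sqpos (1 - sqpos s)) d1.
have d3 := is_deriveB (is_derive_cst (1 : R) s 1) d2.
by apply: is_derive_eq d3 _; rewrite /dstep !sub0r mulrN opprK.
Qed.

Lemma dstep_continuous : continuous dstep.
Proof.
have c1 : continuous (fun s : R => 2 * pos_part s).
  by move=> s; apply: cvgM; [exact: cvg_cst|exact: pos_part_continuous].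
move=> s; apply: cvgM; last exact: c1.
apply: (@continuous_comp _ _ _ (fun s : R => 1 - sqpos s) (fun s : R => 2 * pos_part s)); last exact: c1.
apply: cvgB; first exact: cvg_cst.
by apply/differentiable_continuous/derivable1_diffP; case: (is_derive_sqpos s).
Qed.

Lemma dstep_ge0 s : 0 <= dstep s.
Proof. by rewrite /dstep !mulr_ge0 ?pos_part_ge0. Qed.

Lemma dstep0 s : s <= 0 -> dstep s = 0.
Proof. by move=> s0; rewrite /dstep (pos_part0 s0) !mulr0. Qed.

Lemma dstep1 s : 1 <= s -> dstep s = 0.
Proof.
move=> s1; have : 1 <= sqpos s.
  by rewrite /sqpos pos_partE ?exprn_ege1 //; lra.
by move=> h; rewrite /dstep (@pos_part0 (1 - sqpos s)) ?mulr0 ?mul0r //; lra.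
Qed.

Lemma step0 s : s <= 0 -> step s = 0.
Proof. by move=> s0; rewrite /step (sqpos0 s0) subr0 /sqpos pos_partE // expr1n subrr. Qed.

Lemma step1 s : 1 <= s -> step s = 1.
Proof.
move=> s1; have : 1 <= sqpos s.
  by rewrite /sqpos pos_partE ?exprn_ege1 //; lra.
by move=> h; rewrite /step (@sqpos0 (1 - sqpos s)) ?subr0 //; lra.
Qed.

Lemma step_bounds s : 0 <= step s <= 1.
Proof.
have h := sqpos_ge0 s; have k := sqpos_ge0 (1 - sqpos s).
have : sqpos (1 - sqpos s) <= 1.
  rewrite /sqpos -/(sqpos s) expr_le1 ?pos_part_ge0 // /pos_part ge_max ler01 andbT.
  by lra.
by rewrite /step; move: (sqpos _) k => u *; lra.
Qed.

End Cutoff.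

(** * Geometry of the nozzle *)
Section Geometry.
Context {R : realType} (f : R -> R).
Hypothesis hf : nozzle_profile f.
Implicit Types (X Y e : space3 R) (A : R).
Local Hint Resolve ex_axis ey_axis ez_axis : core.

Lemma profile_derive (x : R) : is_derive x 1 f (derive1 f x).
Proof.
have [[al _ [d _]] _ _ _] := hf.
by rewrite derive1E; apply: derivableP; exact: d.
Qed.

Lemma profile_continuous : continuous f.
Proof. by move=> x; apply/differentiable_continuous/derivable1_diffP; case: (profile_derive x). Qed.

Lemma profile_derive_continuous : continuous (derive1 f).
Proof.
have [[al /andP[al0 al1] [_ [C hC]]] _ _ _] := hf.
have C0 : 0 <= C by have [h _] := hC 0 0; apply: le_trans h.
move=> x; apply/cvgrPdist_le => e e0.
pose d := (e / (C + 1)) `^ (al^-1).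
have q0 : 0 < e / (C + 1) by rewrite divr_gt0 //; lra.
have d0 : 0 < d by rewrite powR_gt0.
have := nbhsx_ballx x d d0; apply: filterS => y xy.
have [_ h] := hC x y; apply: le_trans h _.
have xyd : `|x - y| <= d by exact: ltW.
have : `|x - y| `^ al <= d `^ al.
  by apply: ge0_ler_powR; rewrite ?nnegrE ?normr_ge0 //; exact: ltW.
rewrite -powRrM mulVf ?gt_eqF // (powRr1 (ltW q0)) => h.
apply: le_trans (ler_wpM2l C0 h) _.
by rewrite mulrA ler_pdivrMr; nra.
Qed.

Lemma profile_gt0 : exists2 b : R, 0 < b & forall x, b <= f x.
Proof.
have [_ i0 _ _] := hf; exists (inf (range f)) => // x.
have [[_ lb]|ni] := pselect (has_inf (range f)); last first.
  by move: i0; rewrite inf_out // ltxx.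
by apply: ge_inf => //; exists x.
Qed.

Lemma profile_pos (x : R) : 0 < f x.
Proof. by have [b b0 h] := profile_gt0; exact: lt_le_trans (h x). Qed.

(** Positive exactly in the nozzle, and unlike [f (xc X) - radius X]
   differentiable on the axis. *)
Definition dfun X : R := f (xc X) ^+ 2 - (yc X ^+ 2 + zc X ^+ 2).

Lemma radius_ge0 X : 0 <= radius X. Proof. exact: sqrtr_ge0. Qed.

Lemma radius_sqr X : radius X ^+ 2 = yc X ^+ 2 + zc X ^+ 2.
Proof. by rewrite sqr_sqrtr // addr_ge0 ?sqr_ge0. Qed.

Lemma nozzleE X : nozzle f X = (0 < dfun X) :> Prop.
Proof.
rewrite /nozzle /dfun /= -radius_sqr subr_gt0 ltr_sqr ?nnegrE ?radius_ge0 //.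
by rewrite ltW ?profile_pos.
Qed.

Lemma wallE X : dfun X = 0 -> wall f X.
Proof.
rewrite /wall /dfun /= -radius_sqr => /eqP; rewrite subr_eq0 eqrXn2 //; last exact: radius_ge0.
  by move=> /eqP.
by rewrite ltW ?profile_pos.
Qed.

Let is_derive_sqr (s : R) : is_derive s 1 (fun t => t ^+ 2) (2 * s).
Proof. by apply: is_derive_eq; rewrite /GRing.scale /= mulr1; ring. Qed.

Let is_derive_Nsqr (s : R) : is_derive s 1 (fun t => - t ^+ 2) (- (2 * s)).
Proof. exact: is_deriveN. Qed.

Let is_derive_fsqr (s : R) : is_derive s 1 (fun t => f t ^+ 2) (2 * f s * derive1 f s).
Proof. exact: (@is_derive1_comp R (fun t => t ^+ 2) f s _ _ (is_derive_sqr _) (profile_derive s)). Qed.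

Lemma C1_coord D (c : space3 R -> R) : continuous c ->
  (forall (r : R) X Y, c (r *: X + Y) = r * c X + c Y) ->
  C1 D c /\ forall X e, 'D_e c X = c e.
Proof.
move=> cc lin.
have dc X e : is_derive X e c (c e).
  have sl (h : R) : (h + 0) *: e + X = h *: e + X by rewrite addr0.
  have [_ d2] := @slice_derive _ c X e (fun t => t *: e + X) 0 sl.
  have D1 : is_derive (0 : R) 1 (fun t : R => c (t *: e + X)) (c e).
    have -> : (fun t : R => c (t *: e + X)) = (fun t => t * c e + c X).
      by apply/funext => t; rewrite lin.
    by apply: is_derive_eq; rewrite /GRing.scale /= mulr0 add0r addr0 mulr1.
  apply: DeriveDef; last by rewrite -d2 derive1E; case: D1.
  by apply/derivable1P; case: D1.
split; last by move=> X e; case: (dc X e).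
move=> X _; split; first exact: cc.
move=> e _; split; first by case: (dc X e).
have -> : 'D_e c = cst (c e) by apply/funext => Y; case: (dc Y e).
exact: cvg_cst.
Qed.

Lemma C1_xc D : C1 D (@xc R) /\ forall X e, 'D_e (@xc R) X = xc e.
Proof. by apply: C1_coord => //; exact: continuous_xc. Qed.

Lemma C1_yc D : C1 D (@yc R) /\ forall X e, 'D_e (@yc R) X = yc e.
Proof. by apply: C1_coord => //; exact: continuous_yc. Qed.

Lemma C1_zc D : C1 D (@zc R) /\ forall X e, 'D_e (@zc R) X = zc e.
Proof. by apply: C1_coord => //; exact: continuous_zc. Qed.

Lemma C1_dfun : C1 setT dfun /\ forall X e, e \in [:: e_x; e_y; e_z] ->
  'D_e dfun X = 2 * f (xc X) * derive1 f (xc X) * xc e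
    - 2 * yc X * yc e - 2 * zc X * zc e.
Proof.
have [cx dx] := C1_xc setT; have [cy dy] := C1_yc setT; have [cz dz] := C1_zc setT.
have c2 : continuous (fun t : R => - (2 * t)).
  by move=> t; apply: cvgN; apply: cvgM; [exact: cvg_cst|exact: cvg_id].
have cf : continuous (fun t => 2 * f t * derive1 f t).
  move=> t; apply: cvgM; last exact: profile_derive_continuous.
  by apply: cvgM; [exact: cvg_cst|exact: profile_continuous].
have c1 := C1_comp (dh := fun t => 2 * f t * derive1 f t) openT cx (fun X _ => conj (is_derive_fsqr (xc X)) (cf (xc X))).
have c1y := C1_comp (dh := fun t => - (2 * t)) openT cy (fun X _ => conj (is_derive_Nsqr (yc X)) (c2 (yc X))).
have c1z := C1_comp (dh := fun t => - (2 * t)) openT cz (fun X _ => conj (is_derive_Nsqr (zc X)) (c2 (zc X))).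
have c12 := C1D openT c1 c1y; have c123 := C1D openT c12 c1z.
have E : dfun = (fun X => f (xc X) ^+ 2 + - yc X ^+ 2 + - zc X ^+ 2).
  by apply/funext => X; rewrite /dfun opprD addrA.
rewrite E; split => // X e ea.
have d1 := der_comp (dh := fun t => 2 * f t * derive1 f t) cx (I : setT X) ea (is_derive_fsqr (xc X)).
have d2 := der_comp (dh := fun t => - (2 * t)) cy (I : setT X) ea (is_derive_Nsqr (yc X)).
have d3 := der_comp (dh := fun t => - (2 * t)) cz (I : setT X) ea (is_derive_Nsqr (zc X)).
have D1 := deriveD (C1_derivable c12 (I : setT X) ea) (C1_derivable c1z (I : setT X) ea).
have D2 := deriveD (C1_derivable c1 (I : setT X) ea) (C1_derivable c1y (I : setT X) ea).
refine (etrans D1 _); refine (etrans (congr2 +%R D2 d3) _).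
rewrite d1 d2 dx dy dz; move: (f _) (derive1 f _) (xc e) (yc e) (zc e) => *.
by ring.
Qed.

Lemma dfun_continuous : continuous dfun.
Proof. by move=> X; exact: (C1_continuous C1_dfun.1). Qed.

Lemma nozzle_open : open (nozzle f).
Proof.
have -> : nozzle f = dfun @^-1` [set t | 0 < t].
  by apply/funext => X; rewrite nozzleE.
by move/continuousP : dfun_continuous; apply; exact: open_gt.
Qed.

Lemma nozzle_measurable : measurable3 (nozzle f).
Proof. exact: open_measurable3 nozzle_open. Qed.

(** For [0 < d] these compact sets exhaust the nozzle. *)
Definition core (d A : R) : set (space3 R) := [set X | d <= dfun X /\ `|xc X| <= A].

Lemma core_sub d A : 0 < d -> core d A `<=` nozzle f.
Proof. by move=> d0 X [dX _]; rewrite nozzleE; exact: lt_le_trans dX. Qed.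

Lemma closed_nozzle_box A : exists B, forall X, 0 <= dfun X -> `|xc X| <= A -> box B X.
Proof.
have cI : {within `[- A, A], continuous f} by apply: continuous_subspaceT; exact: profile_continuous.
have [M [_ hM]] := compact_bounded (continuous_compact cI (@segment_compact _ _ _)).
have fM x : `|x| <= A -> f x <= `|M| + 1.
  move=> xA; apply: le_trans (ler_norm _) _.
  apply: (hM (`|M| + 1)); first by rewrite (le_lt_trans (ler_norm _)) // ltrDl.
  by exists x => //=; rewrite in_itv /= -ler_norml.
exists (Num.max A (`|M| + 1)) => X dX xA.
have M0 : 0 <= `|M| + 1 by rewrite addr_ge0.
have F : f (xc X) ^+ 2 <= (`|M| + 1) ^+ 2.
  by rewrite ler_sqr ?nnegrE // ?fM // ltW // profile_pos.
have sq (t : R) : t ^+ 2 <= f (xc X) ^+ 2 -> `|t| <= Num.max A (`|M| + 1).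
  move=> tf; rewrite le_max; apply/orP; right.
  rewrite -(ler_sqr (normr_ge0 _)) ?nnegrE // real_normK ?num_real //.
  exact: le_trans tf F.
have y0 := sqr_ge0 (yc X); have z0 := sqr_ge0 (zc X).
apply/boxP; split; first by rewrite le_max xA.
- by apply: sq; move: dX; rewrite /dfun; lra.
- by apply: sq; move: dX; rewrite /dfun; lra.
Qed.

Lemma core_closed d A : closed (core d A).
Proof.
have -> : core d A = (dfun @^-1` [set t | d <= t]) `&` ((fun X => `|xc X|) @^-1` [set t | t <= A]).
  by [].
apply: closedI; apply: closed_comp.
- by move=> X _; exact: dfun_continuous.
- exact: closed_ge.
- move=> X _; apply: continuous_comp; first exact: continuous_xc.
  exact: norm_continuous.
- exact: closed_le.
Qed.

Lemma core_compact d A : 0 <= d -> compact (core d A).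
Proof.
move=> d0; have [B hB] := closed_nozzle_box A.
apply: subclosed_compact (@core_closed d A) (@box_compact _ B) _.
by move=> X [dX xA]; apply: hB => //; exact: le_trans dX.
Qed.

End Geometry.

(** * Limits of integrals over the nozzle *)
Section IntegralTools.
Context {R : realType}.
Implicit Types (D K : set (space3 R)) (X : space3 R) (phi u : space3 R -> R).

Lemma Rintegral_eq0 D phi : (\int[mu3 R]_(X in D) (phi X)%:E = 0)%E ->
  \int[mu3 R]_(X in D) phi X = 0.
Proof. by rewrite /Rintegral => ->. Qed.

Lemma Rintegral_EFin D phi : measurable3 D -> (mu3 R).-integrable D (EFin \o phi) ->
  (\int[mu3 R]_(X in D) (phi X)%:E)%E = (\int[mu3 R]_(X in D) phi X)%:E.
Proof. by move=> mD i; rewrite fineK //; exact: integrable_fin_num. Qed.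

Lemma continuous_ext0 D K phi : open D -> compact K -> K `<=` D ->
  (forall X, D X -> {for X, continuous phi}) ->
  (forall X, ~ K X -> phi X = 0) -> continuous phi.
Proof.
move=> oD cK KD c p0 X; have [KX|KX] := pselect (K X); first exact/c/KD.
apply: (@continuous_near_eq _ _ (cst 0)); last exact: cvg_cst.
by apply: filterS (near_outside_compact cK KX) => Y /p0.
Qed.

Lemma compact_integrable K phi : compact K -> continuous phi ->
  (forall X, ~ K X -> phi X = 0) -> (mu3 R).-integrable setT (EFin \o phi).
Proof.
move=> cK c p0; have [A KA] := compact_in_box cK.
by apply: (@continuous_box_integrable _ _ A) => // X bX; apply: p0 => /KA.
Qed.

Lemma Rintegral_support D phi : measurable3 D -> (forall X, ~ D X -> phi X = 0) ->
  \int[mu3 R]_(X in D) phi X = \int[mu3 R]_X phi X.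
Proof.
move=> mD p0; rewrite Rintegral_mkcond; congr Rintegral; apply/funext => X.
by rewrite patchE; case: ifPn => // /negP XD; rewrite p0 // => DX; apply: XD; rewrite inE.
Qed.

Lemma ae_sub d (T : measurableType d) (mu : set T -> \bar R) (P Q : set T) :
  (forall x, P x -> Q x) -> {ae mu, forall x, P x} -> {ae mu, forall x, Q x}.
Proof.
move=> PQ [N [mN N0 sub]]; exists N; split => // x nQ.
by apply: sub => /PQ.
Qed.

(** Dominated convergence, with the dominating function [C * \1_(box A)]. *)
Lemma box_dominated D (u_ : nat -> space3 R -> R) u A C : measurable3 D ->
  (forall n, measurable_fun3 D (u_ n)) -> measurable_fun3 D u ->
  {ae mu3 R, forall X, D X -> u_ n X @[n --> \oo] --> u X} ->
  (forall n X, D X -> `|u_ n X| <= C) ->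
  (forall n X, D X -> ~ box A X -> u_ n X = 0) ->
  (mu3 R).-integrable D (EFin \o u)
  /\ \int[mu3 R]_(X in D) u_ n X @[n --> \oo] --> \int[mu3 R]_(X in D) u X.
Proof.
move=> mD mu_ mu cu uC u0.
have iu n : (mu3 R).-integrable D (EFin \o u_ n).
  exact: (box_integrable mD (mu_ n) (uC n) (u0 n)).
have := @dominated_convergence _ (M3 R) R (mu3 R) D mD (fun n => EFin \o u_ n)
  (EFin \o u) (fun X => (C * \1_(box A) X)%:E).
case.
- by move=> n; apply/measurable_EFinP; exact: mu_.
- exact/measurable_EFinP.
- apply: ae_sub cu => X cX DX /=.
  by apply: cvg_EFin; [exact: nearW|exact: cX].
- exact: (integrableZl mD C (box_indic_integrable A mD)).
- apply: aeW => X n DX /=; rewrite lee_fin indicE.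
  have [bX|bX] := pselect (box A X); first by rewrite mem_set // mulr1 uC.
  by rewrite memNset //= mulr0 u0 // normr0.
move=> i _ c; split => //.
by apply: fine_cvg; rewrite fineK; [exact: c|exact: integrable_fin_num].
Qed.

End IntegralTools.

(** * Properties of a single flow *)
Section Flow.
Context {R : realType} (p f : R -> R) (m : R) (Phi : space3 R -> R) (U V : R * R -> R).
Hypotheses (hp : gas_law p) (hf : nozzle_profile f).
Hypothesis flow : subsonic_flow p f m Phi U V.
Implicit Types (X Y e : space3 R) (K : set (space3 R)) (psi eta : space3 R -> R).
Local Hint Resolve ex_axis ey_axis ez_axis : core.
Local Notation v := (velocity U V).
Local Notation D := (nozzle f).
Local Notation F := (fun X => mass_flux p (v X)).

Lemma flow_speed_lt1 X : closure D X -> dot3 (v X) (v X) < 1.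
Proof.
move=> DX; have s1 := flow_subsonic flow.
have : (((speed U V X)%:E : \bar R) < 1)%E.
  by apply: le_lt_trans s1; apply: ereal_sup_ubound; exists X.
rewrite lte_fin /speed => h.
have := sqrtr_ge0 (dot3 (v X) (v X)) => h0.
rewrite -(sqr_sqrtr (dot3_ge0 (v X))) expr_lt1 //.
Qed.

Lemma flow_speed_lt1_in X : D X -> dot3 (v X) (v X) < 1.
Proof. by move=> DX; apply: flow_speed_lt1; exact: subset_closure. Qed.

Lemma flow_C1 : C1 D Phi /\ forall e, e \in [:: e_x; e_y; e_z] -> C1 D ('D_e Phi).
Proof. exact: Ck2_C1 (flow_C2 flow). Qed.

Lemma flow_der X : D X -> [/\ 'D_e_x Phi X = xc (v X), 'D_e_y Phi X = yc (v X)
  & 'D_e_z Phi X = zc (v X)].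
Proof. by move=> /(flow_grad flow) <-. Qed.

Lemma flow_grad_lt1 X : D X -> dot3 (grad Phi X) (grad Phi X) < 1.
Proof. by move=> DX; rewrite (flow_grad flow DX) flow_speed_lt1_in. Qed.

(** Strictly below the critical speed [g] is of class C1, so the flux of a flow
   is a classical C1 field in the nozzle. *)
Lemma flow_dens_C1 : C1 D (fun X => dens p (dot3 (grad Phi X) (grad Phi X))).
Proof.
have oD := nozzle_open hf; have [_ c2] := flow_C1.
have cq : C1 D (fun X => dot3 (grad Phi X) (grad Phi X)).
  have q e ea := C1M oD (c2 e ea) (c2 e ea).
  exact: (C1D oD (C1D oD (q _ ex_axis) (q _ ey_axis)) (q _ ez_axis)).
apply: (C1_comp (dh := fun s => - (dens p s / (2 * derive1 p (dens p s)))) oD cq).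
move=> X DX; have s1 := ltW (flow_grad_lt1 DX).
split; first exact: is_derive_dens.
move: s1; move: (dot3 _ _) => s s1.
have g1 := dens_ge1 hp s1; have d1 := gas_derive_ge1 hp g1.
have cg := dens_continuous hp s1.
apply: cvgN; apply: cvgM; first exact: cg.
apply: cvgV; first by rewrite mulf_neq0 // gt_eqF //; lra.
apply: cvgM; first exact: cvg_cst.
by apply: (@continuous_comp _ _ _ (dens p) (derive1 p)) => //; apply: gas_derive_continuous => //; lra.
Qed.

Lemma flow_flux_C1 : [/\ C1 D (xc \o F), C1 D (yc \o F) & C1 D (zc \o F)].
Proof.
have oD := nozzle_open hf; have [_ c2] := flow_C1.
have E X : D X -> F X = dens p (dot3 (grad Phi X) (grad Phi X)) *: grad Phi X.
  by move=> DX; rewrite (flow_grad flow DX).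
have T c e : e \in [:: e_x; e_y; e_z] ->
    (forall X, D X -> c (F X) = dens p (dot3 (grad Phi X) (grad Phi X)) * 'D_e Phi X) ->
    C1 D (c \o F).
  move=> ea h; apply: (C1_near_eq oD _ (C1M oD flow_dens_C1 (c2 e ea))).
  by move=> X; rewrite inE => DX; exact: h.
by split; [apply: (T _ e_x)|apply: (T _ e_y)|apply: (T _ e_z)] => // X /E ->.
Qed.

Lemma flow_flux_div0 X : D X -> div3 F X = 0.
Proof.
move=> DX; rewrite -(flow_div flow DX).
have nD : \forall Y \near X, D Y by apply: open_nbhs_nbhs; split => //; exact: nozzle_open.
have T (c : space3 R -> R) e : 'D_e (c \o F) X = 'D_e (c \o (fun Y => dens p (dot3 (grad Phi Y) (grad Phi Y)) *: grad Phi Y)) X.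
  by apply: near_eq_derive; apply: filterS nD => Y DY; rewrite /= (flow_grad flow DY).
by rewrite /div3 !T.
Qed.

Lemma flow_weak_interior K psi : compact K -> K `<=` D -> C1 D psi ->
  (forall X, ~ K X -> psi X = 0) ->
  \int[mu3 R]_X dot3 (F X) (grad psi X) = 0.
Proof.
move=> cK KD cpsi psi0; have [c1 c2 c3] := flow_flux_C1.
apply: Rintegral_eq0; rewrite -[RHS](green (nozzle_open hf) cK KD c1 c2 c3 cpsi psi0).
apply: eq_integral => X _; congr EFin.
have [KX|KX] := pselect (K X); first by rewrite (flow_flux_div0 (KD _ KX)) mulr0 addr0.
by rewrite psi0 // mul0r addr0.
Qed.

Lemma flow_velocity_continuous X : D X ->
  [/\ {for X, continuous (xc \o v)}, {for X, continuous (yc \o v)} & {for X, continuous (zc \o v)}].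
Proof.
move=> DX; have nD : \forall Y \near X, D Y by apply: open_nbhs_nbhs; split => //; exact: nozzle_open.
have [_ c2] := flow_C1.
split; [apply: (continuous_near_eq _ (C1_continuous (c2 _ ex_axis) DX))
          |apply: (continuous_near_eq _ (C1_continuous (c2 _ ey_axis) DX))
          |apply: (continuous_near_eq _ (C1_continuous (c2 _ ez_axis) DX))];
  apply: filterS nD => Y DY /=; have [d1 d2 d3] := flow_der DY;
  by [rewrite d1|rewrite d2|rewrite d3].
Qed.

Lemma flow_dens_bounds X : D X -> 1 <= dens p (dot3 (v X) (v X)) <= dens p 0.
Proof.
move=> DX; have s1 := ltW (flow_speed_lt1_in DX).
by rewrite (dens_ge1 hp) // (dens_le_stagnation hp) // dot3_ge0.
Qed.

Lemma flow_flux_bound X (w : space3 R) M : D X -> 0 <= M ->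
  `|xc w| <= M -> `|yc w| <= M -> `|zc w| <= M -> `|dot3 (F X) w| <= dens p 0 * (3 * M).
Proof.
move=> DX M0 w1 w2 w3; have /andP[g1 g2] := flow_dens_bounds DX.
rewrite dot3Zl normrM (ger0_norm (le_trans ler01 g1)).
apply: ler_pM => //; first exact: le_trans g1.
exact: (@dot3_le3 _ _ w M M0 (ltW (flow_speed_lt1_in DX)) w1 w2 w3).
Qed.

Lemma dot3_flux_continuous (w : space3 R -> space3 R) X : D X ->
  {for X, continuous (xc \o w)} -> {for X, continuous (yc \o w)} ->
  {for X, continuous (zc \o w)} -> {for X, continuous (fun X => dot3 (F X) (w X))}.
Proof.
move=> DX w1 w2 w3; have [c1 c2 c3] := flow_flux_C1.
by apply: cvgD; [apply: cvgD|]; apply: cvgM => //;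
  [exact: C1_continuous c1 DX|exact: C1_continuous c2 DX|exact: C1_continuous c3 DX].
Qed.

Lemma grad_continuous psi X : C1 D psi -> D X ->
  [/\ {for X, continuous (xc \o grad psi)}, {for X, continuous (yc \o grad psi)}
    & {for X, continuous (zc \o grad psi)}].
Proof. by move=> c DX; split; exact: (C1_der_continuous c DX). Qed.

End Flow.

(** * The layer along the wall *)
Section Layer.
Context {R : realType} (f : R -> R).
Hypothesis hf : nozzle_profile f.
Implicit Types (X Y e : space3 R) (A eps : R).
Local Hint Resolve ex_axis ey_axis ez_axis : core.
Local Notation D := (nozzle f).
Local Notation d := (dfun f).

(** Cutoffs along the level sets of [d]; [dchi] is the derivative of [chi] in [d]. *)
Definition chi eps X : R := step ((d X - eps) / eps).
Definition dchi eps X : R := dstep ((d X - eps) / eps) / eps.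

Lemma chi_C1 eps : C1 setT (chi eps) /\
  forall X e, e \in [:: e_x; e_y; e_z] -> 'D_e (chi eps) X = dchi eps X * 'D_e d X.
Proof.
have [cd _] := C1_dfun hf.
have dh (t : R) : is_derive t 1 (fun t : R => step ((t - eps) / eps)) (dstep ((t - eps) / eps) / eps).
  have d1 : is_derive t 1 (fun t : R => (t - eps) / eps) eps^-1.
    by apply: is_derive_eq; rewrite /GRing.scale /= subr0 mulr1 mulr0 add0r.
  exact: (@is_derive1_comp R (@step R) _ t _ _ (is_derive_step _) d1).
split.
  apply: (@C1_comp _ _ (fun t : R => step ((t - eps) / eps))
    (fun t => dstep ((t - eps) / eps) / eps) d openT cd) => X _.
  split; first exact: dh.
  apply: cvgM; last exact: cvg_cst.
  apply: (@continuous_comp _ _ _ (fun t : R => (t - eps) / eps) (@dstep R)).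
    apply: cvgM; last exact: cvg_cst.
    by apply: cvgB; [exact: cvg_id|exact: cvg_cst].
  exact: dstep_continuous.
by move=> X e ea; exact: (@der_comp _ _ (fun t : R => step ((t - eps) / eps)) (fun t => dstep ((t - eps) / eps) / eps) d X e cd I ea (dh _)).
Qed.

Lemma dchi_ge0 eps X : 0 < eps -> 0 <= dchi eps X.
Proof. by move=> e0; rewrite divr_ge0 ?dstep_ge0 // ltW. Qed.

Lemma dchi_layer eps X : 0 < eps -> dchi eps X != 0 -> eps < d X < 2 * eps.
Proof.
move=> e0 h; apply/andP; split; rewrite ltNge; apply: contra h => h.
  rewrite /dchi dstep0 ?mul0r // pmulr_lle0 ?invr_gt0 //.
  by rewrite subr_le0.
rewrite /dchi dstep1 ?mul0r // ler_pdivlMr // mul1r lerBrDr.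
by move: h; rewrite mulr_natl mulr2n.
Qed.

Lemma chi_eq0 eps X : 0 < eps -> d X <= eps -> chi eps X = 0.
Proof. by move=> e0 dX; rewrite /chi step0 // pmulr_lle0 ?invr_gt0 // subr_le0. Qed.

Lemma chi_eq1 eps X : 0 < eps -> 2 * eps <= d X -> chi eps X = 1.
Proof.
move=> e0 dX; rewrite /chi step1 // ler_pdivlMr // mul1r lerBrDr.
by move: dX; rewrite mulr_natl mulr2n.
Qed.

Lemma dchi_continuous eps : continuous (dchi eps).
Proof.
move=> X; apply: cvgM; last exact: cvg_cst.
apply: (@continuous_comp _ _ _ (fun X => (d X - eps) / eps) (@dstep R)); last exact: dstep_continuous.
apply: cvgM; last exact: cvg_cst.
by apply: cvgB; [exact: dfun_continuous|exact: cvg_cst].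
Qed.

(** An axial cutoff; fields transversal to the axis are orthogonal to its
   gradient. *)
Definition kappa A X : R := sqpos (A ^+ 2 - xc X ^+ 2).

Lemma kappa_C1 A : C1 setT (kappa A) /\
  forall X, 'D_e_y (kappa A) X = 0 /\ 'D_e_z (kappa A) X = 0.
Proof.
have [cx dx] := C1_xc (setT : set (space3 R)).
pose dh (t : R) := 2 * pos_part (A ^+ 2 - t ^+ 2) * - (2 * t).
have hd (t : R) : is_derive t 1 (fun t : R => sqpos (A ^+ 2 - t ^+ 2)) (dh t).
  have d1 : is_derive t 1 (fun t : R => A ^+ 2 - t ^+ 2) (- (2 * t)).
    by apply: is_derive_eq; rewrite /GRing.scale /= mulr1; ring.
  exact: (@is_derive1_comp R (@sqpos R) _ t _ _ (is_derive_sqpos _) d1).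
have cdh : continuous dh.
  have csq : continuous (fun t : R => A ^+ 2 - t ^+ 2).
    by move=> t; apply: cvgB; [exact: cvg_cst|exact: exprn_continuous].
  move=> t; apply: cvgM.
    apply: cvgM; first exact: cvg_cst.
    by apply: (@continuous_comp _ _ _ (fun t : R => A ^+ 2 - t ^+ 2) (@pos_part R)); [exact: csq|exact: pos_part_continuous].
  by apply: cvgN; apply: cvgM; [exact: cvg_cst|exact: cvg_id].
have D0 e : e \in [:: e_x; e_y; e_z] -> xc e = 0 -> forall X, 'D_e (kappa A) X = 0.
  move=> ea e0 X.
  refine (etrans (der_comp (dh := dh) cx (I : setT X) ea (hd _)) _).
  by rewrite dx e0 mulr0.
split; first exact: (C1_comp openT cx (fun X _ => conj (hd (xc X)) (cdh (xc X)))).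
by move=> X; split; apply: D0.
Qed.

Lemma kappa_ge0 A X : 0 <= kappa A X. Proof. exact: sqpos_ge0. Qed.

Lemma kappa_eq0 A X : 0 <= A -> A <= `|xc X| -> kappa A X = 0.
Proof.
move=> A0 xA; apply: sqpos0; rewrite subr_le0.
by rewrite -(real_normK (num_real (xc X))) ler_sqr ?nnegrE.
Qed.

Lemma kappa_gt0 A X : `|xc X| < A -> 0 < kappa A X.
Proof.
move=> xA; apply: sqpos_gt0; rewrite subr_gt0.
by rewrite -(real_normK (num_real (xc X))) ltr_sqr ?nnegrE // ltW // (le_lt_trans (normr_ge0 (xc X)) xA).
Qed.

Lemma kappa_le A X : kappa A X <= A ^+ 4.
Proof.
rewrite /kappa /sqpos (_ : A ^+ 4 = (A ^+ 2) ^+ 2); last by rewrite -exprM.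
rewrite ler_sqr ?nnegrE ?pos_part_ge0 ?sqr_ge0 //.
by rewrite /pos_part ge_max sqr_ge0 andbT lerBlDr lerDl sqr_ge0.
Qed.

(** The divergence theorem for the radial field [(0, y, z)], multiplied by
   [chi eps kappa]: since the radius is bounded below in the layer where
   [dchi eps] is supported, the integral of [kappa dchi eps] is bounded
   uniformly in [eps], although [dchi eps] is of order [1 / eps]. *)
Lemma layer_bound A : 0 <= A -> exists2 C : R, 0 <= C & exists2 e0 : R, 0 < e0 &
  forall eps, 0 < eps <= e0 ->
    (mu3 R).-integrable setT (EFin \o (fun X => kappa A X * dchi eps X)) /\
    \int[mu3 R]_X (kappa A X * dchi eps X) <= C.
Proof.
move=> A0; have [b b0 bf] := profile_gt0 hf.
have [B hB] := closed_nozzle_box hf A.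
have vol : (mu3 R (box B) < +oo)%E by exact: box_lty.
exists ((b ^+ 2)^-1 * (2 * A ^+ 4 * fine (mu3 R (box B)))).
  by rewrite mulr_ge0 ?invr_ge0 ?sqr_ge0 // mulr_ge0 ?fine_ge0 // mulr_ge0 // exprn_ge0.
exists (b ^+ 2 / 4); first by rewrite divr_gt0 // exprn_gt0.
move=> eps /andP[eps0 epsb].
have [cchi dchiE] := chi_C1 eps; have [ckap dk] := kappa_C1 A.
pose psi X := chi eps X * kappa A X.
pose K := core f eps A.
have cK : compact K by apply: core_compact => //; exact: ltW.
have KD : K `<=` D by exact: core_sub.
have outK X : ~ K X -> d X < eps \/ A < `|xc X|.
  move=> KX; have [h|h] := ltP (d X) eps; [by left|right].
  by rewrite ltNge; apply/negP => xA; apply: KX.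
have psi0 X : ~ K X -> psi X = 0.
  move=> /outK[h|h]; first by rewrite /psi chi_eq0 ?mul0r // ltW.
  by rewrite /psi kappa_eq0 ?mulr0 // ltW.
have w0 X : ~ K X -> kappa A X * dchi eps X = 0.
  move=> /outK[h|h]; last by rewrite kappa_eq0 ?mul0r // ltW.
  have [->|/(dchi_layer eps0)/andP[h' _]] := eqVneq (dchi eps X) 0; first by rewrite mulr0.
  by have := lt_trans h h'; rewrite ltxx.
have cpsi : C1 setT psi := C1M openT cchi ckap.
have ckc : continuous (kappa A) by move=> X; exact: (C1_continuous ckap).
have cw : continuous (fun X => kappa A X * dchi eps X).
  by move=> X; apply: cvgM; [exact: ckc|exact: dchi_continuous].
have cpc : continuous psi by move=> X; exact: (C1_continuous cpsi).
have iw := compact_integrable cK cw w0.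
have ip := compact_integrable cK cpc psi0.
have cr : continuous (fun X => 2 * (yc X ^+ 2 + zc X ^+ 2)).
  move=> X; apply: cvgM; first exact: cvg_cst.
  by apply: cvgD; apply: (@continuous_comp _ _ _ _ (fun t : R => t ^+ 2));
    [exact: continuous_yc|exact: exprn_continuous|exact: continuous_zc|exact: exprn_continuous].
pose w2 X := 2 * (yc X ^+ 2 + zc X ^+ 2) * (kappa A X * dchi eps X).
have cw2 : continuous w2 by move=> X; apply: cvgM; [exact: cr|exact: cw].
have iw2 : (mu3 R).-integrable setT (EFin \o w2).
  by apply: (compact_integrable cK cw2) => X /w0 h; rewrite /w2 h mulr0.
split; first exact: iw.
have [cy dy] := C1_yc D; have [cz dz] := C1_zc D.
pose Y X : space3 R := (0, yc X, zc X).
have G := green (nozzle_open hf) cK KD (F := Y) (@C1_cst R D 0) cy cz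
  (C1S (@subsetT _ D) cpsi) psi0.
have E : \int[mu3 R]_X w2 X = 2 * \int[mu3 R]_X psi X.
  have /eqP := Rintegral_eq0 G.
  have -> : \int[mu3 R]_X (dot3 (Y X) (grad psi X) + psi X * div3 Y X)
     = \int[mu3 R]_X (2 * psi X - w2 X).
    congr Rintegral; apply/funext => X.
    have -> : div3 Y X = 2.
      rewrite /div3 (_ : xc \o Y = cst 0) // derive_cst.
      refine (etrans (congr2 (fun u v => 0 + u + v) (dy X e_y) (dz X e_z)) _).
      by rewrite /yc /zc /= add0r.
    have [_ dE] := C1_dfun hf.
    have P e : e \in [:: e_x; e_y; e_z] -> 'D_e (kappa A) X = 0 ->
        'D_e psi X = kappa A X * (dchi eps X * 'D_e d X).
      move=> ea k0; refine (etrans (der_mul cchi ckap (I : setT X) ea) _).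
      by rewrite k0 mulr0 add0r dchiE.
    have [ky kz] := dk X.
    rewrite dot3_grad (P _ ey_axis ky) (P _ ez_axis kz) (dE X _ ey_axis) (dE X _ ez_axis).
    rewrite /w2 /Y; move: (kappa A X) (dchi eps X) (psi X) (f (xc X)) (derive1 f (xc X)) => k h s u u'.
    by rewrite /xc /yc /zc /=; move: X.1.2 X.2 => y z; ring.
  have i2 : (mu3 R).-integrable setT (EFin \o (fun X => 2 * psi X)).
    by have := integrableZl measurableT 2 ip; apply: eq_integrable.
  rewrite RintegralB // RintegralZl // subr_eq0 => /eqP ->.
  by [].
have ps : \int[mu3 R]_X psi X <= A ^+ 4 * fine (mu3 R (box B)).
  have iB : (mu3 R).-integrable setT (EFin \o (fun X => A ^+ 4 * \1_(box B) X)).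
    have := integrableZl measurableT (A ^+ 4) (box_indic_integrable B measurableT).
    exact: eq_integrable.
  have -> : A ^+ 4 * fine (mu3 R (box B)) = \int[mu3 R]_X (A ^+ 4 * \1_(box B) X).
    rewrite RintegralZl //; last exact: (box_indic_integrable B measurableT).
    congr (_ * _); rewrite /Rintegral integral_indic ?setIT //.
    exact: box_measurable.
  apply: le_Rintegral => // X _; rewrite indicE.
  have [KX|/psi0 ->] := pselect (K X); last by rewrite mulr_ge0 // exprn_ge0.
  have bX : box B X by case: KX => dX xA; apply: hB => //; apply: le_trans dX; exact: ltW.
  rewrite mem_set // mulr1 /psi.
  have /andP[s0 s1] := step_bounds ((d X - eps) / eps).
  by rewrite (le_trans _ (kappa_le A X)) // ler_piMl // kappa_ge0.
rewrite -(ler_pM2l (_ : 0 < b ^+ 2)) ?exprn_gt0 // mulrA mulfV ?mul1r; last first.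
  by rewrite expf_neq0 // gt_eqF.
have : b ^+ 2 * \int[mu3 R]_X (kappa A X * dchi eps X) <= \int[mu3 R]_X w2 X.
  have i3 : (mu3 R).-integrable setT (EFin \o (fun X => b ^+ 2 * (kappa A X * dchi eps X))).
    by have := integrableZl measurableT (b ^+ 2) iw; apply: eq_integrable.
  rewrite -RintegralZl //; apply: le_Rintegral => // X _; rewrite /w2.
  have [->|h] := eqVneq (dchi eps X) 0; first by rewrite !mulr0.
  have /andP[_ h2] := dchi_layer eps0 h.
  have fb : b ^+ 2 <= f (xc X) ^+ 2.
    by rewrite ler_sqr ?nnegrE ?bf //; apply: ltW; [exact: b0|exact: profile_pos].
  apply: ler_wpM2r; first by rewrite mulr_ge0 ?kappa_ge0 ?dchi_ge0.
  by move: h2 epsb; rewrite /dfun; move: fb; clear; move: (f _ ^+ 2) (yc X ^+ 2 + _) => *; lra.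
rewrite E => h; apply: le_trans h _; rewrite -mulrA.
by rewrite ler_wpM2l.
Qed.

End Layer.

(** * The weak equation up to the wall *)
Section Wall.
Context {R : realType} (p f : R -> R) (m : R) (Phi : space3 R -> R) (U V : R * R -> R).
Hypotheses (hp : gas_law p) (hf : nozzle_profile f).
Hypothesis flow : subsonic_flow p f m Phi U V.
Implicit Types (X Y e : space3 R) (K : set (space3 R)) (psi eta : space3 R -> R).
Local Hint Resolve ex_axis ey_axis ez_axis : core.
Local Notation v := (velocity U V).
Local Notation D := (nozzle f).
Local Notation F := (fun X => mass_flux p (v X)).
Local Notation d := (dfun f).

Lemma normal_component X : dot3 (v X) (grad d X) =
  2 * f (xc X) * derive1 f (xc X) * xc (v X) - 2 * yc X * yc (v X) - 2 * zc X * zc (v X).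
Proof.
have [_ dE] := C1_dfun hf.
rewrite dot3_grad (dE X _ ex_axis) (dE X _ ey_axis) (dE X _ ez_axis).
move: (xc (v X)) (yc (v X)) (zc (v X)) (f (xc X)) (derive1 f (xc X)) (yc X) (zc X) => *.
by rewrite /xc /yc /zc /=; ring.
Qed.

(** On the wall [grad d] is a multiple of the outward normal. *)
Lemma normal_component_wall X : wall f X -> dot3 (v X) (grad d X) = 0.
Proof.
have alg (c r k a y b z e : R) : 0 < c -> 0 < r ->
    a * (- k / c) + b * (y / r / c) + e * (z / r / c) = 0 ->
    2 * r * k * a - 2 * y * b - 2 * z * e = 0.
  move=> c0 r0 h.
  have -> : 2 * r * k * a - 2 * y * b - 2 * z * e
      = - (2 * r * c) * (a * (- k / c) + b * (y / r / c) + e * (z / r / c)).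
    by field; rewrite !gt_eqF.
  by rewrite h mulr0.
move=> wX; rewrite normal_component -wX.
apply: (alg (Num.sqrt (1 + derive1 f (xc X) ^+ 2))).
- by rewrite sqrtr_gt0 ltr_pwDl // sqr_ge0.
- by rewrite wX; exact: profile_pos.
- exact: (flow_slip flow wX).
Qed.

Lemma closure_nozzle X : closure D X -> 0 <= d X.
Proof.
move=> cX; have cl : closed (d @^-1` [set t | 0 <= t]).
  by apply: closed_comp; [move=> Y _; exact: dfun_continuous|exact: closed_ge].
move: cX; rewrite closureE => /(_ (d @^-1` [set t | 0 <= t])); apply; split => //.
by move=> Y; rewrite nozzleE //; exact: ltW.
Qed.

(** Compactness turns the slip condition on the wall into a uniform bound
   near the wall. *)
Lemma normal_component_small A (delta : R) : 0 < delta ->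
  exists2 e0 : R, 0 < e0 & forall X, D X -> `|xc X| <= A -> d X <= e0 ->
    `|dot3 (v X) (grad d X)| <= delta.
Proof.
move=> d0; apply: contrapT => H.
have ex (n : nat) : exists X, [/\ D X, `|xc X| <= A, d X <= n.+1%:R^-1 &
    delta < `|dot3 (v X) (grad d X)|].
  apply: contrapT => nX; apply: H; exists (n.+1%:R^-1); first by rewrite invr_gt0.
  move=> X DX xA dX; rewrite leNgt; apply/negP => h; apply: nX.
  by exists X.
have [X_ hX] := choice ex.
pose K := closure D `&` [set X | `|xc X| <= A].
have [B hB] := closed_nozzle_box hf A.
have cK : compact K.
  apply: subclosed_compact (@box_compact _ B) _; last first.
    by move=> X [/closure_nozzle dX xA]; exact: hB.
  apply: closedI; first exact: closed_closure.
  apply: (@closed_comp _ _ (fun X => `|xc X|) [set t | t <= A]); last exact: closed_le.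
  move=> X _; apply: continuous_comp; first exact: continuous_xc.
  exact: norm_continuous.
have KX n : K (X_ n).
  by have [DX xA _ _] := hX n; split => //; exact: subset_closure.
have FK : (X_ n @[n --> \oo]) K by exists 0%N => // n _; exact: KX.
have [Z [[cZ zA] clZ]] := cK _ _ FK.
have tail N : (X_ n @[n --> \oo]) [set X_ n | n in [set n | (N <= n)%N]].
  by exists N => // n Nn; exists n.
have dZ : d Z = 0.
  apply/eqP; rewrite eq_le closure_nozzle // andbT leNgt; apply/negP => Z0.
  have nZ : nbhs Z [set Y | d Z / 2 < d Y].
    have c := @dfun_continuous _ _ hf Z.
    apply: (c [set t | d Z / 2 < t]); apply: lt_nbhsr.
    by rewrite ltr_pdivrMr // ltr_pMr // ltrDl.
  have [N hN] : exists N : nat, 0 + N.+1%:R^-1 < d Z / 2.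
    by apply: ltr_add_invr; rewrite divr_gt0.
  rewrite add0r in hN.
  have [Y [[n /= Nn <-] hY]] := clZ _ _ (tail N) nZ.
  have [_ _ h _] := hX n.
  have : n.+1%:R^-1 <= N.+1%:R^-1 :> R.
    by rewrite lef_pV2 ?posrE ?ltr0n // ler_nat.
  by move=> h2; have := le_lt_trans (le_trans h h2) hN; rewrite ltNge ltW.
have NZ := normal_component_wall (wallE hf dZ).
have /subspace_continuousP/(_ Z cZ) vc := flow_C1_closure flow.
have Nc : (fun Y => dot3 (v Y) (grad d Y)) @ within (closure D) (nbhs Z) --> (0 : R).
  rewrite -NZ normal_component.
  rewrite (_ : (fun Y => dot3 (v Y) (grad d Y)) = (fun Y =>
     2 * f (xc Y) * derive1 f (xc Y) * xc (v Y) - 2 * yc Y * yc (v Y) - 2 * zc Y * zc (v Y))); last first.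
    by apply/funext => Y; rewrite normal_component.
  have wc (g : space3 R -> R) : continuous g -> g @ within (closure D) (nbhs Z) --> g Z.
    by move=> cg; apply: cvg_within_filter; exact: cg.
  have vcomp (c : space3 R -> R) : continuous c -> (fun Y => c (v Y)) @ within (closure D) (nbhs Z) --> c (v Z).
    by move=> cc; apply: cvg_comp vc _; exact: cc.
  have cx : continuous (fun X => 2 * f (xc X) * derive1 f (xc X)).
    move=> X; apply: cvgM; first apply: cvgM; first exact: cvg_cst.
      by apply: (@continuous_comp _ _ _ (@xc R) f); [exact: continuous_xc|exact: profile_continuous].
    by apply: (@continuous_comp _ _ _ (@xc R) (derive1 f)); [exact: continuous_xc|exact: profile_derive_continuous].
  apply: cvgB; first apply: cvgB; apply: cvgM.
  - exact: (wc _ cx).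
  - exact: (vcomp _ continuous_xc).
  - by apply: cvgM; [exact: cvg_cst|exact: (wc _ continuous_yc)].
  - exact: (vcomp _ continuous_yc).
  - by apply: cvgM; [exact: cvg_cst|exact: (wc _ continuous_zc)].
  - exact: (vcomp _ continuous_zc).
have small : nbhs Z [set Y | closure D Y -> `|dot3 (v Y) (grad d Y)| < delta].
  by move/cvgr0Pnorm_lt : Nc => /(_ _ d0).
have [Y [[n /= _ <-] hY]] := clZ _ _ (tail 0%N) small.
have [DX _ _ h] := hX n.
by have := lt_trans h (hY (subset_closure DX)); rewrite ltxx.
Qed.

(** Cut off the layer [d <= eps] by [chi eps], so that the test function is
   admissible in the interior weak form; the error term is small because the
   normal component of the velocity is small in the layer while the integral of
   [dchi eps] is bounded. *)
Lemma flow_weak_wall A eta : 0 <= A -> C1 setT eta ->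
  (forall X, ~ box A X -> eta X = 0) ->
  \int[mu3 R]_(X in D) dot3 (F X) (grad eta X) = 0.
Proof.
move=> A0 ceta eta0.
have oD := nozzle_open hf; have mD : measurable3 D := nozzle_measurable hf.
have [cd dE] := C1_dfun hf.
have cetac : continuous eta by move=> X; exact: (C1_continuous ceta).
have [M M0 hM] := continuous_bounded_box A cetac.
have [M' M'0 hM'] := grad_bounded (@box_compact R A) ceta eta0.
have g00 : 0 <= dens p 0 by apply: le_trans (dens_ge1 hp ler01); rewrite ler01.
pose u X := dot3 (F X) (grad eta X).
(* [q1 + q2] is the flux times the gradient of [chi eps * eta]; [q1] tends to
   the integrand [u], and [q2] is concentrated in the layer. *)
pose q1 eps X := chi f eps X * u X.
pose q2 eps X := eta X * dchi f eps X * dot3 (F X) (grad d X).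
have outK eps X : ~ core f eps A X -> d X < eps \/ ~ box A X.
  move=> KX; have [h|h] := ltP (d X) eps; [by left|right] => /boxP[xA _ _].
  by apply: KX.
have grad0 X : ~ box A X -> u X = 0.
  move=> bX; rewrite /u dot3_grad !(der_outside_compact _ (@box_compact R A) eta0 bX).
  by rewrite !mulr0 !addr0.
have q10 eps X : 0 < eps -> ~ core f eps A X -> q1 eps X = 0.
  move=> e0 /outK[h|bX]; first by rewrite /q1 chi_eq0 ?mul0r // ltW.
  by rewrite /q1 grad0 ?mulr0.
have q20 eps X : 0 < eps -> ~ core f eps A X -> q2 eps X = 0.
  move=> e0 /outK[h|bX]; last by rewrite /q2 eta0 // !mul0r.
  have [k|/(dchi_layer e0)/andP[k _]] := eqVneq (dchi f eps X) 0; first by rewrite /q2 k mulr0 mul0r.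
  by have := lt_trans h k; rewrite ltxx.
have cu X : D X -> {for X, continuous u}.
  move=> DX; have [k1 k2 k3] := grad_continuous (C1S (@subsetT _ D) ceta) DX.
  exact: (dot3_flux_continuous hp hf flow DX k1 k2 k3).
have cu2 X : D X -> {for X, continuous (fun X => dot3 (F X) (grad d X))}.
  move=> DX; have [k1 k2 k3] := grad_continuous (C1S (@subsetT _ D) cd) DX.
  exact: (dot3_flux_continuous hp hf flow DX k1 k2 k3).
have cK eps : 0 < eps -> compact (core f eps A) by move=> e0; apply: core_compact => //; exact: ltW.
have KD eps : 0 < eps -> core f eps A `<=` D by exact: core_sub.
have cq1 eps : 0 < eps -> continuous (q1 eps).
  move=> e0; apply: (continuous_ext0 oD (cK _ e0) (KD _ e0)) => [X DX|X]; last exact: q10.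
  apply: cvgM; last exact: cu.
  by have [cc _] := chi_C1 hf eps; exact: (C1_continuous cc).
have cq2 eps : 0 < eps -> continuous (q2 eps).
  move=> e0; apply: (continuous_ext0 oD (cK _ e0) (KD _ e0)) => [X DX|X]; last exact: q20.
  apply: cvgM; last exact: cu2.
  by apply: cvgM; [exact: cetac|exact: dchi_continuous].
have iq1 eps (e0 : 0 < eps) := compact_integrable (cK _ e0) (cq1 _ e0) (fun X => q10 eps X e0).
have iq2 eps (e0 : 0 < eps) := compact_integrable (cK _ e0) (cq2 _ e0) (fun X => q20 eps X e0).
have sum0 eps : 0 < eps -> \int[mu3 R]_X q1 eps X = - \int[mu3 R]_X q2 eps X.
  move=> e0; apply/eqP; rewrite -addr_eq0 -RintegralD //; [|exact: iq1|exact: iq2].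
  have [cc ccE] := chi_C1 hf eps.
  pose psi X := chi f eps X * eta X.
  have := flow_weak_interior hp hf flow (cK _ e0) (KD _ e0) (C1S (@subsetT _ D) (C1M openT cc ceta)).
  move=> W; rewrite -[X in _ == X]W; last first.
    move=> X /outK[h|/eta0 ->]; last by rewrite mulr0.
    by rewrite chi_eq0 ?mul0r // ltW.
  apply/eqP; congr Rintegral; apply/funext => X.
  have P e : e \in [:: e_x; e_y; e_z] ->
      'D_e (fun X => chi f eps X * eta X) X
      = chi f eps X * 'D_e eta X + eta X * (dchi f eps X * 'D_e d X).
    by move=> ea; refine (etrans (der_mul cc ceta (I : setT X) ea) _); rewrite ccE.
  rewrite /q1 /q2 /u !dot3_grad (P _ ex_axis) (P _ ey_axis) (P _ ez_axis).
  move: (mass_flux p (v X)) ('D_e_x d X) ('D_e_y d X) ('D_e_z d X) => w a1 a2 a3.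
  move: ('D_e_x eta X) ('D_e_y eta X) ('D_e_z eta X) (chi f eps X) (eta X) (dchi f eps X) => *.
  by ring.
have A10 : 0 <= A + 1 by rewrite addr_ge0.
have [C C0 [e0 e00 layer]] := layer_bound hf A10.
(* [kappa A] vanishes at the ends of the box, hence the margin 1. *)
have kap1 X : box A X -> 1 <= kappa (A + 1) X.
  move=> /boxP[xA _ _]; have xx : xc X ^+ 2 <= A ^+ 2.
    by rewrite -(real_normK (num_real (xc X))) ler_sqr ?nnegrE.
  have h : 1 <= (A + 1) ^+ 2 - xc X ^+ 2 by have -> : (A + 1) ^+ 2 = A ^+ 2 + 2 * A + 1; [ring|move: xx; move: (xc X ^+ 2) (A ^+ 2) => *; lra].
  by rewrite /kappa /sqpos pos_partE ?exprn_ege1 //; exact: le_trans h.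
have uE X : dot3 (F X) (grad d X) = dens p (dot3 (v X) (v X)) * dot3 (v X) (grad d X).
  by rewrite dot3Zl.
have small (delta : R) : 0 < delta -> exists2 e1 : R, 0 < e1 &
    forall eps, 0 < eps <= e1 -> `|\int[mu3 R]_X q1 eps X| <= M * dens p 0 * C * delta.
  move=> dl0; have [e1 e10 nc] := normal_component_small A dl0.
  exists (Num.min e0 (e1 / 2)); first by rewrite lt_min e00 divr_gt0.
  move=> eps /andP[eps0]; rewrite le_min => /andP[epse0 epse1].
  have [iw wC] : (mu3 R).-integrable setT (EFin \o (fun X => kappa (A + 1) X * dchi f eps X)) /\
    \int[mu3 R]_X (kappa (A + 1) X * dchi f eps X) <= C by apply: layer; rewrite eps0.
  rewrite sum0 // normrN.
  apply: le_trans (le_normr_Rintegral _ (iq2 _ eps0)) _ => //.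
  have iq2n : (mu3 R).-integrable setT (EFin \o (fun X => `|q2 eps X|)).
    by have := integrable_abse (iq2 _ eps0); apply: eq_integrable.
  have iwM : (mu3 R).-integrable setT (EFin \o (fun X => M * dens p 0 * delta * (kappa (A + 1) X * dchi f eps X))).
    by have := integrableZl measurableT (M * dens p 0 * delta) iw; apply: eq_integrable.
  apply: (@le_trans _ _ (\int[mu3 R]_X (M * dens p 0 * delta * (kappa (A + 1) X * dchi f eps X)))).
    apply: le_Rintegral => // X _.
    have dc0 := dchi_ge0 f X eps0.
    have T0 : 0 <= M * dens p 0 * delta * (kappa (A + 1) X * dchi f eps X).
      exact: (mulr_ge0 (mulr_ge0 (mulr_ge0 M0 g00) (ltW dl0)) (mulr_ge0 (kappa_ge0 _ _) dc0)).
    have [bX|/eta0 h] := pselect (box A X); last by rewrite /q2 h !mul0r normr0.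
    have [h|/(dchi_layer eps0)/andP[k1 k2]] := eqVneq (dchi f eps X) 0.
      by rewrite /q2 h !mulr0 mul0r normr0.
    have DX : D X by rewrite nozzleE //; exact: lt_trans k1.
    have xA : `|xc X| <= A by case/boxP: bX.
    have := nc X DX xA (ltW (lt_le_trans k2 _)).
    have e12 : 2 * eps <= e1 by rewrite mulrC -ler_pdivlMr.
    move=> /(_ e12) N1.
    have /andP[g1 g2] := flow_dens_bounds hp flow DX.
    rewrite /q2 uE 2!normrM (ger0_norm dc0) normrM (ger0_norm (le_trans ler01 g1)).
    have E1 : `|eta X| * dchi f eps X <= M * dchi f eps X by rewrite ler_wpM2r // hM.
    have E2 : dens p (dot3 (v X) (v X)) * `|dot3 (v X) (grad d X)| <= dens p 0 * delta.
      by apply: ler_pM => //; exact: le_trans g1.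
    have E3 : dchi f eps X <= kappa (A + 1) X * dchi f eps X by rewrite ler_peMl // kap1.
    apply: le_trans (ler_pM (mulr_ge0 (normr_ge0 _) dc0) (mulr_ge0 (le_trans ler01 g1) (normr_ge0 _)) E1 E2) _.
    have -> : M * dchi f eps X * (dens p 0 * delta) = M * dens p 0 * delta * dchi f eps X.
      by move: (dchi f eps X) (dens p 0) => *; ring.
    by rewrite ler_wpM2l //; exact: (mulr_ge0 (mulr_ge0 M0 g00) (ltW dl0)).
  rewrite RintegralZl // -!mulrA ler_wpM2l // ler_wpM2l // mulrC ler_wpM2r //.
  exact: ltW.
have [iu lim] : (mu3 R).-integrable D (EFin \o u) /\
    \int[mu3 R]_(X in D) q1 n.+1%:R^-1 X @[n --> \oo] --> \int[mu3 R]_(X in D) u X.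
  have n0 n : 0 < n.+1%:R^-1 :> R by rewrite invr_gt0.
  have ub X : D X -> `|u X| <= dens p 0 * (3 * M').
    by move=> DX; apply: (flow_flux_bound hp flow DX M'0);
      [exact: hM' _ ex_axis|exact: hM' _ ey_axis|exact: hM' _ ez_axis].
  apply: (@box_dominated _ _ _ _ A (dens p 0 * (3 * M'))) => //.
  - by move=> n; apply: continuous_measurable3 => // X _; exact: cq1.
  - exact: continuous_measurable3.
  - apply: aeW => X DX; apply: cvg_near_cst.
    have dX : 0 < d X by move: DX; rewrite nozzleE.
    have [N hN] : exists N : nat, 0 + N.+1%:R^-1 < d X / 2.
      by apply: ltr_add_invr; rewrite divr_gt0.
    rewrite add0r in hN; exists N => // n /= Nn.
    rewrite /q1 chi_eq1 ?mul1r // mulrC -ler_pdivlMr //.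
    by apply: le_trans (ltW hN); rewrite lef_pV2 ?posrE ?ltr0n // ler_nat.
  - move=> n X DX; rewrite /q1 normrM.
    have /andP[s0 s1] := step_bounds ((d X - n.+1%:R^-1) / n.+1%:R^-1).
    by rewrite -[leRHS]mul1r ler_pM // ?ub // ger0_norm.
  - by move=> n X DX bX; rewrite /q1 grad0 // mulr0.
apply/eqP; rewrite -normr_le0; apply/ler_addgt0Pr => e epos; rewrite add0r.
set T := M * dens p 0 * C in small.
have T0 : 0 <= T by rewrite !mulr_ge0.
have T1 : 0 < T + 1 by rewrite ltr_wpDl.
have [e1 e10 he1] := small (e / (T + 1)) (divr_gt0 epos T1).
apply: (ler_cvg_to (cvg_norm lim) (cvg_cst e)).
have [N hN] : exists N : nat, 0 + N.+1%:R^-1 < e1 by apply: ltr_add_invr.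
rewrite add0r in hN; exists N => // n /= Nn.
have n0 : 0 < n.+1%:R^-1 :> R by rewrite invr_gt0.
rewrite Rintegral_support //; last first.
  by move=> X DX; apply: q10 => // KX; apply: DX; exact: KD KX.
apply: le_trans (he1 _ _) _.
  rewrite n0 /=; apply: le_trans (ltW hN).
  by rewrite lef_pV2 ?posrE ?ltr0n // ler_nat.
by rewrite mulrA ler_pdivrMr // mulrC; apply: ler_wpM2l; [exact: ltW|rewrite lerDl].
Qed.

End Wall.

(** * Extraction of subsequences *)
Section Subsequences.
Context {R : realType}.
Implicit Types sigma tau : nat -> nat.

Definition strictly_increasing sigma := forall i j : nat, (i < j)%N -> (sigma i < sigma j)%N.

Lemma strictly_increasing_comp sigma tau : strictly_increasing sigma ->
  strictly_increasing tau -> strictly_increasing (sigma \o tau).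
Proof. by move=> s t i j ij; apply/s/t. Qed.

Lemma frequent_subsequence (P : nat -> nat -> Prop) :
  (forall j N, exists2 n, (N <= n)%N & P j n) ->
  exists2 sigma, strictly_increasing sigma & forall j, P j (sigma j).
Proof.
move=> H; have /choice[g hg] : forall jN : nat * nat, exists n, (jN.2 <= n)%N /\ P jN.1 n.
  by move=> [j N]; have [n] := H j N; exists n.
pose sigma := fix s j := if j is i.+1 then g (i.+1, (s i).+1) else g (0, 0)%N.
have sP j : P j (sigma j) by case: j => [|j]; [exact: (hg (0, 0)%N).2|exact: (hg (j.+1, (sigma j).+1)).2].
exists sigma => // i j; elim: j => // j ih.
have sj : (sigma j < sigma j.+1)%N by exact: (hg (j.+1, (sigma j).+1)).1.
by rewrite ltnS leq_eqVlt => /orP[/eqP -> //|/ih h]; exact: ltn_trans h sj.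
Qed.

(** By Tychonoff's theorem the sequence [u] has a cluster point in the product
   of the segments [[- M k, M k]]; a neighbourhood of a point of the product
   constrains finitely many coordinates. *)
Lemma pointwise_subsequence (u : nat -> nat -> R) (M : nat -> R) :
  (forall n k, `|u n k| <= M k) ->
  exists2 sigma, strictly_increasing sigma &
    exists l : nat -> R, forall k, u (sigma n) k @[n --> \oo] --> l k.
Proof.
move=> uM.
have := @tychonoff nat (fun=> R : topologicalType) (fun k => `[- M k, M k]) (fun k => @segment_compact _ _ _).
set B := (X in compact X) => cB.
have FB : (u n @[n --> \oo]) B.
  by exists 0%N => // n _ k /=; rewrite in_itv /= -ler_norml.
have [l [_ cl]] := cB _ _ FB.
pose P j n := forall k, (k <= j)%N -> `|u n k - l k| < j.+1%:R^-1.
have [j N|sigma s sP] := @frequent_subsequence P.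
  have j0 : 0 < j.+1%:R^-1 :> R by rewrite invr_gt0.
  have nb i : nbhs l [set g : prod_topology (fun=> R : topologicalType) |
      forall k, (k <= i)%N -> `|g k - l k| < j.+1%:R^-1].
    have one k : nbhs l [set g : prod_topology (fun=> R : topologicalType) | `|g k - l k| < j.+1%:R^-1].
      have c := @proj_continuous nat (fun=> R : topologicalType) k l.
      have nk : nbhs (l k) [set t : R | `|t - l k| < j.+1%:R^-1].
        by have := nbhsx_ballx (l k) _ j0; apply: filterS => t; rewrite /ball /= distrC.
      exact: c nk.
    elim: i => [|i ih].
      by apply: filterS (one 0%N) => g h k; rewrite leqn0 => /eqP ->.
    apply: filterS2 ih (one i.+1) => g h1 h2 k; rewrite leq_eqVlt => /orP[/eqP -> //|].
    exact: h1.
  have tail : (u n @[n --> \oo]) [set u n | n in [set n | (N <= n)%N]].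
    by exists N => // n Nn; exists n.
  have [_ [[n /= Nn <-] hn]] := cl _ _ tail (nb j).
  by exists n.
exists sigma => //; exists l => k; apply/cvgrPdist_lt => e e0.
have [N hN] : exists N : nat, 0 + N.+1%:R^-1 < e by apply: ltr_add_invr.
rewrite add0r in hN; exists (maxn N k) => // n /=; rewrite geq_max => /andP[Nn kn].
rewrite distrC; apply: lt_trans hN; apply: lt_le_trans (sP n k kn) _.
by rewrite lef_pV2 ?posrE ?ltr0n // ler_nat.
Qed.

Lemma geometric_cauchy (x : nat -> R) (C : R) (k : nat) : 0 <= C ->
  (forall j, (k <= j)%N -> `|x j - x j.+1| <= C * 2^-1 ^+ j) -> cvgn x.
Proof.
move=> C0 hx; apply/cauchy_cvgP/cauchy_exP => e e0.
have tele N i : (k <= N)%N -> `|x N - x (N + i)%N| <= 2 * C * (2^-1 ^+ N - 2^-1 ^+ (N + i)).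
  move=> kN; elim: i => [|i ih]; first by rewrite addn0 !subrr normr0 mulr0.
  have h1 := ler_distD (x (N + i)%N) (x N) (x (N + i).+1).
  have h2 := hx (N + i)%N (leq_trans kN (leq_addr _ _)).
  rewrite addnS exprS; apply: le_trans h1 _; apply: le_trans (lerD ih h2) _.
  move: (2^-1 ^+ N) (2^-1 ^+ (N + i)) => a b.
  by have -> : 2 * C * (a - 2^-1 * b) = 2 * C * (a - b) + C * b by field.
(* [2 C + 1] bounds the geometric tail also when [C = 0]. *)
have C1 : 0 < 2 * C + 1 by lra.
have [N1 hN1] : exists N : nat, (2 * C + 1) * 2^-1 ^+ N < e.
  have h2 : `|2^-1 : R| < 1 by rewrite ger0_norm ?invf_lt1 ?ltr1n.
  have /cvgrPdist_lt/(_ (e / (2 * C + 1)) (divr_gt0 e0 C1))[N _ hN] := cvg_expr h2.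
  exists N; have := hN N (leqnn N); rewrite /= sub0r normrN ger0_norm ?exprn_ge0 //.
  by rewrite ltr_pdivlMr // mulrC.
pose N := maxn k N1; exists (x N).
exists N => // n /= Nn; rewrite /ball /=.
rewrite -(subnKC Nn); apply: le_lt_trans (tele N (n - N)%N (leq_maxl _ _)) _.
apply: le_lt_trans hN1.
have p0 i : 0 <= 2^-1 ^+ i :> R by rewrite exprn_ge0.
have : 2^-1 ^+ N <= 2^-1 ^+ N1 :> R.
  by apply: ler_wiXn2l; rewrite ?invf_le1 ?ler1n // leq_maxr.
have := p0 (N + (n - N))%N; have := p0 N1.
by move: (2^-1 ^+ (N + _)) (2^-1 ^+ N) (2^-1 ^+ N1) => *; nra.
Qed.

End Subsequences.

(** * Convergence of the potentials *)
Section Potential.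
Context {R : realType} (p f : R -> R) (m : R) (Phi : space3 R -> R) (U V : R * R -> R).
Hypotheses (hf : nozzle_profile f).
Hypothesis flow : subsonic_flow p f m Phi U V.
Implicit Types (X Y Z e : space3 R).
Local Hint Resolve ex_axis ey_axis ez_axis : core.
Local Notation D := (nozzle f).

Definition between (a b t : R) := Num.min a b <= t <= Num.max a b.

Lemma betweenl a b : between a b a.
Proof. by rewrite /between ge_min le_max lexx. Qed.

Lemma betweenr a b : between a b b.
Proof. by rewrite /between ge_min le_max lexx !orbT. Qed.

(** The potential is 1-Lipschitz along the axes because the speed is below 1. *)
Lemma potential_segment (c : R -> space3 R) e a b : e \in [:: e_x; e_y; e_z] ->
  (forall h t, c (h + t) = h *: e + c t) ->
  (forall t, between a b t -> D (c t)) ->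
  `|Phi (c a) - Phi (c b)| <= `|a - b|.
Proof.
move=> ea ce cD; have [cPhi _] := flow_C1 flow.
have der t : between a b t -> is_derive t 1 (Phi \o c) ('D_e Phi (c t)).
  move=> abt; have [d1 d2] := slice_derive Phi (fun h => ce h t).
  apply: DeriveDef; first by apply: d1; exact: (C1_derivable cPhi (cD _ abt)).
  by rewrite -derive1E d2.
have le1 t : between a b t -> `|'D_e Phi (c t)| <= 1.
  move=> abt; have [d1 d2 d3] := flow_der flow (cD _ abt).
  have [h1 h2 h3] := coord_le1 (ltW (flow_speed_lt1_in flow (cD _ abt))).
  by move: ea; rewrite !inE => /or3P[] /eqP ->; rewrite ?d1 ?d2 ?d3.
have [ab|ba] := leP a b.
  rewrite distrC (distrC a) (ger0_norm (_ : 0 <= b - a)) ?subr_ge0 //.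
  apply: (derive_le1_lipschitz (h := Phi \o c) ab) => t abt; [apply: der|apply: le1];
  by rewrite /between (min_idPl ab) (max_idPr ab).
rewrite (ger0_norm (_ : 0 <= a - b)) ?subr_ge0 ?(ltW ba) //.
apply: (derive_le1_lipschitz (h := Phi \o c) (ltW ba)) => t abt; [apply: der|apply: le1];
by rewrite /between (min_idPr (ltW ba)) (max_idPl (ltW ba)).
Qed.

(** The box with opposite vertices [X] and [Y], which contains a path from [X] to
   [Y] made of segments parallel to the axes. *)
Definition cell X Y : set (space3 R) := [set Z | [/\ between (xc X) (xc Y) (xc Z),
  between (yc X) (yc Y) (yc Z) & between (zc X) (zc Y) (zc Z)]].

Definition dist1 X Y : R := `|xc X - xc Y| + `|yc X - yc Y| + `|zc X - zc Y|.

Lemma potential_cell X Y : cell X Y `<=` D -> `|Phi X - Phi Y| <= dist1 X Y.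
Proof.
move: X Y => [[x y] z] [[x' y'] z'] hD; rewrite /dist1 /xc /yc /zc /=.
have s1 : `|Phi (x, y, z) - Phi (x', y, z)| <= `|x - x'|.
  apply: (potential_segment (c := fun t => (t, y, z)) (e := e_x)) => //.
    by move=> h t; rewrite [RHS]space3_eta /xc /yc /zc /= /GRing.scale /= !mulr0 !add0r mulr1.
  by move=> t ht; apply: hD; split => //; exact: betweenl.
have s2 : `|Phi (x', y, z) - Phi (x', y', z)| <= `|y - y'|.
  apply: (potential_segment (c := fun t => (x', t, z)) (e := e_y)) => //.
    by move=> h t; rewrite [RHS]space3_eta /xc /yc /zc /= /GRing.scale /= !mulr0 !add0r mulr1.
  by move=> t ht; apply: hD; split => //; [exact: betweenr|exact: betweenl].
have s3 : `|Phi (x', y', z) - Phi (x', y', z')| <= `|z - z'|.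
  apply: (potential_segment (c := fun t => (x', y', t)) (e := e_z)) => //.
    by move=> h t; rewrite [RHS]space3_eta /xc /yc /zc /= /GRing.scale /= !mulr0 !add0r mulr1.
  by move=> t ht; apply: hD; split => //; exact: betweenr.
apply: le_trans (ler_distD (Phi (x', y', z)) _ _) _; apply: lerD s3.
by apply: le_trans (ler_distD (Phi (x', y, z)) _ _) _; apply: lerD s1 s2.
Qed.

Lemma between0_sqr (b t : R) : between 0 b t -> t ^+ 2 <= b ^+ 2.
Proof.
rewrite /between => /andP[h1 h2].
have [b0|b0] := leP 0 b.
  by rewrite (min_idPl b0) in h1; rewrite (max_idPr b0) in h2; rewrite ler_sqr ?nnegrE.
rewrite (min_idPr (ltW b0)) in h1; rewrite (max_idPl (ltW b0)) in h2.
by rewrite -(sqrrN t) -(sqrrN b) ler_sqr ?nnegrE ?oppr_ge0 ?lerN2 // ltW.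
Qed.

Definition origin : space3 R := (0, 0, 0).

(** Any point of the nozzle is reached from the origin along the axis and then
   inside a cross-section. *)
Lemma potential_bound X : D X -> `|Phi X - Phi origin| <= dist1 X origin.
Proof.
move=> DX; pose Y : space3 R := (xc X, 0, 0).
have s1 : `|Phi origin - Phi Y| <= dist1 origin Y.
  apply: potential_cell => Z [_ /between0_sqr hy /between0_sqr hz].
  rewrite nozzleE // /dfun subr_gt0; apply: (@le_lt_trans _ _ 0); last first.
    by rewrite exprn_gt0 // profile_pos.
  by move: hy hz; rewrite /Y /yc /zc /= !expr0n /= => *; lra.
have s2 : `|Phi Y - Phi X| <= dist1 Y X.
  apply: potential_cell => Z [hx /between0_sqr hy /between0_sqr hz].
  have xE : xc Z = xc X.
    by move: hx; rewrite /between /Y /xc /= minxx maxxx -eq_le => /eqP.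
  move: DX; rewrite !nozzleE // /dfun xE; move: hy hz; move: (f _ ^+ 2).
  by move: (yc Z ^+ 2) (zc Z ^+ 2) (yc X ^+ 2) (zc X ^+ 2) => *; lra.
rewrite distrC; apply: le_trans (ler_distD (Phi Y) _ _) _.
apply: le_trans (lerD s1 s2) _.
rewrite /dist1 /origin /Y /xc /yc /zc /= !subrr !normr0 !sub0r !subr0 !normrN.
by rewrite !addr0 !add0r addrA.
Qed.

End Potential.

Section PotentialLimit.
Context {R : realType} (p f : R -> R) (m : nat -> R) (Phi : nat -> space3 R -> R)
  (Un Vn : nat -> R * R -> R).
Hypotheses (hf : nozzle_profile f).
Hypothesis flows : forall n, subsonic_flow p f (m n) (Phi n) (Un n) (Vn n).
Implicit Types (X Y Z e : space3 R).
Local Notation D := (nozzle f).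

(** Fixing the additive constants at the origin makes the potentials locally
   bounded, uniformly in [n]. *)
Definition pot n X : R := Phi n X - Phi n origin.

Lemma pot_bound n X : D X -> `|pot n X| <= dist1 X origin.
Proof. exact: (potential_bound hf (flows n)). Qed.

Lemma pot_cell n X Y : cell X Y `<=` D -> `|pot n X - pot n Y| <= dist1 X Y.
Proof.
move=> h; have := potential_cell (flows n) h.
by rewrite /pot opprB addrA subrK.
Qed.

Lemma cell_ball X Y Z (d : R) : ball X d Y -> cell X Y Z -> ball X d Z.
Proof.
have h (a b t : R) : `|a - b| < d -> between a b t -> `|a - t| < d.
  rewrite /between => ab /andP[h1 h2]; apply: le_lt_trans ab.
  have [ba|ba] := leP b a.
    rewrite (min_idPr ba) in h1; rewrite (max_idPl ba) in h2.
    by rewrite !ger0_norm ?subr_ge0 // lerD2l lerN2.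
  rewrite (min_idPl (ltW ba)) in h1; rewrite (max_idPr (ltW ba)) in h2.
  by rewrite (distrC a t) (distrC a b) !ger0_norm ?subr_ge0 // ?lerD2r // ltW.
move=> /ball3P[b1 b2 b3] [c1 c2 c3]; apply/ball3P.
by split; [apply: h b1 c1|apply: h b2 c2|apply: h b3 c3].
Qed.

Definition rat_point (q : rat * rat * rat) : space3 R := (ratr q.1.1, ratr q.1.2, ratr q.2).

Lemma rat_point_dense X (d : R) : 0 < d -> exists q, ball X d (rat_point q).
Proof.
move=> d0; have app (x : R) : exists q : rat, `|x - ratr q| < d.
  have /rat_in_itvoo[q] : x - d < x + d by lra.
  by rewrite in_itv /= => qx; exists q; rewrite ltr_norml; lra.
have [q1 h1] := app (xc X); have [q2 h2] := app (yc X); have [q3 h3] := app (zc X).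
by exists (q1, q2, q3); apply/ball3P.
Qed.

(** The potentials are locally equi-Lipschitz, so that convergence at the
   rational points of the nozzle gives convergence everywhere in it. *)
Lemma potential_limit : exists2 sigma, strictly_increasing sigma &
  exists Psi : space3 R -> R, forall X, D X -> pot (sigma n) X @[n --> \oo] --> Psi X.
Proof.
pose point k : option (rat * rat * rat) := unpickle k.
pose u n k := if point k is Some q then
  (if `[< D (rat_point q) >] then pot n (rat_point q) else 0) else 0.
pose M k := if point k is Some q then dist1 (rat_point q) origin else 0.
have d0 X Y : 0 <= dist1 X Y by rewrite /dist1 !addr_ge0.
have uM n k : `|u n k| <= M k.
  rewrite /u /M; case: (point k) => [q|]; last by rewrite normr0.
  by case: asboolP => [/pot_bound|_]; [exact|rewrite normr0].
have [sigma s [l hl]] := pointwise_subsequence uM.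
exists sigma => //; exists (fun X => limn (fun n => pot (sigma n) X)) => X DX.
suff : cvgn (fun n => pot (sigma n) X) by [].
apply/cauchy_cvgP/cauchy_exP => e e0.
have /nbhs_ballP[r /= r0 rD] : nbhs X D by apply: open_nbhs_nbhs; split => //; exact: nozzle_open.
pose d := Num.min r (e / 6).
have dpos : 0 < d by rewrite lt_min r0 divr_gt0.
have de : d <= e / 6 by rewrite ge_min lexx orbT.
have [q bq] := rat_point_dense X dpos.
have cD : cell X (rat_point q) `<=` D.
  move=> Z /(cell_ball bq) bZ; apply: rD; apply: le_ball bZ.
  by rewrite ge_min lexx.
have qD : D (rat_point q) by apply: cD; split; exact: betweenr.
have uE n : u n (pickle q) = pot n (rat_point q).
  by rewrite /u /point pickleK asboolT.
have := hl (pickle q); move/cvgrPdist_lt => /(_ (e / 2)) [|N _ hN]; first by rewrite divr_gt0.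
exists (l (pickle q)); exists N => // n /= Nn; rewrite /ball /=.
have h1 := hN n Nn; rewrite /= uE in h1.
have h2 := pot_cell (sigma n) cD.
have h3 : dist1 X (rat_point q) < 3 * d.
  have /ball3P[b1 b2 b3] := bq; rewrite /dist1.
  by move: b1 b2 b3; move: (`|_|) (`|_|) (`|_|) => *; lra.
apply: le_lt_trans (ler_distD (pot (sigma n) (rat_point q)) _ _) _.
rewrite (distrC (pot _ (rat_point q)) (pot _ X)).
apply: lt_le_trans (ltr_leD h1 (le_trans h2 (ltW h3))) _.
by move: de; move: (d) => d' *; lra.
Qed.

End PotentialLimit.

(** * Almost everywhere convergence of the velocities *)
Section CompactCutoffs.
Context {R : realType} (p f : R -> R) (m : nat -> R) (Phi : nat -> space3 R -> R)
  (Un Vn : nat -> R * R -> R) (Psi : space3 R -> R).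
Hypotheses (hf : nozzle_profile f).
Hypothesis flows : forall n, subsonic_flow p f (m n) (Phi n) (Un n) (Vn n).
Hypothesis potPsi : forall X, nozzle f X -> pot Phi n X @[n --> \oo] --> Psi X.
Implicit Types (X Y Z e : space3 R).
Local Hint Resolve ex_axis ey_axis ez_axis : core.
Local Notation D := (nozzle f).
Local Notation v n := (velocity (Un n) (Vn n)).

(** Cutoffs supported in the compact sets [zeta_core k] of the nozzle; every
   point of the nozzle lies in the support of one of them. *)
Definition zeta (k : nat) X : R := chi f k.+1%:R^-1 X * kappa k.+1%:R X.
Definition zeta_core (k : nat) : set (space3 R) := core f k.+1%:R^-1 k.+1%:R.

Let k0 (k : nat) : 0 < k.+1%:R^-1 :> R. Proof. by rewrite invr_gt0. Qed.

Lemma zeta_core_compact k : compact (zeta_core k).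
Proof. by apply: core_compact => //; exact: ltW. Qed.

Lemma zeta_core_sub k : zeta_core k `<=` D.
Proof. exact: core_sub. Qed.

Lemma zeta_core_measurable k : measurable3 (zeta_core k).
Proof.
rewrite -(setCK (zeta_core k)); apply: measurableC; apply: open_measurable3.
by apply: closed_openC; exact: core_closed.
Qed.

Lemma zeta_C1 k : C1 setT (zeta k).
Proof. exact: (C1M openT (chi_C1 hf _).1 (kappa_C1 _).1). Qed.

Lemma zeta_ge0 k X : 0 <= zeta k X.
Proof.
rewrite mulr_ge0 ?kappa_ge0 //.
by have /andP[] := step_bounds ((dfun f X - k.+1%:R^-1) / k.+1%:R^-1).
Qed.

Lemma zeta_eq0 k X : ~ zeta_core k X -> zeta k X = 0.
Proof.
move=> KX; rewrite /zeta.
have [h|h] := leP (dfun f X) k.+1%:R^-1; first by rewrite chi_eq0 // mul0r.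
rewrite kappa_eq0 ?mulr0 // leNgt; apply/negP => xA; apply: KX; split; exact: ltW.
Qed.

Lemma zeta_exhaust X : D X -> exists k, 0 < zeta k X.
Proof.
rewrite nozzleE // => dX.
have [N hN] : exists N : nat, 0 + N.+1%:R^-1 < dfun f X / 2 :> R.
  by apply: ltr_add_invr; rewrite divr_gt0.
rewrite add0r in hN.
have [B hB] : exists B : nat, `|xc X| < B%:R.
  by exists (Num.bound `|xc X|); exact: archi_boundP.
pose k := maxn N B; exists k; rewrite /zeta chi_eq1 ?mul1r //.
  apply: kappa_gt0; apply: lt_le_trans hB _; rewrite ler_nat.
  by apply: leqW; exact: leq_maxr.
rewrite mulrC -ler_pdivlMr //; apply: le_trans (ltW hN).
by rewrite lef_pV2 ?posrE ?ltr0n // ler_nat ltnS leq_maxl.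
Qed.

(** The fourth power of the distance of two velocities: the quantity controlled
   by [mass_flux_monotone]. *)
Definition gap n n' X : R := dot3 (v n X - v n' X) (v n X - v n' X) ^+ 2.

Let vcont n X := @flow_velocity_continuous R p f _ _ _ _ hf (flows n) X.

Lemma gap_continuous n n' X : D X -> {for X, continuous (gap n n')}.
Proof.
move=> DX; have [a1 a2 a3] := vcont n DX; have [b1 b2 b3] := vcont n' DX.
have sq (c : space3 R -> R) : {for X, continuous (c \o v n)} -> {for X, continuous (c \o v n')} ->
    {for X, continuous (fun Y => (c (v n Y) - c (v n' Y)) * (c (v n Y) - c (v n' Y)))}.
  by move=> ca cb; apply: cvgM; exact: (cvgB ca cb).
apply: (@continuous_comp _ _ _ (fun Y => dot3 (v n Y - v n' Y) (v n Y - v n' Y)) (fun t : R => t ^+ 2)); last exact: exprn_continuous.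
exact: (cvgD (cvgD (sq _ a1 b1) (sq _ a2 b2)) (sq _ a3 b3)).
Qed.

Lemma pot_C1 n : C1 D (pot Phi n).
Proof. exact: (C1D (nozzle_open hf) (flow_C1 (flows n)).1 (@C1_cst R D _)). Qed.

Lemma der_pot n X e : D X -> e \in [:: e_x; e_y; e_z] -> 'D_e (pot Phi n) X = 'D_e (Phi n) X.
Proof.
move=> DX ea.
refine (etrans (deriveD (C1_derivable (flow_C1 (flows n)).1 DX ea) (@derivable_cst _ _ _ _ _ _)) _).
by rewrite derive_cst addr0.
Qed.

(** The right-hand side of the estimate of [gap]. *)
Definition pot_err k n : R := \int[mu3 R]_(X in zeta_core k) `|pot Phi n X - Psi X|.

Lemma pot_measurable n : measurable_fun3 D (pot Phi n).
Proof.
apply: continuous_measurable3; first exact: nozzle_open.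
by move=> X DX; exact: (C1_continuous (pot_C1 n)).
Qed.

Lemma Psi_measurable : measurable_fun3 D Psi.
Proof.
apply: (@measurable_fun_cvg _ _ _ _ (fun n => pot Phi n)) => [n|X DX]; last exact: potPsi.
exact: pot_measurable.
Qed.

Lemma Psi_bound X : D X -> `|Psi X| <= dist1 X origin.
Proof.
move=> DX; apply: (ler_cvg_to (cvg_norm (potPsi DX)) (cvg_cst (dist1 X origin))).
by apply: nearW => n; exact: pot_bound hf flows n X DX.
Qed.

Lemma pot_err_integrable k n :
  (mu3 R).-integrable (zeta_core k) (EFin \o (fun X => `|pot Phi n X - Psi X|)).
Proof.
have [B KB] := compact_in_box (@zeta_core_compact k).
apply: (@box_integrable _ _ _ B (2 * (3 * B)) (@zeta_core_measurable k)).
- apply: measurableT_comp => //; apply: measurable_funB.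
    exact: (measurable_funS (nozzle_measurable hf) (@zeta_core_sub k) (pot_measurable n)).
  exact: (measurable_funS (nozzle_measurable hf) (@zeta_core_sub k) Psi_measurable).
- move=> X KX; rewrite normr_id; have DX := zeta_core_sub KX.
  have d3 : dist1 X origin <= 3 * B.
    have /boxP[] := KB _ KX; rewrite /dist1 /origin {2}/xc {2}/yc {2}/zc /= !subr0.
    by move: (`|_|) (`|_|) (`|_|) => *; lra.
  apply: le_trans (ler_normB _ _) _.
  have h1 := le_trans (pot_bound hf flows n DX) d3.
  have h2 := le_trans (Psi_bound DX) d3.
  by rewrite mulr_natl mulr2n; exact: lerD.
- by move=> X KX bX; case: bX; exact: KB.
Qed.

Lemma pot_err_cvg k : pot_err k n @[n --> \oo] --> (0 : R).
Proof.
have [B KB] := compact_in_box (@zeta_core_compact k).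
have mK := @zeta_core_measurable k.
have [|||||_] := @box_dominated _ (zeta_core k) (fun n X => `|pot Phi n X - Psi X|) (cst 0) B (2 * (3 * B)) mK _ _ _ _ _.
- by move=> n; case/integrableP: (pot_err_integrable k n) => /measurable_EFinP.
- exact: measurable_cst.
- apply: aeW => X /zeta_core_sub DX; rewrite /=.
  have c : (pot Phi n X - Psi X) @[n --> \oo] --> (0 : R).
    by rewrite -(subrr (Psi X)); apply: cvgB; [exact: potPsi|exact: cvg_cst].
  by have := cvg_norm c; rewrite normr0; exact.
- move=> n X KX; rewrite normr_id; have DX := zeta_core_sub KX.
  have d3 : dist1 X origin <= 3 * B.
    have /boxP[] := KB _ KX; rewrite /dist1 /origin {2}/xc {2}/yc {2}/zc /= !subr0.
    by move: (`|_|) (`|_|) (`|_|) => *; lra.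
  apply: le_trans (ler_normB _ _) _.
  have h1 := le_trans (pot_bound hf flows n DX) d3.
  have h2 := le_trans (Psi_bound DX) d3.
  by rewrite mulr_natl mulr2n; exact: lerD.
- by move=> n X KX bX; case: bX; exact: KB.
by rewrite Rintegral_cst // mul0r.
Qed.

End CompactCutoffs.

Section GapEstimate.
Context {R : realType} (p f : R -> R) (m : nat -> R) (Phi : nat -> space3 R -> R)
  (Un Vn : nat -> R * R -> R) (Psi : space3 R -> R).
Hypotheses (hp : gas_law p) (hf : nozzle_profile f).
Hypothesis flows : forall n, subsonic_flow p f (m n) (Phi n) (Un n) (Vn n).
Hypothesis potPsi : forall X, nozzle f X -> pot Phi n X @[n --> \oo] --> Psi X.
Implicit Types (X Y Z e : space3 R).
Local Hint Resolve ex_axis ey_axis ez_axis : core.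
Local Notation D := (nozzle f).
Local Notation v n := (velocity (Un n) (Vn n)).
Local Notation F n := (fun X => mass_flux p (v n X)).
Local Notation zeta := (zeta f).
Local Notation zeta_core := (zeta_core f).
Local Notation gap := (gap Un Vn).
Local Notation pot_err := (pot_err f Phi Psi).

(** Test the difference of the equations of two flows with the difference of
   their potentials: by the monotonicity of the flux the product of the
   differences controls the distance of the velocities, while the remaining
   term contains the difference of the potentials without derivatives. *)
Lemma gap_estimate k : exists2 C : R, 0 <= C & forall n n',
  (mu3 R).-integrable setT (EFin \o (fun X => zeta k X * gap n n' X)) /\
  \int[mu3 R]_X (zeta k X * gap n n' X) <= C * (pot_err k n + pot_err k n').
Proof.
have [M M0 hM] := grad_bounded (@zeta_core_compact R f hf k) (zeta_C1 hf k) (@zeta_eq0 R f k).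
have g00 : 0 <= dens p 0 by apply: le_trans (dens_ge1 hp ler01); rewrite ler01.
pose B := dens p 0 * (3 * M) + dens p 0 * (3 * M).
have B0 : 0 <= B by rewrite addr_ge0 // !mulr_ge0.
exists (8 * B); first by rewrite mulr_ge0.
move=> n n'.
have oD := nozzle_open hf.
have cK := @zeta_core_compact R f hf k; have KD := @zeta_core_sub R f hf k.
have mK := @zeta_core_measurable R f hf k.
have cz := zeta_C1 hf k; have z0 := @zeta_eq0 R f k.
have czD := C1S (@subsetT _ D) cz.
pose Dl X := pot Phi n X - pot Phi n' X.
have cDl : C1 D Dl.
  have := C1D oD (pot_C1 hf flows n) (C1M oD (@C1_cst R D (-1)) (pot_C1 hf flows n')).
  by apply: C1_near_eq => // X _; rewrite /Dl mulN1r.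
have derDl X e : D X -> e \in [:: e_x; e_y; e_z] ->
    'D_e Dl X = 'D_e (Phi n) X - 'D_e (Phi n') X.
  move=> DX ea; refine (etrans (deriveB (C1_derivable (pot_C1 hf flows n) DX ea) (C1_derivable (pot_C1 hf flows n') DX ea)) _).
  exact: (congr2 (fun a b => a - b) (der_pot flows n DX ea) (der_pot flows n' DX ea)).
pose psi X := zeta k X * Dl X.
have cpsi : C1 D psi := C1M oD czD cDl.
have psi0 X : ~ zeta_core k X -> psi X = 0 by move=> /z0 h; rewrite /psi h mul0r.
pose w X := v n X - v n' X.
have wc (c : space3 R -> R) X : {for X, continuous (c \o v n)} -> {for X, continuous (c \o v n')} ->
    {for X, continuous (fun Y => c (v n Y) - c (v n' Y))}.
  by move=> ca cb; exact: (cvgB ca cb).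
(* [a + b] is the difference of the fluxes times the gradient of [zeta k * Dl]. *)
pose a X := zeta k X * (dot3 (F n X) (w X) - dot3 (F n' X) (w X)).
pose b X := Dl X * (dot3 (F n X) (grad (zeta k) X) - dot3 (F n' X) (grad (zeta k) X)).
have gz0 X : ~ zeta_core k X -> grad (zeta k) X = (0, 0, 0).
  by move=> KX; rewrite /grad !(der_outside_compact _ cK z0 KX).
have gp0 X : ~ zeta_core k X -> grad psi X = (0, 0, 0).
  by move=> KX; rewrite /grad !(der_outside_compact _ cK psi0 KX).
have dot0 (u : space3 R) : dot3 u (0, 0, 0) = 0.
  by rewrite /dot3 [xc (_, _, _)]/xc [yc (_, _, _)]/yc [zc (_, _, _)]/zc /= !mulr0 !addr0.
have a0 X : ~ zeta_core k X -> a X = 0 by move=> /z0 h; rewrite /a h mul0r.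
have b0 X : ~ zeta_core k X -> b X = 0 by move=> /gz0 h; rewrite /b h !dot0 subrr mulr0.
have cfl i (u : space3 R -> space3 R) X := @dot3_flux_continuous R p f _ _ _ _ hp hf (flows i) u X.
have ca : continuous a.
  apply: (continuous_ext0 oD cK KD) => // X DX.
  have [a1 a2 a3] := flow_velocity_continuous hf (flows n) DX.
  have [b1 b2 b3] := flow_velocity_continuous hf (flows n') DX.
  have w1 := wc _ _ a1 b1; have w2 := wc _ _ a2 b2; have w3 := wc _ _ a3 b3.
  apply: cvgM; first exact: (C1_continuous cz).
  by apply: cvgB; [exact: (cfl n w X DX w1 w2 w3)|exact: (cfl n' w X DX w1 w2 w3)].
have cb : continuous b.
  apply: (continuous_ext0 oD cK KD) => // X DX.
  have [w1 w2 w3] := grad_continuous czD DX.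
  apply: cvgM; first exact: (C1_continuous cDl).
  by apply: cvgB; [exact: (cfl n _ X DX w1 w2 w3)|exact: (cfl n' _ X DX w1 w2 w3)].
have cq i : continuous (fun X => dot3 (F i X) (grad psi X)).
  apply: (continuous_ext0 oD cK KD) => [X DX|X /gp0 h]; last by rewrite h dot0.
  have [w1 w2 w3] := grad_continuous cpsi DX.
  exact: (cfl i _ X DX w1 w2 w3).
have iq i : (mu3 R).-integrable setT (EFin \o (fun X => dot3 (F i X) (grad psi X))).
  by apply: (compact_integrable cK (cq i)) => X /gp0 h; rewrite h dot0.
have ia := compact_integrable cK ca a0; have ib := compact_integrable cK cb b0.
have ab : \int[mu3 R]_X a X = - \int[mu3 R]_X b X.
  apply/eqP; rewrite -addr_eq0 -RintegralD //.
  have W i := flow_weak_interior hp hf (flows i) cK KD cpsi psi0.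
  have E : \int[mu3 R]_X (dot3 (F n X) (grad psi X) - dot3 (F n' X) (grad psi X)) = 0.
    by rewrite RintegralB // (W n) (W n') subrr.
  rewrite -[X in _ == X]E; apply/eqP; congr Rintegral; apply/funext => X.
  have [KX|KX] := pselect (zeta_core k X); last by rewrite a0 // b0 // gp0 // !dot0 subrr addr0.
  have DX := KD _ KX.
  have P e : e \in [:: e_x; e_y; e_z] ->
      'D_e psi X = zeta k X * ('D_e (Phi n) X - 'D_e (Phi n') X) + Dl X * 'D_e (zeta k) X.
    by move=> ea; refine (etrans (der_mul czD cDl DX ea) _); rewrite (derDl X e DX ea).
  have [p1 p2 p3] := flow_der (flows n) DX; have [q1 q2 q3] := flow_der (flows n') DX.
  rewrite /a /b !dot3_grad (P _ ex_axis) (P _ ey_axis) (P _ ez_axis) p1 p2 p3 q1 q2 q3 /w.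
  rewrite !dot3Br /dot3.
  move: (mass_flux p (v n X)) (mass_flux p (v n' X)) (v n X) (v n' X) => f1 f2 v1 v2.
  move: ('D_e_x (zeta k) X) ('D_e_y (zeta k) X) ('D_e_z (zeta k) X) (zeta k X) (Dl X) => *.
  move: (xc f1) (yc f1) (zc f1) (xc f2) (yc f2) (zc f2) (xc v1) (yc v1) (zc v1) (xc v2) (yc v2) (zc v2) => *.
  by ring.
have cg : continuous (fun X => zeta k X * gap n n' X).
  apply: (continuous_ext0 oD cK KD) => [X DX|X /z0 h]; last by rewrite h mul0r.
  by apply: cvgM; [exact: (C1_continuous cz)|exact: gap_continuous hf flows n n' X DX].
have ig : (mu3 R).-integrable setT (EFin \o (fun X => zeta k X * gap n n' X)).
  by apply: (compact_integrable cK cg) => X /z0 h; rewrite h mul0r.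
split; first exact: ig.
have le1 : \int[mu3 R]_X (zeta k X * gap n n' X) <= 8 * \int[mu3 R]_X a X.
  rewrite -RintegralZl //; apply: le_Rintegral => //.
    by have := integrableZl measurableT 8 ia; apply: eq_integrable.
  move=> X _; have [KX|KX] := pselect (zeta_core k X); last first.
    by rewrite a0 // (z0 X KX) mul0r mulr0.
  have DX := KD _ KX.
  have h := mass_flux_monotone hp (ltW (flow_speed_lt1_in (flows n) DX)) (ltW (flow_speed_lt1_in (flows n') DX)).
  rewrite /a [leRHS]mulrCA; apply: ler_wpM2l; first exact: zeta_ge0.
  move: h; rewrite (dot3Dl (mass_flux p _)) (dot3Nl (mass_flux p _)) ler_pdivrMr // [_ * 8]mulrC.
  exact.
apply: le_trans le1 _; rewrite -mulrA ler_wpM2l // ab.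
apply: le_trans (ler_norm _) _; rewrite normrN.
apply: le_trans (le_normr_Rintegral _ ib) _ => //.
rewrite -(@Rintegral_support _ (zeta_core k)) //; last by move=> X /b0 ->; rewrite normr0.
have i1 := pot_err_integrable hf flows potPsi k n.
have i2 := pot_err_integrable hf flows potPsi k n'.
have i12 := integrableD mK i1 i2.
rewrite /pot_err -RintegralD // -RintegralZl //.
apply: le_Rintegral => //.
- apply: integrableS (integrable_abse ib) => //.
- by have := integrableZl mK B i12; apply: eq_integrable.
move=> X KX; have DX := KD _ KX; have hMX := hM X.
have fl i : `|dot3 (F i X) (grad (zeta k) X)| <= dens p 0 * (3 * M).
  by apply: (flow_flux_bound hp (flows i) DX M0);
    [exact: hMX _ ex_axis|exact: hMX _ ey_axis|exact: hMX _ ez_axis].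
rewrite /b normrM mulrC; apply: ler_pM => //.
  by apply: le_trans (ler_normB _ _) _; exact: lerD.
rewrite /Dl; apply: le_trans (ler_distD (Psi X) _ _) _.
by rewrite (distrC (Psi X)).
Qed.

End GapEstimate.

Section AlmostEverywhere.
Context {R : realType}.

(** A series of nonnegative functions with summable integrals converges almost
   everywhere; in particular its terms are bounded there. *)
Lemma ae_bounded_of_summable (h : nat -> space3 R -> R) :
  (forall n, (mu3 R).-integrable setT (EFin \o h n)) -> (forall n X, 0 <= h n X) ->
  (forall n, \int[mu3 R]_X h n X <= 2 / (2 ^ n.+1)%:R) ->
  {ae mu3 R, forall X, exists C : R, forall n, h n X <= C}.
Proof.
move=> ih h0 hs.
have mh n : measurable_fun (setT : set (M3 R)) (EFin \o h n) by case/integrableP: (ih n).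
have h0E n (X : M3 R) : setT X -> (0 <= (h n X)%:E)%E by move=> _; rewrite lee_fin.
pose S (X : M3 R) := (\sum_(n <oo) (h n X)%:E)%E.
have iS : (mu3 R).-integrable setT S.
  apply/integrableP; split.
    by apply: ge0_emeasurable_sum => n *; [rewrite lee_fin|exact: mh].
  rewrite (_ : (fun X => `|S X|%E) = S); last first.
    by apply/funext => X; rewrite gee0_abs //; apply: nneseries_ge0 => n _ _; rewrite lee_fin.
  have E := @integral_nneseries _ (M3 R) R (mu3 R) setT measurableT (fun n X => (h n X)%:E) mh h0E.
  apply: (@le_lt_trans _ _ (\sum_(n <oo) (\int[mu3 R]_X (h n X)%:E))%E); first by rewrite -E.
  apply: (@le_lt_trans _ _ (\sum_(n <oo) (2 / (2 ^ (n + 1))%:R)%:E)%E).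
    apply: lee_nneseries => n _; first by move=> _; apply: integral_ge0 => X _; rewrite lee_fin.
    by rewrite Rintegral_EFin // lee_fin addn1.
  have := @cvg_geometric_eseries_half R 2 0; rewrite /eseries => /cvg_lim -> //.
  by rewrite ltry.
have := integrable_ae measurableT iS; apply: ae_sub => X /(_ I) Sf.
exists (fine (S X)) => n; rewrite -lee_fin fineK //.
have t0 i : (0 <= i)%N -> xpredT i -> (0 <= (h i X)%:E)%E by move=> _ _; rewrite lee_fin.
apply: le_trans (nneseries_lim_ge n.+1 t0).
by rewrite big_nat_recr //= leeDr // sume_ge0 // => i _; rewrite lee_fin.
Qed.

Lemma ae_forall_nat (P : nat -> set (M3 R)) :
  (forall n, {ae mu3 R, forall X, P n X}) -> {ae mu3 R, forall X, forall n, P n X}.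
Proof. exact: ae_foralln. Qed.

Lemma near_forall_le (P : nat -> nat -> Prop) (j : nat) :
  (forall k, \forall n \near \oo, P k n) -> \forall n \near \oo, forall k, (k <= j)%N -> P k n.
Proof.
move=> H; elim: j => [|j ih].
  by apply: filterS (H 0%N) => n h k; rewrite leqn0 => /eqP ->.
apply: filterS2 ih (H j.+1) => n h1 h2 k; rewrite leq_eqVlt => /orP[/eqP -> //|].
exact: h1.
Qed.

End AlmostEverywhere.

Section FastSubsequence.
Context {R : realType} (p f : R -> R) (m : nat -> R) (Phi : nat -> space3 R -> R)
  (Un Vn : nat -> R * R -> R) (Psi : space3 R -> R).
Hypotheses (hp : gas_law p) (hf : nozzle_profile f).
Hypothesis flows : forall n, subsonic_flow p f (m n) (Phi n) (Un n) (Vn n).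
Hypothesis potPsi : forall X, nozzle f X -> pot Phi n X @[n --> \oo] --> Psi X.
Implicit Types (X Y Z e : space3 R).
Local Notation D := (nozzle f).
Local Notation v n := (velocity (Un n) (Vn n)).
Local Notation zeta := (zeta f).
Local Notation gap := (gap Un Vn).
Local Notation pot_err := (pot_err f Phi Psi).

(** By [gap_estimate] the velocities are Cauchy in the fourth power mean on
   compact subsets of the nozzle.  Choose [tau] such that the gap between
   consecutive terms has integral at most [2^- 5 j]: then the functions
   [2^(4 j) gap] have a summable sequence of integrals and are bounded at almost
   every point, where consecutive velocities are at distance [O(2^-j)]. *)
Lemma velocity_subsequence : exists2 tau, strictly_increasing tau &
  {ae mu3 R, forall X, D X -> [/\ cvgn (fun n => xc (v (tau n) X)),
    cvgn (fun n => yc (v (tau n) X)) & cvgn (fun n => zc (v (tau n) X))]}.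
Proof.
have /choice[C hC] : forall k, exists C : R, 0 <= C /\ forall n n',
    (mu3 R).-integrable setT (EFin \o (fun X => zeta k X * gap n n' X)) /\
    \int[mu3 R]_X (zeta k X * gap n n' X) <= C * (pot_err k n + pot_err k n').
  by move=> k; have [C C0 h] := gap_estimate hp hf flows potPsi k; exists C.
pose r (j : nat) : R := 2^-1 ^+ j.
have r0 j : 0 < r j by rewrite exprn_gt0 // invr_gt0.
pose P (j n : nat) := forall n', (n <= n')%N -> forall k, (k <= j)%N ->
  C k * pot_err k n' <= r (5 * j)%N / 2.
have [j N|tau ts tP] := @frequent_subsequence P.
  have e0 : 0 < r (5 * j)%N / 2 by rewrite divr_gt0.
  have ev k : \forall n \near \oo, C k * pot_err k n <= r (5 * j)%N / 2.
    have c : C k * pot_err k n @[n --> \oo] --> C k * 0.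
      by apply: cvgM; [exact: cvg_cst|exact: pot_err_cvg hf flows potPsi k].
    rewrite mulr0 in c; move/cvgrPdist_lt : c => /(_ _ e0).
    by apply: filterS => n; rewrite sub0r normrN => /ltW h; exact: le_trans (ler_norm _) h.
  have [N0 _ hN0] := near_forall_le j ev.
  exists (maxn N N0); first exact: leq_maxl.
  by move=> n' hn k kj; apply: hN0 => //=; exact: leq_trans (leq_maxr _ _) hn.
exists tau => //.
have bound k j : (k <= j)%N ->
    \int[mu3 R]_X (zeta k X * gap (tau j) (tau j.+1) X) <= r (5 * j)%N.
  move=> kj; have [_ h] := (hC k).2 (tau j) (tau j.+1).
  apply: le_trans h _; rewrite mulrDr.
  have h1 := tP j (tau j) (leqnn _) k kj.
  have h2 := tP j (tau j.+1) (ltnW (ts _ _ (ltnSn j))) k kj.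
  by apply: le_trans (lerD h1 h2) _; rewrite -splitr.
pose h k n X := 2 ^+ (4 * (k + n)) * (zeta k X * gap (tau (k + n)%N) (tau (k + n).+1) X).
have gap0 n n' X : 0 <= gap n n' X by exact: sqr_ge0.
have hB k : {ae mu3 R, forall X, exists B : R, forall n, h k n X <= B}.
  apply: ae_bounded_of_summable => [n|n X|n].
  - have := integrableZl measurableT (2 ^+ (4 * (k + n))) ((hC k).2 (tau (k + n)%N) (tau (k + n).+1)).1.
    exact: eq_integrable.
  - exact: (mulr_ge0 (exprn_ge0 _ (ler0n R 2)) (mulr_ge0 (@zeta_ge0 R f k X) (gap0 _ _ X))).
  - rewrite /h RintegralZl //; last exact: ((hC k).2 _ _).1.
    apply: le_trans (ler_wpM2l _ (bound k (k + n)%N (leq_addr _ _))) _.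
      by rewrite exprn_ge0.
    have -> : 2 / (2 ^ n.+1)%:R = r n.
      rewrite natrX exprS invfM mulrA mulfV ?mul1r ?pnatr_eq0 //.
      by rewrite /r exprVn.
    have -> : 2 ^+ (4 * (k + n)) * r (5 * (k + n))%N = r (k + n)%N.
      rewrite /r (_ : (5 * (k + n) = 4 * (k + n) + (k + n))%N); last by rewrite -mulSnr.
      by rewrite exprD mulrA -exprMn mulfV ?pnatr_eq0 // expr1n mul1r.
    by apply: ler_wiXn2l; rewrite ?invf_le1 ?ler1n // ?invr_ge0 // leq_addl.
have := ae_forall_nat hB; apply: ae_sub => X hX DX.
have [k zk] := zeta_exhaust hf DX; have [B hBX] := hX k.
pose K := Num.max 1 (B / zeta k X).
have K1 : 1 <= K by rewrite le_max lexx.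
have small j : (k <= j)%N -> gap (tau j) (tau j.+1) X <= K * r (4 * j)%N.
  move=> kj; have := hBX (j - k)%N; rewrite /h subnKC //.
  rewrite mulrCA => h1.
  have -> : r (4 * j)%N = (2 ^+ (4 * j))^-1 by rewrite /r exprVn.
  rewrite ler_pdivlMr ?exprn_gt0 // /K le_max; apply/orP; right.
  by rewrite ler_pdivlMr // mulrC [gap _ _ _ * _]mulrC.
have coord (c : space3 R -> R) : (forall Y Z, c (Y - Z) = c Y - c Z) ->
    (forall Y, c Y ^+ 2 <= dot3 Y Y) -> cvgn (fun n => c (v (tau n) X)).
  move=> cB cd; apply: (@geometric_cauchy _ _ K k); first by rewrite (le_trans ler01).
  move=> j kj; rewrite -cB; set w := v _ X - v _ X.
  have w0 : 0 <= `|c w| := normr_ge0 _.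
  have w4 : `|c w| ^+ 4 <= (K * r j) ^+ 4.
    rewrite (_ : `|c w| ^+ 4 = (c w ^+ 2) ^+ 2); last first.
      by rewrite -(real_normK (num_real (c w))) -exprM.
    apply: (@le_trans _ _ (gap (tau j) (tau j.+1) X)).
      by rewrite /gap ler_sqr ?nnegrE ?sqr_ge0 ?dot3_ge0.
    apply: le_trans (small j kj) _; rewrite exprMn /r -exprM mulnC.
    by rewrite ler_pM2r ?exprn_gt0 ?invr_gt0 // ler_eXnr.
  by rewrite -(ler_pXn2r (n := 4)) // nnegrE // mulr_ge0 ?(le_trans ler01 K1) // ltW.
by split; apply: coord => // Y; rewrite /dot3 -!expr2;
  have := sqr_ge0 (xc Y); have := sqr_ge0 (yc Y); have := sqr_ge0 (zc Y);
  move: (xc Y ^+ 2) (yc Y ^+ 2) (zc Y ^+ 2) => *; lra.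
Qed.

End FastSubsequence.

(** * Null sets of the half-section *)
Section NullSets.
Context {R : realType}.

(** A countable cover of [N] by intervals of small total length is mapped by
   [h] to sets of at most twice these lengths. *)
Lemma null_image_lipschitz (h : R -> R) (N E : set (measurableTypeR R)) :
  (forall x y, `|h x - h y| <= `|x - y|) -> measurable E -> E `<=` h @` N ->
  mu1 R N = 0%E -> mu1 R E = 0%E.
Proof.
move=> hl mE EN N0; apply/eqP; rewrite -measure_le0; apply/lee_addgt0Pr => e e0.
rewrite add0e.
have : (mu1 R N < (e / 2)%:E)%E by rewrite N0 lte_fin divr_gt0.
move=> /ereal_inf_lt[z [A [mA NA] <-] ze].
have : forall k, exists ab : R * R, [/\ ab.1 <= ab.2, A k `<=` `]ab.1, ab.2] &
    wlength idfun (A k) = (ab.2 - ab.1)%:E].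
  move=> k; have /ocitvP[->|[ab lab ->]] := mA k.
    by exists (0, 0); split => //=; rewrite ?subrr ?wlength0 // => x [].
  exists ab; split => //; first exact: ltW.
  by rewrite wlength_itv_bnd // ltW.
move=> /choice[ab hab].
pose I k : set (measurableTypeR R) := `[h (ab k).2 - ((ab k).2 - (ab k).1), h (ab k).2 + ((ab k).2 - (ab k).1)].
have mI k : measurable (I k) by exact: measurable_itv.
have EI : E `<=` \bigcup_k I k.
  move=> _ /EN[x Nx <-]; have [k _ Akx] := NA x Nx; exists k => //.
  have [_ /(_ _ Akx) + _] := hab k; rewrite /= in_itv /= => /andP[ax xb].
  have := hl x (ab k).2; rewrite (distrC x) (ger0_norm (_ : 0 <= (ab k).2 - x)) ?subr_ge0 //.
  by rewrite /I /= in_itv /= ler_norml => /andP[? ?]; apply/andP; split; lra.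
have le1 : (mu1 R E <= \sum_(k <oo) mu1 R (I k))%E.
  exact: (@measure_sigma_subadditive _ _ _ (mu1 R) E I mI mE EI).
apply: le_trans le1 _.
apply: (@le_trans _ _ (\sum_(k <oo) (2%:E * wlength idfun (A k)))%E).
  apply: lee_nneseries => k _; first by move=> _; exact: measure_ge0.
  have [l1 _ ->] := hab k; rewrite /I lebesgue_measure_itv /= lte_fin -EFinM.
  by case: ifP => _; rewrite ?lee_fin -?EFinB ?lee_fin; lra.
rewrite nneseriesZl; last first.
  by move=> k _; have [l1 _ ->] := hab k; rewrite lee_fin subr_ge0.
have -> : e%:E = (2%:E * (e / 2)%:E)%E by rewrite -EFinM mulrCA mulfV ?mulr1 // pnatr_eq0.
by apply: lee_wpmul2l => //; exact: ltW.
Qed.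

Lemma ae_eq0_of_integral0 d (T : measurableType d) (mu : {measure set T -> \bar R})
    (g : T -> \bar R) : measurable_fun setT g -> (forall x, 0 <= g x)%E ->
  (\int[mu]_x g x = 0)%E -> {ae mu, forall x, g x = 0%E}.
Proof.
move=> mg g0 ig.
have : (\int[mu]_x `|g x| = 0)%E.
  by rewrite -[RHS]ig; apply: eq_integral => x _; rewrite gee0_abs.
move=> /(ae_eq_integral_abs mu measurableT mg).
by apply: ae_sub => x; apply.
Qed.

Lemma ae_null_xsection d1 d2 (T1 : measurableType d1) (T2 : measurableType d2)
    (m1 : {measure set T1 -> \bar R}) (m2 : {sigma_finite_measure set T2 -> \bar R})
    (S : set (T1 * T2)) : measurable S -> (m1 \x m2)%E S = 0%E ->
  {ae m1, forall x, m2 (xsection S x) = 0%E}.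
Proof.
move=> mS S0; apply: ae_eq0_of_integral0 S0 => //.
exact: measurable_fun_xsection.
Qed.

Lemma ae_null_ysection d1 d2 (T1 : measurableType d1) (T2 : measurableType d2)
    (m1 : {sigma_finite_measure set T1 -> \bar R}) (m2 : {sigma_finite_measure set T2 -> \bar R})
    (S : set (T1 * T2)) : measurable S -> (m1 \x m2)%E S = 0%E ->
  {ae m2, forall y, m1 (ysection S y) = 0%E}.
Proof.
move=> mS S0; apply: (@ae_eq0_of_integral0 _ _ m2 (m1 \o ysection S)) => //.
  exact: measurable_fun_ysection.
rewrite -[RHS]S0; apply/esym.
have := @product_measure_unique _ _ _ _ R m1 m2 (product_measure2 m1 m2).
apply => // A B mA mB /=; exact: product_measure2E.
Qed.

Lemma radial_lipschitz (z x y : R) :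
  `|Num.sqrt (x ^+ 2 + z ^+ 2) - Num.sqrt (y ^+ 2 + z ^+ 2)| <= `|x - y|.
Proof.
have p (t : R) : 0 <= t ^+ 2 + z ^+ 2 by rewrite addr_ge0 ?sqr_ge0.
set a := Num.sqrt _; set b := Num.sqrt _.
have a2 : a ^+ 2 = x ^+ 2 + z ^+ 2 by rewrite sqr_sqrtr.
have b2 : b ^+ 2 = y ^+ 2 + z ^+ 2 by rewrite sqr_sqrtr.
have a0 : 0 <= a := sqrtr_ge0 _; have b0 : 0 <= b := sqrtr_ge0 _.
have cs : x * y + z ^+ 2 <= a * b.
  have [h|h] := leP (x * y + z ^+ 2) 0; first by apply: le_trans h _; rewrite mulr_ge0.
  rewrite -ler_sqr ?nnegrE; [|exact: ltW|exact: mulr_ge0].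
  rewrite exprMn a2 b2 -subr_ge0.
  have -> : (x ^+ 2 + z ^+ 2) * (y ^+ 2 + z ^+ 2) - (x * y + z ^+ 2) ^+ 2 = (z * (x - y)) ^+ 2 by ring.
  exact: sqr_ge0.
rewrite -ler_sqr ?nnegrE // !real_normK ?num_real // -subr_ge0.
have -> : (x - y) ^+ 2 - (a - b) ^+ 2 = x ^+ 2 + y ^+ 2 - a ^+ 2 - b ^+ 2 + 2 * (a * b - x * y) by ring.
by rewrite a2 b2; move: cs; move: (a * b) (x * y) (x ^+ 2) (y ^+ 2) (z ^+ 2) => *; lra.
Qed.

Notation M2 := (measurableTypeR R * measurableTypeR R)%type.

Lemma radius_continuous : continuous (@Defs.radius R).
Proof.
move=> X; apply: (@continuous_comp _ _ _ (fun X => yc X ^+ 2 + zc X ^+ 2) Num.sqrt); last exact: sqrt_continuous.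
apply: cvgD; apply: (@continuous_comp _ _ _ _ (fun t : R => t ^+ 2)); try exact: exprn_continuous.
  exact: continuous_yc.
exact: continuous_zc.
Qed.

Lemma measurable_cyl : measurable_fun (setT : set (M3 R)) (@cyl R : M3 R -> M2).
Proof.
apply: measurable_fun_pair; first exact: measurable_xc.
exact: (continuous_measurable3 openT (fun X _ => @radius_continuous X)).
Qed.

(** Almost every slice [z = const] of the preimage of [N] is a null set; on the
   slices the cylindrical coordinates act by [y |-> sqrt (y^2 + z^2)], which
   maps null sets to null sets and covers the radii above [z]; finally [z] is
   sent to 0. *)
Lemma null_of_cyl_null (N : set M2) : measurable N -> (forall P, N P -> 0 < P.2) ->
  mu3 R (@cyl R @^-1` N) = 0%E -> mu2 R N = 0%E.
Proof.
move=> mN N0 S0; pose S : set (M3 R) := @cyl R @^-1` N.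
have mS : measurable S.
  by rewrite -(setTI S); apply: measurable_cyl.
have aez := @ae_null_ysection _ _ _ _ (@plane_measure R) (mu1 R) S mS S0.
have zk (k : nat) : exists z : R, [/\ 0 < z, z < k.+1%:R^-1 & mu2 R (ysection S z) = 0%E].
  apply: contrapT => nz; have [Z [mZ Z0 sub]] := aez.
  have k0 : 0 < k.+1%:R^-1 :> R by rewrite invr_gt0.
  pose I : set (measurableTypeR R) := `]0, k.+1%:R^-1[.
  have IZ : I `<=` Z.
    move=> z; rewrite /I /= in_itv /= => /andP[z0 zk]; apply: sub => /= h.
    by apply: nz; exists z.
  have : (mu1 R I <= mu1 R Z)%E.
    by apply: le_measure; rewrite ?inE //; exact: measurable_itv.
  by rewrite Z0 lebesgue_measure_itv /= lte_fin k0 -EFinB subr0 leNgt lte_fin k0.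
have /choice[z hz] := zk.
have aex : {ae mu1 R, forall x, forall k, mu1 R (xsection (ysection S (z k)) x) = 0%E}.
  apply: ae_foralln => k; have [_ _ h] := hz k.
  apply: (@ae_null_xsection _ _ _ _ (mu1 R) (mu1 R)) h.
  exact: measurable_ysection.
have aeN : {ae mu1 R, forall x, mu1 R (xsection N x) = 0%E}.
  apply: ae_sub aex => x hx.
  have mNx : measurable (xsection N x) by exact: measurable_xsection.
  pose Nk k : set (measurableTypeR R) := xsection N x `&` `]z k, +oo[.
  have mNk k : measurable (Nk k) by apply: measurableI => //; exact: measurable_itv.
  have -> : xsection N x = \bigcup_k Nk k.
    apply/seteqP; split => [r|r [k _ []]] //.
    rewrite /xsection /= inE => Nr; have r0 := N0 _ Nr; rewrite /= in r0.
    have [k hk] : exists k : nat, 0 + k.+1%:R^-1 < r by apply: ltr_add_invr.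
    rewrite add0r in hk; exists k => //; split; first by rewrite /xsection /= inE.
    by rewrite /= in_itv /= andbT; have [_ h _] := hz k; exact: lt_trans hk.
  apply/eqP; rewrite -measure_le0.
  have mU : measurable (\bigcup_k Nk k) by exact: bigcupT_measurable.
  have le1 : (mu1 R (\bigcup_k Nk k) <= \sum_(k <oo) mu1 R (Nk k))%E.
    exact: (@measure_sigma_subadditive _ _ _ (mu1 R) _ Nk mNk mU (@subset_refl _ _)).
  apply: le_trans le1 _.
  rewrite eseries0 // => k _ _.
  have [z0 _ _] := hz k.
  apply: (null_image_lipschitz (radial_lipschitz (z k)) (mNk k) _ (hx k)).
  move=> r [Nr]; rewrite /= in_itv /= andbT => zr.
  have p : 0 <= r ^+ 2 - z k ^+ 2 by rewrite subr_ge0 ler_sqr ?nnegrE; [exact: ltW|exact: ltW|exact: ltW (lt_trans z0 zr)].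
  have E : Num.sqrt (Num.sqrt (r ^+ 2 - z k ^+ 2) ^+ 2 + z k ^+ 2) = r.
    by rewrite sqr_sqrtr // subrK sqrtr_sqr ger0_norm //; exact: ltW (lt_trans z0 zr).
  exists (Num.sqrt (r ^+ 2 - z k ^+ 2)) => //.
  have cE : cyl (x, Num.sqrt (r ^+ 2 - z k ^+ 2), z k) = (x, r) by congr (_, _); exact: E.
  apply/xsectionP; apply/ysectionP; rewrite /S /preimage /mkset cE.
  by move/xsectionP : Nr.
transitivity (\int[mu1 R]_x (mu1 R (xsection N x)))%E; first by [].
transitivity (\int[mu1 R]_x (cst 0 x : \bar R))%E; last by rewrite integral_cst // mul0e.
apply: ae_eq_integral => //.
- exact: measurable_fun_xsection.
- by apply: ae_sub aeN => x h _.
Qed.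

End NullSets.

(** * Velocity profiles on the half-section *)
Section LimitMeasurability.
Context d (T : measurableType d) (R : realType).

(** Convergence is the Cauchy property, a countable combination of the sets [A]. *)
Lemma measurable_cvg_set (D : set T) (u : nat -> T -> R) : measurable D ->
  (forall n, measurable_fun D (u n)) -> measurable (D `&` [set x | cvgn (u ^~ x)]).
Proof.
move=> mD mu.
pose A k N i := D `&` [set x | `|u N x - u i x| < k.+1%:R^-1].
have mA k N i : measurable (A k N i).
  pose I : set R := `]-oo, k.+1%:R^-1[.
  have mf : measurable_fun D (fun x => `|u N x - u i x|).
    by apply: measurableT_comp => //; exact: measurable_funB.
  have := mf mD I (measurable_itv _).
  by rewrite (_ : D `&` _ = A k N i) //; apply/seteqP; split => x [Dx];
    rewrite /I /= in_itv.
have -> : D `&` [set x | cvgn (u ^~ x)] =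
    \bigcap_k \bigcup_N \bigcap_(i in [set i | (N <= i)%N]) A k N i.
  apply/seteqP; split => x.
    move=> [Dx /cvg_ex[l /= ul]] k _.
    have k0 : 0 < k.+1%:R^-1 / 2 :> R by rewrite divr_gt0 // invr_gt0.
    move/cvgrPdist_lt : ul => /(_ _ k0)[N _ hN]; exists N => // i /= Ni; split => //=.
    have h1 := hN N (leqnn N); have h2 := hN i Ni.
    apply: le_lt_trans (ler_distD l _ _) _; rewrite (distrC _ l).
    by rewrite [ltRHS]splitr; exact: ltrD.
  move=> h; have [N0 _ h0] := h 0%N I; split; first by have [] := h0 N0 (leqnn N0).
  apply/cauchy_cvgP/cauchy_exP => e e0.
  have [k hk] : exists k : nat, 0 + k.+1%:R^-1 < e by apply: ltr_add_invr.
  rewrite add0r in hk; have [N _ hN] := h k I.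
  exists (u N x), N => // i /= Ni; have [_ /= hi] := hN i Ni.
  by rewrite /ball /=; exact: lt_trans hk.
apply: bigcapT_measurable => k; apply: bigcupT_measurable => N.
by apply: bigcap_measurable => //; exists N => /=.
Qed.

Lemma measurable_fun_restrict (D : set T) (g : T -> R) : measurable D ->
  measurable_fun D g -> measurable_fun setT (g \_ D).
Proof. by move=> mD mg; apply/(measurable_restrictT _ mD). Qed.

End LimitMeasurability.

Section HalfSection.
Context {R : realType} (p f : R -> R) (m : R) (Phi : space3 R -> R) (U V : R * R -> R).
Hypotheses (hf : nozzle_profile f).
Hypothesis flow : subsonic_flow p f m Phi U V.
Implicit Types (X : space3 R).
Notation M2 := (measurableTypeR R * measurableTypeR R)%type.
Local Notation D := (nozzle f).
Local Notation v := (velocity U V).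

(** The half-plane [z = 0 < y], on which the Cartesian velocity is the pair of
   the axial and radial components. *)
Definition meridian (P : R * R) : space3 R := (P.1, P.2, 0).

Lemma cyl_meridian P : 0 < P.2 -> cyl (meridian P) = P.
Proof.
case: P => x r /= r0; congr (_, _).
by rewrite /Defs.radius /yc /zc /= expr0n addr0 sqrtr_sqr gtr0_norm.
Qed.

Lemma radius_meridian P : 0 < P.2 -> radius (meridian P) = P.2.
Proof. by move=> /cyl_meridian/(congr1 snd). Qed.

Lemma velocity_meridian P : 0 < P.2 -> velocity U V (meridian P) = (U P, V P, 0).
Proof.
move=> P0; rewrite /velocity cyl_meridian //.
rewrite radius_meridian //.
by rewrite /yc /zc /= mul0r mulr0 divff ?gt_eqF // mulr1.
Qed.

Lemma half_sectionE : half_section f = [set P | 0 < P.2] `&` (meridian @^-1` D).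
Proof.
apply/seteqP; split => P /=.
  move=> /andP[P0 Pf]; split => //; rewrite /nozzle /=.
  by rewrite radius_meridian.
move=> [P0]; rewrite /nozzle /= radius_meridian // => Pf.
by apply/andP; split.
Qed.

Lemma half_section_nozzle P : half_section f P -> D (meridian P).
Proof. by rewrite half_sectionE => -[]. Qed.

Lemma measurable_meridian : measurable_fun (setT : set M2) (meridian : M2 -> M3 R).
Proof.
apply: measurable_fun_pair; last exact: measurable_cst.
by apply: measurable_fun_pair; [exact: measurable_fst|exact: measurable_snd].
Qed.

Lemma half_section_measurable : measurable (half_section f : set M2).
Proof.
rewrite half_sectionE; apply: measurableI.
  have := @measurable_snd _ _ (measurableTypeR R) (measurableTypeR R) measurableT
    `]0, +oo[ (measurable_itv _).
  rewrite setTI; congr (measurable _); apply/seteqP; split => P /=;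
  by rewrite in_itv /= andbT.
by rewrite -[X in measurable X]setTI; apply: measurable_meridian => //; exact: nozzle_measurable.
Qed.

Lemma flow_UV_measurable : measurable_fun (half_section f : set M2) (U : M2 -> R) /\
  measurable_fun (half_section f : set M2) (V : M2 -> R).
Proof.
have T (c : space3 R -> R) (W : M2 -> R) :
    (forall X, D X -> {for X, continuous (c \o v)}) ->
    (forall P, half_section f P -> c (v (meridian P)) = W P) ->
    measurable_fun (half_section f : set M2) W.
  move=> cc cW.
  have mc : measurable_fun3 D (c \o v) by apply: continuous_measurable3 => //; exact: nozzle_open.
  apply: (@eq_measurable_fun _ _ M2 _ _ ((c \o v) \o meridian)).
    by move=> P; rewrite inE => /cW.
  apply: (@measurable_comp _ _ _ M2 (M3 R) _ D) => //.
  - exact: nozzle_measurable.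
  - by move=> _ [P /half_section_nozzle DP <-].
  - by apply: measurable_funTS; exact: measurable_meridian.
split; [apply: (T (@xc R))|apply: (T (@yc R))].
- by move=> X DX; have [] := flow_velocity_continuous hf flow DX.
- by move=> P /andP[P0 _]; rewrite velocity_meridian.
- by move=> X DX; have [] := flow_velocity_continuous hf flow DX.
- by move=> P /andP[P0 _]; rewrite velocity_meridian.
Qed.

Lemma flow_UV_lt1 P : half_section f P -> U P ^+ 2 + V P ^+ 2 < 1.
Proof.
move=> hP; have := flow_speed_lt1_in flow (half_section_nozzle hP).
case/andP: hP => P0 _; rewrite velocity_meridian // /dot3 /xc /yc /zc /=.
by rewrite mulr0 addr0 -!expr2.
Qed.

End HalfSection.

Section Cylindrical.
Context {R : realType}.
Implicit Types (X : space3 R) (U V : R * R -> R).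

Lemma radial_velocity U V X : 0 < radius X ->
  (yc (velocity U V X) * yc X + zc (velocity U V X) * zc X) / radius X = V (cyl X).
Proof.
move=> r0; rewrite /velocity [yc (_, _, _)]/yc [zc (_, _, _)]/zc /=.
have := radius_sqr X; move: (V _) (radius X) (yc X) (zc X) r0 => u r y z r0 E.
have -> : (u * (y / r) * y + u * (z / r) * z) / r = u * ((y ^+ 2 + z ^+ 2) / r ^+ 2).
  by field; rewrite gt_eqF.
by rewrite -E divff ?mulr1 // expf_neq0 // gt_eqF.
Qed.

Lemma dot3_velocity U V X : 0 < radius X ->
  dot3 (velocity U V X) (velocity U V X) = U (cyl X) ^+ 2 + V (cyl X) ^+ 2.
Proof.
move=> r0; rewrite /velocity /dot3 ![xc (_, _, _)]/xc ![yc (_, _, _)]/yc ![zc (_, _, _)]/zc /=.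
have := radius_sqr X; move: (V _) (U _) (radius X) (yc X) (zc X) r0 => u w r y z r0 E.
have -> : w * w + u * (y / r) * (u * (y / r)) + u * (z / r) * (u * (z / r))
   = w ^+ 2 + u ^+ 2 * ((y ^+ 2 + z ^+ 2) / r ^+ 2).
  by field; rewrite gt_eqF.
by rewrite -E divff ?mulr1 // expf_neq0 // gt_eqF.
Qed.

Lemma ae_off_axis : {ae mu3 R, forall X, 0 < radius X}.
Proof.
exists ((setT : set (measurableTypeR R * measurableTypeR R)) `*` [set 0]).
have m0 : measurable ([set 0] : set (measurableTypeR R)) by exact: measurable_set1.
split.
- exact: measurableX.
- apply: etrans (@product_measure1E _ _ _ _ R (mu2 R) (mu1 R) _ _ measurableT m0) _.
  refine (etrans (congr1 (fun t => (_ * t)%E) (lebesgue_measure_set1 (0 : R))) _).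
  exact: mule0.
- move=> X /= rX; split => //=.
  have := radius_sqr X; have r0 : radius X = 0.
    by apply/eqP; rewrite eq_le radius_ge0 andbT leNgt; apply/negP.
  rewrite r0 expr0n /= => /esym/eqP; rewrite paddr_eq0 ?sqr_ge0 // => /andP[_].
  by rewrite sqrf_eq0 => /eqP.
Qed.

Lemma measurable_ratio (c : space3 R -> R) : continuous c ->
  measurable_fun3 setT (fun X => c X / radius X).
Proof.
move=> cc; pose A : set (space3 R) := [set X | 0 < radius X].
have oA : open A.
  have -> : A = @Defs.radius R @^-1` [set t | 0 < t] by [].
  by move/continuousP : (@radius_continuous R); apply; exact: open_gt.
have mA : measurable3 A := open_measurable3 oA.
rewrite (_ : (fun X => c X / radius X) = (fun X => c X / radius X) \_ A).
  apply: measurable_fun_restrict => //; apply: continuous_measurable3 => // X rX.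
  apply: cvgM; first exact: cc.
  by apply: cvgV; [rewrite gt_eqF|exact: radius_continuous].
apply/funext => X; rewrite patchE; case: ifPn => // /negP rX.
have -> : radius X = 0.
  apply/eqP; rewrite eq_le radius_ge0 andbT leNgt; apply/negP => h.
  by apply: rX; rewrite inE.
by rewrite invr0 mulr0.
Qed.

Lemma measurable_velocity U V :
  measurable_fun (setT : set (measurableTypeR R * measurableTypeR R)) U ->
  measurable_fun (setT : set (measurableTypeR R * measurableTypeR R)) V ->
  [/\ measurable_fun3 setT (xc \o velocity U V), measurable_fun3 setT (yc \o velocity U V)
    & measurable_fun3 setT (zc \o velocity U V)].
Proof.
move=> mU mV; have mc := @measurable_cyl R.
have mVc := measurableT_comp mV mc.
split; first exact: (measurableT_comp mU mc).
- by apply: measurable_funM; [exact: mVc|exact: measurable_ratio continuous_yc].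
- by apply: measurable_funM; [exact: mVc|exact: measurable_ratio continuous_zc].
Qed.

End Cylindrical.

(** * The limit flow *)
Section Limit.
Context {R : realType} (p f : R -> R) (m : nat -> R) (Phi : nat -> space3 R -> R)
  (Un Vn : nat -> R * R -> R).
Hypotheses (hp : gas_law p) (hf : nozzle_profile f).
Hypothesis flows : forall n, subsonic_flow p f (m n) (Phi n) (Un n) (Vn n).
Local Notation D := (nozzle f).
Local Notation v n := (velocity (Un n) (Vn n)).
Hypothesis vcvg : {ae mu3 R, forall X, D X -> [/\ cvgn (fun n => xc (v n X)),
    cvgn (fun n => yc (v n X)) & cvgn (fun n => zc (v n X))]}.
Implicit Types (X Y : space3 R) (P : R * R) (eta phi : space3 R -> R).
Local Hint Resolve ex_axis ey_axis ez_axis : core.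
Notation M2 := (measurableTypeR R * measurableTypeR R)%type.

Definition good_set : set M2 :=
  (half_section f `&` [set P | cvgn (Un ^~ P)]) `&` (half_section f `&` [set P | cvgn (Vn ^~ P)]).

(** The limits, extended by 0 so that [limU ^+ 2 + limV ^+ 2 <= 1] holds
   everywhere. *)
Definition limU : R * R -> R := (fun P => limn (Un ^~ P)) \_ good_set.
Definition limV : R * R -> R := (fun P => limn (Vn ^~ P)) \_ good_set.
Local Notation vel := (velocity limU limV).

Lemma good_set_measurable : measurable good_set.
Proof.
have mH := half_section_measurable hf.
by apply: measurableI; apply: measurable_cvg_set => // n;
  have [h1 h2] := flow_UV_measurable hf (flows n).
Qed.

Lemma good_setP P : good_set P -> [/\ half_section f P, Un n P @[n --> \oo] --> limU P
  & Vn n P @[n --> \oo] --> limV P].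
Proof.
move=> GP; have [[hP cU] [_ cV]] := GP.
by split => //; rewrite /limU /limV patchE mem_set.
Qed.

Lemma limU_measurable : measurable_fun (setT : set M2) limU.
Proof.
apply: (measurable_fun_restrict good_set_measurable).
apply: (@measurable_fun_cvg _ _ _ _ Un) => [n|P GP]; last by case: GP => [[_ h] _].
have [h _] := flow_UV_measurable hf (flows n).
by apply: measurable_funS h => [|P [[]]] //; exact: half_section_measurable.
Qed.

Lemma limV_measurable : measurable_fun (setT : set M2) limV.
Proof.
apply: (measurable_fun_restrict good_set_measurable).
apply: (@measurable_fun_cvg _ _ _ _ Vn) => [n|P GP]; last by case: GP => [_ [_ h]].
have [_ h] := flow_UV_measurable hf (flows n).
by apply: measurable_funS h => [|P [[]]] //; exact: half_section_measurable.
Qed.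

Lemma cvg_sqr (u : nat -> R) (l : R) : u n @[n --> \oo] --> l -> u n ^+ 2 @[n --> \oo] --> l ^+ 2.
Proof. by move=> h; rewrite expr2; under eq_fun do rewrite expr2; exact: cvgM. Qed.

Lemma lim_speed_le1 P : limU P ^+ 2 + limV P ^+ 2 <= 1.
Proof.
have [GP|GP] := pselect (good_set P); last first.
  by rewrite /limU /limV !patchE memNset //= expr0n addr0 ler01.
have [hP cU cV] := good_setP GP.
have c : (Un n P ^+ 2 + Vn n P ^+ 2) @[n --> \oo] --> limU P ^+ 2 + limV P ^+ 2.
  exact: (cvgD (cvg_sqr cU) (cvg_sqr cV)).
apply: (ler_cvg_to c (cvg_cst (1 : R))); apply: nearW => n.
by apply: ltW; exact: (flow_UV_lt1 (flows n)).
Qed.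

(** Off the axis the radial component is the projection of the velocity on the
   unit vector [(0, y / r, z / r)]. *)
Lemma good_of_cvg X : D X -> 0 < radius X -> cvgn (fun n => xc (v n X)) ->
  cvgn (fun n => yc (v n X)) -> cvgn (fun n => zc (v n X)) -> good_set (cyl X).
Proof.
move=> DX r0 cx cy cz.
have hX : half_section f (cyl X) by apply/andP; split.
split; split => //=.
rewrite (_ : Vn ^~ (cyl X) = (fun n => (yc (v n X) * yc X + zc (v n X) * zc X) / radius X)).
  apply: is_cvgM; last exact: is_cvg_cst.
  by apply: is_cvgD; (apply: is_cvgM; last exact: is_cvg_cst).
by apply/funext => n; rewrite radial_velocity.
Qed.

Lemma ae_good_cyl : {ae mu3 R, forall X, D X -> 0 < radius X /\ good_set (cyl X)}.
Proof.
have [Z1 [mZ1 Z10 s1]] := vcvg; have [Z2 [mZ2 Z20 s2]] := @ae_off_axis R.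
exists (Z1 `|` Z2); split; first exact: measurableU.
  exact: (null_set_setU mZ1 mZ2 Z10 Z20).
move=> X nX; apply: contrapT => /not_orP[nZ1 nZ2]; apply: nX => DX.
have r0 : 0 < radius X by apply: contrapT => h; apply: nZ2; exact: s2.
split => //; have : D X -> [/\ cvgn (fun n => xc (v n X)),
    cvgn (fun n => yc (v n X)) & cvgn (fun n => zc (v n X))].
  by apply: contrapT => h; apply: nZ1; exact: s1.
by move=> /(_ DX)[cx cy cz]; exact: good_of_cvg.
Qed.

Lemma ae_good : {ae mu2 R, forall P, half_section f P -> good_set P}.
Proof.
pose N : set M2 := half_section f `\` good_set.
have mN : measurable N.
  by apply: measurableD; [exact: half_section_measurable|exact: good_set_measurable].
exists N; split => //; last by move=> P /= /not_implyP.
apply: null_of_cyl_null => //; first by move=> P [/andP[]].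
have [Z [mZ Z0 sub]] := ae_good_cyl.
apply: (subset_measure0 _ mZ _ Z0).
  by rewrite -(setTI (_ @^-1` _)); exact: measurable_cyl.
move=> X [/andP[r0 rf] nG]; apply: sub => /= h.
by case: (h rf).
Qed.

Lemma good_cvg X : D X -> 0 < radius X -> good_set (cyl X) ->
  [/\ xc (v n X) @[n --> \oo] --> xc (vel X), yc (v n X) @[n --> \oo] --> yc (vel X)
    & zc (v n X) @[n --> \oo] --> zc (vel X)].
Proof.
move=> DX r0 /good_setP[_ cU cV]; split; first exact: cU.
- by apply: cvgM; [exact: cV|exact: cvg_cst].
- by apply: cvgM; [exact: cV|exact: cvg_cst].
Qed.

Lemma dens_cvg (u : nat -> R) (l : R) : l <= 1 -> u n @[n --> \oo] --> l ->
  dens p (u n) @[n --> \oo] --> dens p l.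
Proof. by move=> l1 ul; apply: (continuous_cvg _ (dens_continuous hp l1)). Qed.

Lemma limit_profiles : {ae mu2 R, forall P, half_section f P ->
  [/\ Un n P @[n --> \oo] --> limU P, Vn n P @[n --> \oo] --> limV P,
      dens p (Un n P ^+ 2 + Vn n P ^+ 2) * Un n P @[n --> \oo]
        --> dens p (limU P ^+ 2 + limV P ^+ 2) * limU P &
      dens p (Un n P ^+ 2 + Vn n P ^+ 2) * Vn n P @[n --> \oo]
        --> dens p (limU P ^+ 2 + limV P ^+ 2) * limV P]}.
Proof.
apply: ae_sub ae_good => P G hP; have [_ cU cV] := good_setP (G hP).
have c : (Un n P ^+ 2 + Vn n P ^+ 2) @[n --> \oo] --> limU P ^+ 2 + limV P ^+ 2.
  exact: (cvgD (cvg_sqr cU) (cvg_sqr cV)).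
have cd := dens_cvg (lim_speed_le1 P) c.
by split; [exact: cU|exact: cV|exact: (cvgM cd cU)|exact: (cvgM cd cV)].
Qed.

Lemma test_function_C1 phi : test_function phi ->
  [/\ C1 setT phi, Ck 2 setT phi, compact (supp phi) & forall X, ~ supp phi X -> phi X = 0].
Proof.
move=> [ck cs]; split => //; first exact: Ck1_C1 (ck 1%N).
exact: compact_supp_zero.
Qed.

(** The curl vanishes for each flow, as its velocity is a gradient; the velocities
   are bounded by 1 and converge almost everywhere, so the limit inherits the
   equation by dominated convergence. *)
Lemma limit_curl_free a b (ca cb : space3 R -> R) :
  a \in [:: e_x; e_y; e_z] -> b \in [:: e_x; e_y; e_z] ->
  (forall n X, D X -> 'D_a (Phi n) X = ca (v n X) /\ 'D_b (Phi n) X = cb (v n X)) ->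
  (forall Y, dot3 Y Y <= 1 -> `|ca Y| <= 1 /\ `|cb Y| <= 1) ->
  (forall X, D X -> 0 < radius X -> good_set (cyl X) ->
    ca (v n X) @[n --> \oo] --> ca (vel X) /\ cb (v n X) @[n --> \oo] --> cb (vel X)) ->
  measurable_fun3 setT (ca \o vel) -> measurable_fun3 setT (cb \o vel) ->
  distr_eq D a (cb \o vel) b (ca \o vel).
Proof.
move=> aa ba dab cle clim mca mcb phi [tphi KD].
have [cphi c2 cK phi0] := test_function_C1 tphi.
have [A KA] := compact_in_box cK.
have [M M0 hM] := grad_bounded cK cphi phi0.
have mD : measurable3 D := nozzle_measurable hf.
have mder e : e \in [:: e_x; e_y; e_z] -> measurable_fun3 D ('D_e phi).
  move=> ea; apply: (continuous_measurable3 (nozzle_open hf)) => X _.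
  exact: (C1_der_continuous cphi).
have der0 e X : ~ supp phi X -> 'D_e phi X = 0 by exact: der_outside_compact.
pose u_ n X := 'D_a (Phi n) X * 'D_b phi X - 'D_b (Phi n) X * 'D_a phi X.
pose u X := ca (vel X) * 'D_b phi X - cb (vel X) * 'D_a phi X.
have I0 n : \int[mu3 R]_(X in D) u_ n X = 0.
  refine (etrans (@Rintegral_support _ D (u_ n) mD _) _).
    by move=> X DX; rewrite /u_ !der0 ?mulr0 ?subr0 // => /KD.
  have [cP _] := flow_C1 (flows n).
  apply: Rintegral_eq0.
  exact: (gradient_curl_free (nozzle_open hf) cK KD cP c2 phi0 aa ba).
have [iu cu] : (mu3 R).-integrable D (EFin \o u)
    /\ \int[mu3 R]_(X in D) u_ n X @[n --> \oo] --> \int[mu3 R]_(X in D) u X.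
  apply: (@box_dominated _ D u_ u A (M + M) mD).
  - move=> n; have [_ c2n] := flow_C1 (flows n).
    apply: (continuous_measurable3 (nozzle_open hf)) => X DX.
    apply: cvgB; apply: cvgM.
    + exact: (C1_continuous (c2n _ aa) DX).
    + exact: (C1_der_continuous cphi).
    + exact: (C1_continuous (c2n _ ba) DX).
    + exact: (C1_der_continuous cphi).
  - by apply: measurable_funB; apply: measurable_funM;
      [exact: measurable_funTS mca|exact: mder|exact: measurable_funTS mcb|exact: mder].
  - apply: ae_sub ae_good_cyl => X h DX; have [r0 G] := h DX; have [ka kb] := clim X DX r0 G.
    have -> : u_ ^~ X = (fun n => ca (v n X) * 'D_b phi X - cb (v n X) * 'D_a phi X).
      by apply/funext => n; rewrite /u_; have [-> ->] := dab n X DX.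
    by apply: cvgB; (apply: cvgM; last exact: cvg_cst).
  - move=> n X DX; rewrite /u_; have [-> ->] := dab n X DX.
    have [a1 b1] := cle _ (ltW (flow_speed_lt1_in (flows n) DX)).
    move: ('D_a phi X) ('D_b phi X) (hM X a aa) (hM X b ba) => s t sM tM.
    apply: le_trans (ler_normB _ _) _; rewrite !normrM; apply: lerD.
      by rewrite -[leRHS]mul1r ler_pM.
    by rewrite -[leRHS]mul1r ler_pM.
  - by move=> n X _ bX; rewrite /u_ !der0 ?mulr0 ?subr0 // => /KA.
refine (etrans (Rintegral_EFin mD iu) _); congr EFin.
have h0 : \int[mu3 R]_(X in D) u_ n X @[n --> \oo] --> (0 : R).
  by under eq_fun do rewrite I0; exact: cvg_cst.
exact: (cvg_unique (@Rhausdorff R) cu h0).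
Qed.

(** Clamping the squared speed at 1, where the density is continuous, changes
   nothing on the values taken by the limit. *)
Lemma limit_density_measurable : measurable_fun3 setT (flow_density p limU limV).
Proof.
have cd : continuous (fun s : R => dens p (Num.min s 1)).
  move=> s; apply: (@continuous_comp _ _ _ (fun s : R => Num.min s 1) (dens p)).
    by apply: continuous_min; [exact: cvg_id|exact: cvg_cst].
  by apply: (dens_continuous hp); rewrite ge_min lexx orbT.
have mq : measurable_fun (setT : set M2) (fun P => limU P ^+ 2 + limV P ^+ 2).
  by apply: measurable_funD; apply: measurable_funX;
    [exact: limU_measurable|exact: limV_measurable].
have := measurableT_comp (continuous_measurable_fun cd)
  (measurableT_comp mq (@measurable_cyl R)).
congr (measurable_fun _ _); apply/funext => X; rewrite /flow_density /=.
by rewrite min_l // lim_speed_le1.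
Qed.

(** Dominated convergence in [flow_weak_wall].  The convergence is strong, so it
   passes through the nonlinear density. *)
Lemma limit_weak eta : test_function eta ->
  (\int[mu3 R]_(X in D) (dot3 (flow_density p limU limV X *: vel X) (grad eta X))%:E = 0)%E.
Proof.
move=> teta; have [ceta _ cK eta0] := test_function_C1 teta.
have [A0 KA0] := compact_in_box cK.
pose A := Num.max A0 0; have A_ge0 : 0 <= A by rewrite le_max lexx orbT.
have KA X : ~ box A X -> ~ supp eta X.
  move=> bX KX; apply: bX; have /boxP[h1 h2 h3] := KA0 _ KX.
  by apply/boxP; split; rewrite le_max ?h1 ?h2 ?h3.
have [M M0 hM] := grad_bounded cK ceta eta0.
have mD : measurable3 D := nozzle_measurable hf.
have mder e : e \in [:: e_x; e_y; e_z] -> measurable_fun3 D ('D_e eta).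
  move=> ea; apply: (continuous_measurable3 (nozzle_open hf)) => X _.
  exact: (C1_der_continuous ceta).
have grad0 X : ~ supp eta X -> grad eta X = 0.
  by move=> KX; rewrite /grad !(der_outside_compact _ cK eta0 KX).
have [mv1 mv2 mv3] := measurable_velocity limU_measurable limV_measurable.
pose u_ n X := dot3 (mass_flux p (v n X)) (grad eta X).
pose u X := dot3 (flow_density p limU limV X *: vel X) (grad eta X).
have I0 n : \int[mu3 R]_(X in D) u_ n X = 0.
  by apply: (flow_weak_wall hp hf (flows n) A_ge0 ceta) => X /KA; exact: eta0.
have [iu cu] : (mu3 R).-integrable D (EFin \o u)
    /\ \int[mu3 R]_(X in D) u_ n X @[n --> \oo] --> \int[mu3 R]_(X in D) u X.
  apply: (@box_dominated _ D u_ u A (dens p 0 * (3 * M)) mD).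
  - move=> n; apply: (continuous_measurable3 (nozzle_open hf)) => X DX.
    by apply: (dot3_flux_continuous hp hf (flows n) DX);
      [apply: (C1_der_continuous ceta _ ex_axis)|apply: (C1_der_continuous ceta _ ey_axis)
      |apply: (C1_der_continuous ceta _ ez_axis)].
  - rewrite (_ : u = (fun X => flow_density p limU limV X * dot3 (vel X) (grad eta X))); last first.
      by apply/funext => X; rewrite /u dot3Zl.
    apply: measurable_funM; first exact: measurable_funTS limit_density_measurable.
    apply: measurable_funD; [apply: measurable_funD|].
    + by apply: measurable_funM; [exact: measurable_funTS mv1|exact: (mder _ ex_axis)].
    + by apply: measurable_funM; [exact: measurable_funTS mv2|exact: (mder _ ey_axis)].
    + by apply: measurable_funM; [exact: measurable_funTS mv3|exact: (mder _ ez_axis)].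
  - apply: ae_sub ae_good_cyl => X h DX; have [r0 G] := h DX.
    have [kx ky kz] := good_cvg DX r0 G; have [_ cU cV] := good_setP G.
    have c : (Un n (cyl X) ^+ 2 + Vn n (cyl X) ^+ 2) @[n --> \oo]
        --> limU (cyl X) ^+ 2 + limV (cyl X) ^+ 2.
      exact: (cvgD (cvg_sqr cU) (cvg_sqr cV)).
    have -> : u_ ^~ X = (fun n => dens p (Un n (cyl X) ^+ 2 + Vn n (cyl X) ^+ 2)
        * dot3 (v n X) (grad eta X)).
      by apply/funext => n; rewrite /u_ /mass_flux dot3Zl dot3_velocity.
    rewrite /u dot3Zl; apply: cvgM; first exact: (dens_cvg (lim_speed_le1 _) c).
    by apply: cvgD; [apply: cvgD|]; (apply: cvgM; last exact: cvg_cst).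
  - by move=> n X DX; apply: (flow_flux_bound hp (flows n) DX M0);
      [exact: hM _ ex_axis|exact: hM _ ey_axis|exact: hM _ ez_axis].
  - move=> n X _ /KA/grad0 g0; rewrite /u_ g0.
    by rewrite /dot3 /xc /yc /zc /= !mulr0 !addr0.
refine (etrans (Rintegral_EFin mD iu) _); congr EFin.
have h0 : \int[mu3 R]_(X in D) u_ n X @[n --> \oo] --> (0 : R).
  by under eq_fun do rewrite I0; exact: cvg_cst.
exact: (cvg_unique (@Rhausdorff R) cu h0).
Qed.

(** With zero divergence and zero normal flux, both sides of the Gauss-Green
   formula vanish. *)
Lemma limit_normal_trace :
  normal_trace f (fun X => flow_density p limU limV X *: vel X) (cst 0) (cst 0).
Proof.
have E eta : test_function eta ->
    (\int[mu3 R]_(X in D) (dot3 (flow_density p limU limV X *: vel X) (grad eta X)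
      + cst 0 X * eta X)%:E = 0)%E.
  move=> teta; refine (etrans _ (limit_weak teta)); apply: eq_integral => X _.
  by rewrite [cst 0 X]/(0 : R) mul0r addr0.
split; first by move=> phi [tphi _]; exact: E.
move=> eta teta; refine (etrans _ (esym (E _ teta))).
apply: integral0_eq => x _; apply: integral0_eq => t _.
by rewrite [cst 0 _]/(0 : R) !mul0r.
Qed.

End Limit.

Theorem theorem3 (R : realType) (p f : R -> R) (mhat : R) (m : nat -> R)
    (Phi : nat -> space3 R -> R) (Un Vn : nat -> R * R -> R)
    (hp : gas_law p) (hf : nozzle_profile f)
    (hmhat : critical_mass_flux p f mhat)
    (hm : forall n, 0 <= m n < mhat) (hmlim : m n @[n --> \oo] --> mhat)
    (hflow : forall n, subsonic_flow p f (m n) (Phi n) (Un n) (Vn n)) :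
  exists (sigma : nat -> nat) (U V : R * R -> R),
    [/\ forall i j : nat, (i < j)%N -> (sigma i < sigma j)%N,
        measurable_fun setT U, measurable_fun setT V &
        let q2n n P := Un n P ^+ 2 + Vn n P ^+ 2 in
        let q2 P := U P ^+ 2 + V P ^+ 2 in
        let rho := flow_density p U V in
        let vel := velocity U V in
        let D := nozzle f in
        [/\ {ae mu2 R, forall P, half_section f P ->
              [/\ Un (sigma n) P @[n --> \oo] --> U P,
                  Vn (sigma n) P @[n --> \oo] --> V P,
                  dens p (q2n (sigma n) P) * Un (sigma n) P @[n --> \oo]
                    --> dens p (q2 P) * U P &
                  dens p (q2n (sigma n) P) * Vn (sigma n) P @[n --> \oo]
                    --> dens p (q2 P) * V P]},
            [/\ distr_eq D e_y (xc \o vel) e_x (yc \o vel),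
                distr_eq D e_z (yc \o vel) e_y (zc \o vel) &
                distr_eq D e_x (zc \o vel) e_z (xc \o vel)],
            forall eta, test_function eta ->
              (\int[mu3 R]_(X in D) (dot3 (rho X *: vel X) (grad eta X))%:E
               = 0)%E &
            normal_trace f (fun X => rho X *: vel X) (cst 0) (cst 0)]].
Proof.
have [sigma1 s1 [Psi hPsi]] := potential_limit hf hflow.
have [tau t1 vcvg] := velocity_subsequence hp hf (fun n => hflow (sigma1 n)) hPsi.
pose sigma := sigma1 \o tau.
have hsigma : strictly_increasing sigma := strictly_increasing_comp s1 t1.
have flows n : subsonic_flow p f (m (sigma n)) (Phi (sigma n)) (Un (sigma n)) (Vn (sigma n)).
  exact: hflow.
pose U := limU f (Un \o sigma) (Vn \o sigma).
pose V := limV f (Un \o sigma) (Vn \o sigma).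
have mU := limU_measurable hf flows; have mV := limV_measurable hf flows.
have [v1 v2 v3] := measurable_velocity mU mV.
exists sigma, U, V; split => //.
split.
- exact: (limit_profiles hp hf flows vcvg).
- have der n X : nozzle f X -> [/\ 'D_e_x (Phi (sigma n)) X = xc (velocity (Un (sigma n)) (Vn (sigma n)) X),
      'D_e_y (Phi (sigma n)) X = yc (velocity (Un (sigma n)) (Vn (sigma n)) X)
    & 'D_e_z (Phi (sigma n)) X = zc (velocity (Un (sigma n)) (Vn (sigma n)) X)].
    by move=> DX; exact: (flow_der (flows n) DX).
  have le1 (Y : space3 R) := @coord_le1 R Y.
  split.
  + apply: (limit_curl_free hf flows vcvg ey_axis ex_axis) => //.
    * by move=> n X /(der n)[].
    * by move=> Y /le1[].
    * by move=> X DX r0 G; have [] := good_cvg DX r0 G.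
  + apply: (limit_curl_free hf flows vcvg ez_axis ey_axis) => //.
    * by move=> n X /(der n)[].
    * by move=> Y /le1[].
    * by move=> X DX r0 G; have [] := good_cvg DX r0 G.
  + apply: (limit_curl_free hf flows vcvg ex_axis ez_axis) => //.
    * by move=> n X /(der n)[].
    * by move=> Y /le1[].
    * by move=> X DX r0 G; have [] := good_cvg DX r0 G.
- by move=> eta; exact: (limit_weak hp hf flows vcvg).
- exact: (limit_normal_trace hp hf flows vcvg).
Qed.
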